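(* Suppose the sampling decisions are generated for all $n=0,1,2,\ldots$ by the cost-aware one-step lookahead acquisition rule $$(\theta^n,\tau^n,q^n)\in\operatorname*{arg\,max}_{\theta\in\bar\Theta,\ \tau\in\mathcal T,\ q\in\mathcal Q}\ \frac{\nu^n(\theta,\tau,q)}{q\,\tau},$$ and for each $N$ let the recommendation $\theta^N_{\mathrm{rec}}\in\operatorname*{arg\,max}_{\theta\in\bar\Theta}\mu^N(\theta,\tau_{\max})$. Then, almost surely, $$\lim_{N\to\infty} f(\theta^N_{\mathrm{rec}},\tau_{\max})=\max_{\theta\in\bar\Theta} f(\theta,\tau_{\max}).$$
   Context: Setting. $\Theta\subseteq\mathbb R^m$ is a parameter space, $\bar\Theta\subseteq\Theta$ is a finite nonempty subset (a discretization), $\mathcal T$ and $\mathcal Q$ are finite nonempty sets of positive integers (possible numbers of interactions and of replications), and $\tau_{\max}=\max\mathcal T$. Prior. $f:\Theta\times\mathcal T\to\mathbb R$ is a Gaussian process with mean function identically $0$ and covariance function (kernel) $k:(\Theta\times\mathcal T)\times(\Theta\times\mathcal T)\to\mathbb R$; $k$ is assumed to have continuous partial derivatives (in the $\Theta$-variables) up to fourth order. Observations. At each step $n=0,1,2,\ldots$ a triple $(\theta^n,\tau^n,q^n)\in\bar\Theta\times\mathcal T\times\mathcal Q$ is chosen as a function of the history $H^n=(\theta^0,\tau^0,q^0,y^1,\ldots,\theta^{n-1},\tau^{n-1},q^{n-1},y^n)$, and then one observes $$y^{n+1}=f(\theta^n,\tau^n)+\varepsilon^{n+1}_{\mathrm{env}}+\varepsilon^{n+1}_{\mathrm{rep}}(q^n),$$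 where the noise terms are independent of each other, across steps, and of $f$, and are normal with mean zero and variances $\sigma^2_{\mathrm{env}}$ and $\sigma^2_{\mathrm{rep}}/q^n$ respectively. The total noise variance $\lambda(\theta,\tau,q)=\sigma_{\mathrm{env}}^2+\sigma_{\mathrm{rep}}^2/q$ is strictly positive for every $q\in\mathcal Q$. Posterior. $\mathscr F^n$ is the $\sigma$-algebra generated by $H^n$, $\mathbb E_n=\mathbb E[\,\cdot\mid\mathscr F^n]$, $\mu^n(\theta,\tau)=\mathbb E_n[f(\theta,\tau)]$ is the posterior mean and $k^n((\theta,\tau),(\theta',\tau'))$ is the posterior covariance of $f(\theta,\tau)$ and $f(\theta',\tau')$ given $\mathscr F^n$ (so the posterior of $f$ is again a Gaussian process). Value of an evaluation. $\mu^n_*=\max_{\theta\in\bar\Theta}\mu^n(\theta,\tau_{\max})$ and $$\nu^n(\theta,\tau,q)=\mathbb E_n\bigl[\mu_*^{n+1}\mid \theta^n=\theta,\ \tau^n=\tau,\ q^n=q\bigr]-\mu_*^n,$$ i.e. the expected one-step increase of the maximal posterior mean at $\tau_{\max}$ if the next evaluation is $(\theta,\tau,q)$. *)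

(* Defs.v *)
(* Library: MathComp-Analysis. *)
From HB Require Import structures.
From mathcomp Require Import all_boot all_order all_algebra.
From mathcomp Require Import finmap.
From mathcomp Require Import all_classical all_reals all_analysis.

Set Implicit Arguments.
Unset Strict Implicit.
Unset Printing Implicit Defensive.

Import Order.TTheory GRing.Theory Num.Theory.
Import numFieldNormedType.Exports.

Local Open Scope classical_set_scope.
Local Open Scope ring_scope.

Section finite_maximization.
Variable R : realType.

(* The maximum of F over a nonempty finite set (junk value 0 on the empty set). *)
Definition fset_max (I : choiceType) (A : {fset I}) (F : I -> R) : R :=
  if enum_fset A is x :: s then \big[Num.max/F x]_(y <- s) F y else 0.

Definition is_argmax (I : Type) (A : set I) (F : I -> R) (x : I) : Prop :=
  A x /\ forall y, A y -> F y <= F x.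

End finite_maximization.

Section smooth_kernels.
Variable R : realType.

(* On an open set U, g has continuous partial derivatives up to order r. *)
Fixpoint continuous_partials (r n : nat) (U : set 'rV[R]_n)
    (g : 'rV[R]_n -> R) : Prop :=
  (forall x, U x -> {for x, continuous g}) /\
  if r is r'.+1 then
    forall i : 'I_n,
      (forall x, U x -> derivable g x (delta_mx 0 i)) /\
      continuous_partials r' U (fun x => 'D_(delta_mx 0 i) g x)
  else True.

(* The parameter set Theta is arbitrary, in particular not assumed open, so
   differentiability on Theta x Theta is that of an extension to an open
   neighbourhood; the pair (theta, theta') is the vector row_mx theta theta'. *)
Definition smooth_kernel (r m : nat) (Theta : set 'rV[R]_m) (T : {fset nat})
    (k : 'rV[R]_m * nat -> 'rV[R]_m * nat -> R) : Prop :=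
  forall t t' : nat, t \in T -> t' \in T ->
  exists (U : set 'rV[R]_(m + m)) (g : 'rV[R]_(m + m) -> R),
    [/\ open U,
        continuous_partials r U g &
        forall th th', Theta th -> Theta th' ->
          U (row_mx th th') /\ g (row_mx th th') = k (th, t) (th', t')].

End smooth_kernels.

Section probability_notions.
Context {d : measure_display} {Omega : measurableType d} {R : realType}.
Variable P : probability Omega R.

(* The second parameter is the variance. The library's normal_prob takes a
   standard deviation and is not a point mass when that is 0, hence the case
   distinction. *)
Definition gaussian_law (mean var : R) (A : set R) : \bar R :=
  if var == 0 then \d_mean A else normal_prob mean (Num.sqrt var) A.

Definition has_gaussian_law (X : Omega -> R) (mean var : R) : Prop :=
  forall A : set R, measurable A -> P (X @^-1` A) = gaussian_law mean var A.

Definition gaussian_process (I : Type) (D : set I) (f : I -> {RV P >-> R})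
    (mean : I -> R) (k : I -> I -> R) : Prop :=
  [/\ forall (n : nat) (x : 'I_n -> I) (c : 'I_n -> R),
        (forall i, D (x i)) ->
        exists mn v : R, 0 <= v /\
          has_gaussian_law (fun w => \sum_(i < n) c i * f (x i) w) mn v,
      forall x, D x -> ('E_P[f x] = (mean x)%:E)%E &
      forall x y, D x -> D y -> covariance P (f x) (f y) = (k x y)%:E].

Definition generated (I : Type) (D : set I) (X : I -> Omega -> R) :
    set (set Omega) :=
  <<s \bigcup_(i in D) preimage_set_system setT (X i) measurable >>.

Definition mutually_independent (I : eqType) (G : I -> set (set Omega)) : Prop :=
  forall (J : seq I) (A : I -> set Omega), uniq J ->
    (forall i, i \in J -> G i (A i)) ->
    P (\big[setI/setT]_(i <- J) A i) = (\prod_(i <- J) P (A i))%E.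

Definition is_cond_exp (G : set (set Omega)) (X Y : Omega -> R) : Prop :=
  [/\ forall B : set R, measurable B -> G (Y @^-1` B),
      P.-integrable setT (EFin \o Y) &
      forall A, G A ->
        (\int[P]_(w in A) (Y w)%:E = \int[P]_(w in A) (X w)%:E)%E].

(* An arbitrary but fixed version of E[X | G]. *)
Definition cond_exp (G : set (set Omega)) (X : Omega -> R) : Omega -> R :=
  xget (cst 0) [set Y | is_cond_exp G X Y].

End probability_notions.

(* An evaluation ((theta, tau), q). *)
Definition evaluation (R : realType) (m : nat) : Type := ('rV[R]_m * nat * nat)%type.

Definition evaluations (R : realType) (m : nat)
    (Theta : {fset 'rV[R]_m}) (T Q : {fset nat}) : set (evaluation R m) :=
  [set x | [/\ x.1.1 \in Theta, x.1.2 \in T & x.2 \in Q]].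

Definition tau_max (T : {fset nat}) : nat := (\max_(t <- T) t)%N.

Section sequential_sampling.
Context {d : measure_display} {Omega : measurableType d} {R : realType}.
Context {P : probability Omega R} {m : nat}.
(* eps_env n and eps_rep n q are the noise terms entering y^{n+1}. *)
Variables (f : 'rV[R]_m * nat -> {RV P >-> R})
  (eps_env : nat -> {RV P >-> R}) (eps_rep : nat -> nat -> {RV P >-> R}).

(* The noise (eps_rep n q)_q of one step is a single block: nothing is assumed
   about the joint law of replication noises of one step for different q, only
   one of which is ever observed. *)
Definition model_block (Theta : set 'rV[R]_m) (T Q : {fset nat})
    (b : unit + (nat + nat)) : set (set Omega) :=
  match b with
  | inl _ => generated [set x | Theta x.1 /\ x.2 \in T] f
  | inr (inl n) => generated [set n] eps_env
  | inr (inr n) => generated [set` Q] (eps_rep n)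
  end.

(* The value of y^{n+1} if the n-th evaluation is x. *)
Definition outcome (n : nat) (x : evaluation R m) (w : Omega) : R :=
  f x.1 w + eps_env n w + eps_rep n x.2 w.

(* A rule choosing the next evaluation from the past evaluations and their
   outcomes, listed chronologically. *)
Variable policy : seq (evaluation R m * R) -> evaluation R m.

Fixpoint history (n : nat) (w : Omega) : seq (evaluation R m * R) :=
  if n is n'.+1 then
    let h := history n' w in rcons h (policy h, outcome n' (policy h) w)
  else [::].

Definition decision (n : nat) (w : Omega) : evaluation R m :=
  policy (history n w).

(* The (random) observation y^{n+1}. *)
Definition observation (n : nat) (w : Omega) : R := outcome n (decision n w) w.

(* Decisions take finitely many values, so all their preimages are used. *)
Definition history_events (n : nat) : set (set Omega) :=
  \bigcup_(i in `I_n)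
    (preimage_set_system setT (decision i) setT `|`
     preimage_set_system setT (observation i) measurable).

Definition filtration (n : nat) : set (set Omega) := <<s history_events n >>.

Definition posterior_mean (n : nat) (x : 'rV[R]_m * nat) : Omega -> R :=
  cond_exp P (filtration n) (f x).

(* The information at time n+1 if the n-th evaluation is x, i.e. if y^{n+1} is
   outcome n x, and the resulting posterior mean. *)
Definition next_filtration (n : nat) (x : evaluation R m) : set (set Omega) :=
  <<s history_events n `|` preimage_set_system setT (outcome n x) measurable >>.

Definition next_posterior_mean (n : nat) (x : evaluation R m)
    (z : 'rV[R]_m * nat) : Omega -> R :=
  cond_exp P (next_filtration n x) (f z).

Variables (Theta : {fset 'rV[R]_m}) (T : {fset nat}).

Definition max_posterior_mean (n : nat) (w : Omega) : R :=
  fset_max Theta (fun th => posterior_mean n (th, tau_max T) w).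

Definition next_max_posterior_mean (n : nat) (x : evaluation R m)
    (w : Omega) : R :=
  fset_max Theta (fun th => next_posterior_mean n x (th, tau_max T) w).

Definition evaluation_value (n : nat) (x : evaluation R m) (w : Omega) : R :=
  cond_exp P (filtration n) (next_max_posterior_mean n x) w
  - max_posterior_mean n w.

Definition acquisition (n : nat) (w : Omega) (x : evaluation R m) : R :=
  evaluation_value n x w / (x.2%:R * x.1.2%:R).

End sequential_sampling.

(* Main.v *)
(* Conditionally on a path of evaluations the model is a Gaussian linear regression,
   so posterior means and variances are given by Gram-Schmidt residuals in L2. The
   maximal posterior mean is a submartingale bounded in mean, hence the expected gains
   of the chosen evaluations are summable; as the rule is a maximizer and costs are
   bounded, the expected gain of every fixed evaluation tends to 0. Where ts leads, the
   gain from evaluating at th or ts is at least the positive part of the change of the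
   mean of u = f th - f ts minus |mean of u|, and a Gaussian of variance at least beta
   exceeds M with definite weight. Hence the posterior variance of f th - f ts tends to
   0 in mean, first on the event that ts leads, and then, as some point always leads,
   for all pairs. Thus the posterior means of all differences converge in L1, and by
   Doob's maximal inequality almost surely, to the differences themselves. *)
Require Import Defs.
From HB Require Import structures.
From mathcomp Require Import all_boot all_order all_algebra.
From mathcomp Require Import finmap.
From mathcomp Require Import all_classical all_reals all_analysis.
From mathcomp Require Import measurable_realfun measurable_fun_approximation.
From mathcomp Require Import ring lra.
Set Implicit Arguments.
Unset Strict Implicit.
Unset Printing Implicit Defensive.
Import Order.TTheory GRing.Theory Num.Theory.
Import numFieldNormedType.Exports HBSimple HBNNSimple.
Local Open Scope classical_set_scope.
Local Open Scope ring_scope.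

(** * Expectations of integrable real random variables *)

Section expectation.
Context {d : measure_display} {Omega : measurableType d} {R : realType}.
Variable P : probability Omega R.
Implicit Types (X Y : Omega -> R) (a c : R).

(** Only differences can be expected to be learned: a shift common to all points moves the maximal
    mean by a term of zero conditional mean, so the rule has no incentive to explore it and the
    posterior variance of a single [f th] need not vanish. A recommendation only compares points, so
    differences suffice. The leader enters because a gain can be bounded below through a pair of
    points only if one of them realises the current maximum; a pair of trailing points is reached by
    comparing both with the leader.

    Conditioning is expressed by integrals over events. A path of evaluations takes finitely many
    values, and on the event that it equals [p] the adaptive history generates the same events as
    the linear span of the fixed outcomes of [p]. What has to be shown is that a Gaussian residual
    orthogonal to this span is independent of its events. The Gaussian assumption speaks of linear
    combinations only, that is, of Laplace transforms, and the passage from these to events is the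
    analytic core of the first part. *)

Definition L1 (X : Omega -> R) : Prop := P.-integrable setT (EFin \o X).

Definition Ex (X : Omega -> R) : R := Rintegral P setT X.

Lemma L1_measurable X : L1 X -> measurable_fun setT X.
Proof. by move=> /measurable_int/measurable_EFinP. Qed.

Lemma ExE X : L1 X -> (\int[P]_w (X w)%:E = (Ex X)%:E)%E.
Proof. by move=> X1; rewrite /Ex /Rintegral fineK//; exact: integrable_fin_num. Qed.

Lemma L1_ext X Y : (forall w, X w = Y w) -> L1 X -> L1 Y.
Proof. by move=> XY; rewrite (_ : X = Y)//; apply/funext. Qed.

Lemma Ex_ext X Y : (forall w, X w = Y w) -> Ex X = Ex Y.
Proof. by move=> XY; rewrite (_ : X = Y)//; apply/funext. Qed.

Lemma L1_le X Y : measurable_fun setT X -> (forall w, `|X w| <= Y w) ->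
  L1 Y -> L1 X.
Proof.
move=> mX XY; apply: le_integrable => //=; first exact/measurable_EFinP.
by move=> w _; rewrite lee_fin (le_trans (XY w)) ?ler_norm.
Qed.

Lemma L1_cst c : L1 (fun=> c).
Proof. exact: (finite_measure_integrable_cst P c). Qed.

Lemma L1Z a X : L1 X -> L1 (fun w => a * X w).
Proof. by move=> /(integrableZl measurableT a); apply: eq_integrable. Qed.

Lemma L1D X Y : L1 X -> L1 Y -> L1 (fun w => X w + Y w).
Proof. by move=> X1 Y1; have := integrableD measurableT X1 Y1; apply: eq_integrable. Qed.

Lemma L1N X : L1 X -> L1 (fun w => - X w).
Proof. by move=> /(L1Z (-1)); apply: L1_ext => w; rewrite mulN1r. Qed.

Lemma L1B X Y : L1 X -> L1 Y -> L1 (fun w => X w - Y w).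
Proof. by move=> X1 Y1; apply: L1D => //; exact: L1N. Qed.

Lemma L1_abs X : L1 X -> L1 (fun w => `|X w|).
Proof. by move=> X1; exact: integrable_norm. Qed.

Lemma L1_sum (I : Type) (s : seq I) (X : I -> Omega -> R) :
  (forall i, L1 (X i)) -> L1 (fun w => \sum_(i <- s) X i w).
Proof.
move=> X1; elim: s => [|i s ih].
  by apply: (L1_ext _ (L1_cst 0)) => w; rewrite big_nil.
by apply: (L1_ext _ (L1D (X1 i) ih)) => w; rewrite big_cons.
Qed.

Lemma L1_bdd X (M : R) : measurable_fun setT X -> (forall w, `|X w| <= M) -> L1 X.
Proof. by move=> mX XM; apply: L1_le (L1_cst M). Qed.

Lemma L1_mulb X Y (M : R) : measurable_fun setT Y -> (forall w, `|Y w| <= M) ->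
  L1 X -> L1 (fun w => X w * Y w).
Proof.
move=> mY YM X1; have := L1_measurable X1 => mX.
apply: (@L1_le _ (fun w => M * `|X w|)).
- exact: measurable_funM.
- by move=> w; rewrite normrM mulrC ler_wpM2r.
- exact/L1Z/L1_abs.
Qed.

Lemma measurable_indicR (A : set Omega) : measurable A ->
  measurable_fun setT (\1_A : Omega -> R).
Proof. by move=> mA; exact: measurable_indic. Qed.

Lemma indic_le1 (A : set Omega) w : `|(\1_A w : R)| <= 1.
Proof. by rewrite indicE; case: (_ \in _); rewrite ?normr1 ?normr0. Qed.

Lemma L1_ind X (A : set Omega) : measurable A -> L1 X -> L1 (fun w => X w * \1_A w).
Proof.
by move=> mA; apply: L1_mulb; [exact: measurable_indicR|exact: indic_le1].
Qed.

Lemma Ex_cst c : Ex (fun=> c) = c.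
Proof. by rewrite /Ex Rintegral_cst//= (_ : P _ = 1%E) ?mulr1//; exact: probability_setT. Qed.

Lemma ExZ a X : L1 X -> Ex (fun w => a * X w) = a * Ex X.
Proof. exact: RintegralZl. Qed.

Lemma ExZr a X : L1 X -> Ex (fun w => X w * a) = Ex X * a.
Proof. exact: RintegralZr. Qed.

Lemma ExD X Y : L1 X -> L1 Y -> Ex (fun w => X w + Y w) = Ex X + Ex Y.
Proof. exact: RintegralD. Qed.

Lemma ExB X Y : L1 X -> L1 Y -> Ex (fun w => X w - Y w) = Ex X - Ex Y.
Proof. exact: RintegralB. Qed.

Lemma Ex_sum (I : Type) (s : seq I) (X : I -> Omega -> R) :
  (forall i, L1 (X i)) -> Ex (fun w => \sum_(i <- s) X i w) = \sum_(i <- s) Ex (X i).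
Proof.
move=> X1; elim: s => [|i s ih].
  by under Ex_ext => w do rewrite big_nil; rewrite Ex_cst big_nil.
under Ex_ext => w do rewrite big_cons.
by rewrite ExD ?ih ?big_cons//; exact: L1_sum.
Qed.

Lemma Ex_le X Y : L1 X -> L1 Y -> (forall w, X w <= Y w) -> Ex X <= Ex Y.
Proof. by move=> X1 Y1 XY; exact: le_Rintegral. Qed.

Lemma Ex_ge0 X : (forall w, 0 <= X w) -> 0 <= Ex X.
Proof. by move=> X0; exact: Rintegral_ge0. Qed.

Lemma Ex_abs X : L1 X -> `|Ex X| <= Ex (fun w => `|X w|).
Proof. exact: le_normr_Rintegral. Qed.

Lemma Ex_indic (A : set Omega) : measurable A -> Ex (\1_A) = fine (P A).
Proof. by move=> mA; rewrite /Ex /Rintegral integral_indic// setIT. Qed.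

Lemma int_setE X (A : set Omega) : measurable A -> L1 X ->
  (\int[P]_(w in A) (X w)%:E = (Ex (fun w => X w * \1_A w))%:E)%E.
Proof.
move=> mA X1; rewrite integral_mkcond -ExE; last exact: L1_ind.
apply: eq_integral => w _; rewrite patchE indicE.
by case: ifP => _; rewrite ?mulr1 ?mulr0.
Qed.

Lemma Ex_ae X Y : L1 X -> L1 Y -> {ae P, forall w, X w = Y w} -> Ex X = Ex Y.
Proof.
move=> X1 Y1 XY; congr fine.
apply: ae_eq_integral => //.
- exact/measurable_EFinP/L1_measurable.
- exact/measurable_EFinP/L1_measurable.
- by apply: filterS XY => w -> _.
Qed.

Lemma Ex_le_ae X Y : L1 X -> L1 Y -> {ae P, forall w, X w <= Y w} -> Ex X <= Ex Y.
Proof.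
move=> X1 Y1 XY.
have m1 : L1 (fun w => Num.max (X w) (Y w)).
  apply: (L1_le _ _ (L1D (L1_abs X1) (L1_abs Y1))).
    by apply: measurable_maxr; exact: L1_measurable.
  by move=> w; rewrite /Num.max; case: ifP => _; rewrite ?lerDl ?lerDr.
rewrite (@Ex_ae Y (fun w => Num.max (X w) (Y w)))//.
- by apply: Ex_le => // w; rewrite le_max lexx.
- by apply: filterS XY => w XYw; rewrite max_r.
Qed.

Lemma Ex_dct (f_ : nat -> Omega -> R) (f g : Omega -> R) :
  (forall n, measurable_fun setT (f_ n)) ->
  (forall w, f_ ^~ w @ \oo --> f w) -> L1 g ->
  (forall n w, `|f_ n w| <= g w) ->
  L1 f /\ Ex (f_ n) @[n --> \oo] --> Ex f.
Proof.
move=> mf_ ff L1g fg.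
have mf : measurable_fun setT f.
  by apply: (@measurable_fun_cvg _ _ _ setT f_) => // w _; exact: ff.
have [|||||h1 _ h3] := @dominated_convergence _ _ _ P setT measurableT
   (fun n => EFin \o f_ n) (EFin \o f) (EFin \o g).
- by move=> n; exact/measurable_EFinP.
- exact/measurable_EFinP.
- by apply: aeW => w _; apply/cvg_EFin => /=; [exact: nearW|exact: ff].
- exact: L1g.
- by apply: aeW => w n _ /=; rewrite lee_fin.
split=> //; apply: fine_cvg; rewrite -/(Rintegral P setT f) -/(Ex f) -ExE//.
Qed.

(** The form in which orthogonality relations survive dominated limits. *)
Lemma Ex_cvg0 (f_ : nat -> Omega -> R) (f g : Omega -> R) :
  (forall n, measurable_fun setT (f_ n)) ->
  (forall w, f_ ^~ w @ \oo --> f w) -> L1 g ->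
  (forall n w, `|f_ n w| <= g w) -> (forall n, Ex (f_ n) = 0) ->
  L1 f /\ Ex f = 0.
Proof.
move=> mf ff L1g fg f0; have [L1f cf] := Ex_dct mf ff L1g fg.
split=> //; have := cvg_lim (@Rhausdorff R) cf => <-.
by under eq_fun do rewrite f0; exact: lim_cst.
Qed.

End expectation.

(** * Difference quotients of the exponential and polynomial approximation of the sign *)

Section real_sequences.
Variable R : realType.
Implicit Types x t : R.

Lemma expR_sub1_ub x : `|expR x - 1| <= `|x| * expR `|x|.
Proof.
have [x0|x0] := leP 0 x.
  rewrite (ger0_norm x0) ger0_norm ?subr_ge0 -?expR0 ?ler_expR//.
  have := expR_ge1Dx (- x); rewrite expRN => h.
  have e0 := expR_gt0 x.
  have : (1 + - x) * expR x <= 1 by rewrite -ler_pdivlMr// div1r.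
  rewrite expR0; lra.
rewrite (ltr0_norm x0) ler0_norm ?subr_le0 -?expR0 ?ler_expR ?(ltW x0)//.
have h := expR_ge1Dx x; have g : 1 <= expR (- x) by rewrite -expR0 ler_expR; lra.
by rewrite expR0; nra.
Qed.

(** The bound is free of [n], so it dominates the difference quotients when a Laplace transform is
    differentiated under the expectation. *)
Lemma expR_diff_quotient_ub t (n : nat) :
  `|(expR (n.+1%:R^-1 * t) - 1) * n.+1%:R| <= expR (2 * `|t|).
Proof.
have n1 : 1 <= n.+1%:R :> R by rewrite ler1n.
have n0 : 0 < n.+1%:R :> R by lra.
set h := n.+1%:R^-1 * t.
have ht : `|h| = n.+1%:R^-1 * `|t| by rewrite normrM gtr0_norm// invr_gt0.
have hle : `|h| <= `|t| by rewrite ht ler_piMl// invf_le1.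
rewrite normrM (gtr0_norm n0) (le_trans (ler_wpM2r (ltW n0) (expR_sub1_ub h)))//.
rewrite ht mulrAC [_ * n.+1%:R]mulrC mulrA divff ?gt_eqF// mul1r -ht.
rewrite mulr_natl mulr2n expRD ler_pM ?expR_ge0// ?ler_expR//.
by have := expR_ge1Dx `|t|; lra.
Qed.

Lemma cvg_invS : n.+1%:R^-1 @[n --> \oo] --> (0 : R).
Proof. exact: (@cvg_harmonic R). Qed.

(** With [h = t / c n], the inequality [1 + x <= expR x] at [h] and at [- h] gives
    [h <= expR h - 1 <= h * expR h]; multiplication by [c n] squeezes the quotient. A general [c]
    covers both [n.+1] and its square. *)
Lemma expR_diff_quotient_cvg (c : nat -> R) t : (forall n, 0 < c n) ->
  (c n)^-1 @[n --> \oo] --> 0 ->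
  (expR ((c n)^-1 * t) - 1) * c n @[n --> \oo] --> t.
Proof.
move=> c0 cV0.
apply: (@squeeze_cvgr _ _ _ _ (fun=> t) (fun n => t * expR ((c n)^-1 * t))).
- apply: nearW => n; set h := _ * t.
  have -> : t = c n * h by rewrite /h mulrA divff ?mul1r// gt_eqF.
  rewrite [_ * c n]mulrC -mulrA !ler_pM2l//.
  have := expR_ge1Dx h; have := expR_ge1Dx (- h); rewrite expRN => h1 h2.
  have e0 := expR_gt0 h.
  have h3 : (1 + - h) * expR h <= 1 by rewrite -ler_pdivlMr// div1r.
  by apply/andP; split; lra.
- exact: cvg_cst.
- rewrite -[X in _ --> X]mulr1; apply: cvgMl_tmp; rewrite -[X in _ --> X]expR0.
  apply: continuous_cvg; first exact: continuous_expR.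
  by rewrite -[X in _ --> X](mul0r t); apply: cvgMr_tmp.
Qed.

(** An odd cubic that maps [[-1, 1]] to itself, fixes -1, 0 and 1, repels 0 and attracts the other
    two; its iterates approximate the sign. Being a polynomial, it preserves every algebra of
    functions that contains the constants. *)
Definition smoothstep x : R := (3 * x - x ^+ 3) / 2.

Lemma smoothstep_le1 x : `|x| <= 1 -> `|smoothstep x| <= 1.
Proof.
rewrite /smoothstep !ler_norml => /andP[x1 x2]; apply/andP; split.
  have : 0 <= (x + 1) ^+ 2 * (2 - x) by rewrite mulr_ge0 ?sqr_ge0//; lra.
  rewrite !expr2 !exprS expr0; lra.
have : 0 <= (1 - x) ^+ 2 * (2 + x) by rewrite mulr_ge0 ?sqr_ge0//; lra.
rewrite !expr2 !exprS expr0; lra.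
Qed.

Lemma iter_smoothstep_le1 n x : `|x| <= 1 -> `|iter n smoothstep x| <= 1.
Proof. by move=> x1; elim: n => //= n ih; exact: smoothstep_le1. Qed.

Lemma iter_smoothstepN n x : iter n smoothstep (- x) = - iter n smoothstep x.
Proof.
by elim: n => //= n ->; rewrite /smoothstep; field.
Qed.

Lemma iter_smoothstep_cvg1 x : 0 < x -> x <= 1 ->
  iter n smoothstep x @[n --> \oo] --> (1 : R).
Proof.
move=> x0 x1.
(* [1 - smoothstep y] equals [1 - y] times [1 - (y + y ^ 2) / 2], so the gap to 1 shrinks at least
   by the factor [1 - x / 2] as long as [x <= y <= 1]. *)
have H n : x <= iter n smoothstep x <= 1 /\
    1 - iter n smoothstep x <= (1 - x / 2) ^+ n.
  elim: n => [|n [/andP[ih1 ih2] ih3]] /=; first by rewrite lexx x1 expr0; split=> //; lra.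
  set y := iter n smoothstep x in ih1 ih2 ih3 *.
  have y2 : y ^+ 3 <= y by rewrite exprS ler_piMr ?exprn_ile1//; lra.
  have yy : 0 <= (1 - y) * (y ^+ 2 + y - x).
    by rewrite mulr_ge0//; have := sqr_ge0 y; lra.
  split.
    apply/andP; split; first by rewrite /smoothstep; lra.
    have : 0 <= (1 - y) ^+ 2 * (2 + y) by rewrite mulr_ge0 ?sqr_ge0//; lra.
    by rewrite /smoothstep !expr2 !exprS expr0; lra.
  rewrite exprS; apply: (@le_trans _ _ ((1 - x / 2) * (1 - y))).
    by move: yy; rewrite /smoothstep !expr2 !exprS expr0; lra.
  by rewrite ler_wpM2l//; lra.
apply: (@squeeze_cvgr _ _ _ _ (fun n => 1 - (1 - x / 2) ^+ n) (fun=> 1)).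
- by apply: nearW => n; have [/andP[_ ->]] := H n; rewrite andbT; lra.
- rewrite -[X in _ --> X]subr0; apply: cvgB; [exact: cvg_cst|apply: cvg_expr].
  by rewrite ger0_norm; lra.
- exact: cvg_cst.
Qed.

Lemma iter_smoothstep_cvg x : `|x| <= 1 ->
  iter n smoothstep x @[n --> \oo] --> Num.sg x.
Proof.
move=> x1; have [x0|x0|->] := ltrgt0P x.
- by rewrite gtr0_sg//; apply: iter_smoothstep_cvg1 => //; rewrite -(gtr0_norm x0).
- rewrite ltr0_sg// (_ : (fun n => _) = fun n => - iter n smoothstep (- x)).
    2: by apply/funext => n; rewrite iter_smoothstepN opprK.
  apply: cvgN; apply: iter_smoothstep_cvg1; first by rewrite oppr_gt0.
  by rewrite -(ltr0_norm x0).
- rewrite sgr0 (_ : (fun n => _) = fun=> 0); first exact: cvg_cst.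
  apply/funext; elim=> //= n ->.
  by rewrite /smoothstep expr0n/= mulr0 subrr mul0r.
Qed.

(** Brings an unbounded [x] into [[-1, 1]], where the iterates of [smoothstep] converge, without
    losing its sign in the limit. *)
Lemma sgr_sin_cvg x : Num.sg (sin (n.+1%:R^-1 * x)) @[n --> \oo] --> Num.sg x.
Proof.
have E u : `|u| < pi -> Num.sg (sin u) = Num.sg u :> R.
  have [u0|u0|->] := ltrgt0P u; last by rewrite sin0.
  - by move=> up; rewrite !gtr0_sg// sin_gt0_pi// u0.
  - move=> up; rewrite !ltr0_sg//.
    by rewrite -[u]opprK sinN oppr_lt0 sin_gt0_pi// oppr_gt0 u0.
apply: cvg_near_cst.
have c0 : n.+1%:R^-1 * x @[n --> \oo] --> (0 : R).
  by rewrite -(mul0r x); apply: cvgMr_tmp; exact: cvg_invS.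
have : \forall n \near \oo, `|n.+1%:R^-1 * x| < pi.
  by apply: (cvgr0_norm_lt _ c0); exact: pi_gt0.
apply: filterS => n /= hn.
by rewrite E// sgrM gtr0_sg ?mul1r// invr_gt0.
Qed.

End real_sequences.

(** * From Laplace transforms to events: weights orthogonal to all exponentials of a linear space *)

Section exponentially_null_weights.
Context {d : measure_display} {Omega : measurableType d} {R : realType}.
Variables (P : probability Omega R) (S : set (Omega -> R)).
Hypotheses (S0 : S (fun=> 0))
  (SD : forall a T T', S T -> S T' -> S (fun w => a * T w + T' w))
  (mS : forall T, S T -> measurable_fun setT T).
Implicit Types (W T g : Omega -> R).

(* Difference quotients of a -> e^(aT) turn a null weight W into W T, power series
   into W sin T, and iterating a smooth step on sin(T / n) into W sgn T; so W is
   orthogonal to every event generated by S. *)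
Definition exp_null W := measurable_fun setT W /\
  forall T, S T -> L1 P (fun w => W w * expR (T w)) /\
                   Ex P (fun w => W w * expR (T w)) = 0.

Lemma spanZ a T : S T -> S (fun w => a * T w).
Proof.
by move=> ST; rewrite (_ : (fun w => _) = (fun w => a * T w + 0));
  [exact: SD|apply/funext => w; rewrite addr0].
Qed.

Lemma exp_null_L1 W : exp_null W -> L1 P W /\ Ex P W = 0.
Proof.
move=> [_ /(_ _ S0)[h1 h2]]; split.
  by apply: L1_ext h1 => w; rewrite expR0 mulr1.
by rewrite -h2; apply: Ex_ext => w; rewrite expR0 mulr1.
Qed.

Lemma exp_nullM_exp W T : exp_null W -> S T -> exp_null (fun w => W w * expR (T w)).
Proof.
move=> [mW nW] ST; split.
  by apply: measurable_funM => //; apply: measurableT_comp => //; exact: mS.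
move=> T' ST'.
have -> : (fun w => W w * expR (T w) * expR (T' w)) =
          (fun w => W w * expR (1 * T w + T' w)).
  by apply/funext => w; rewrite mul1r expRD mulrA.
exact/nW/SD.
Qed.

(** [expR |T|] is at most [expR T + expR (- T)], and [S] contains [- T]. This is the dominating
    function of the limits taken in [T]. *)
Lemma exp_null_L1_expabs W T : exp_null W -> S T ->
  L1 P (fun w => `|W w| * expR `|T w|).
Proof.
move=> nW ST; have [mW _] := nW.
have [h1 _] := exp_null_L1 (exp_nullM_exp nW ST).
have [h2 _] := exp_null_L1 (exp_nullM_exp nW (spanZ (-1) ST)).
apply: (L1_le _ _ (L1D (L1_abs h1) (L1_abs h2))).
  apply: measurable_funM; first exact: measurableT_comp.
  by do 2 apply: measurableT_comp => //; exact: mS.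
move=> w; rewrite !normrM normr_id ![ `|expR _| ]ger0_norm ?expR_ge0//.
rewrite -mulrDr ler_wpM2l// mulN1r.
by have [_|_] := ger0P (T w); rewrite ?lerDl ?lerDr expR_ge0.
Qed.

Lemma exp_nullM W T : exp_null W -> S T -> exp_null (fun w => W w * T w).
Proof.
move=> + ST.
(* It is enough that the expectation vanishes for every null weight: the full claim follows with
   [W * expR T'] in place of [W]. *)
suff H W' : exp_null W' -> L1 P (fun w => W' w * T w) /\ Ex P (fun w => W' w * T w) = 0.
  move=> nW; split; first by apply: measurable_funM; [exact: nW.1|exact: mS].
  move=> T' ST'; have := H _ (exp_nullM_exp nW ST').
  by rewrite (_ : (fun w => W w * T w * _) = (fun w => W w * expR (T' w) * T w))//;
    apply/funext => w; rewrite mulrAC.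
move=> nW; have [mW _] := nW; have mT := mS ST.
have H0 n : L1 P (fun w => W' w * expR (n.+1%:R^-1 * T w)) /\
    Ex P (fun w => W' w * expR (n.+1%:R^-1 * T w)) = 0.
  exact: exp_null_L1 (exp_nullM_exp nW (spanZ n.+1%:R^-1 ST)).
have [L1W EW] := exp_null_L1 nW.
apply: (@Ex_cvg0 _ _ _ P
  (fun n w => W' w * ((expR (n.+1%:R^-1 * T w) - 1) * n.+1%:R)) _
  (fun w => `|W' w| * expR `|2 * T w|)).
- move=> n; apply: measurable_funM => //; apply: measurable_funM => //.
  apply: measurable_funB => //; apply: measurableT_comp => //.
  exact: measurable_funM.
- move=> w; apply: cvgMl_tmp.
  by apply: (@expR_diff_quotient_cvg _ (fun n => n.+1%:R)) => //; exact: cvg_invS.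
- exact: exp_null_L1_expabs nW (spanZ 2 ST).
- move=> n w; rewrite normrM ler_wpM2l// (le_trans (expR_diff_quotient_ub _ _))//.
  by rewrite normrM [ `|2| ]ger0_norm.
- move=> n; have [h1 h2] := H0 n.
  rewrite (_ : (fun w => _) = fun w =>
      n.+1%:R * (W' w * expR (n.+1%:R^-1 * T w) - W' w)); last first.
    by apply/funext => w; ring.
  by rewrite ExZ ?ExB ?h2 ?EW ?subrr ?mulr0//; exact: L1B.
Qed.

Lemma exp_nullM_pow W T n : exp_null W -> S T -> exp_null (fun w => W w * T w ^+ n).
Proof.
move=> nW ST; elim: n => [|n ih].
  by rewrite (_ : (fun w => _) = W)//; apply/funext => w; rewrite expr0 mulr1.
have := exp_nullM ih ST.
by rewrite (_ : (fun w => _ * T w) = (fun w => W w * T w ^+ n.+1))//;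
  apply/funext => w; rewrite exprSr mulrA.
Qed.

(** Orthogonality is required for all null weights at once, not for one fixed weight. This makes the
    class stable under products, since a null weight times such a function is again a null
    weight. *)
Definition null_mult g := [/\ measurable_fun setT g, exists M : R, forall w, `|g w| <= M &
  forall W, exp_null W -> Ex P (fun w => W w * g w) = 0].

Lemma null_multM_null g W : null_mult g -> exp_null W -> exp_null (fun w => W w * g w).
Proof.
move=> [mg [M gM] g0] nW; have [mW _] := nW.
split; first exact: measurable_funM.
move=> T ST; have nWT := exp_nullM_exp nW ST.
have E : (fun w => W w * g w * expR (T w)) = (fun w => W w * expR (T w) * g w).
  by apply/funext => w; rewrite mulrAC.
rewrite E g0//; split=> //.
by apply: L1_mulb gM _ => //; exact: (exp_null_L1 nWT).1.
Qed.

Lemma null_mult_cst c : null_mult (fun=> c).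
Proof.
split; [exact: measurable_cst|by exists `|c| |].
by move=> W /exp_null_L1[h1 h2]; rewrite ExZr// h2 mul0r.
Qed.

Lemma null_multD g h : null_mult g -> null_mult h -> null_mult (fun w => g w + h w).
Proof.
move=> [mg [M gM] g0] [mh [N hN] h0]; split; first exact: measurable_funD.
  by exists (M + N) => w; rewrite (le_trans (ler_normD _ _))// lerD.
move=> W nW; have [L1W _] := exp_null_L1 nW.
under Ex_ext => w do rewrite mulrDr.
by rewrite ExD ?g0 ?h0 ?addr0//; [exact: L1_mulb gM L1W|exact: L1_mulb hN L1W].
Qed.

Lemma null_multM g h : null_mult g -> null_mult h -> null_mult (fun w => g w * h w).
Proof.
move=> ng [mh [N hN] h0]; have [mg [M gM] g0] := ng.
split; first exact: measurable_funM.
  exists (M * N) => w; rewrite normrM ler_pM//.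
move=> W nW; under Ex_ext => w do rewrite mulrA.
exact/h0/null_multM_null.
Qed.

Lemma null_mult_lim (g_ : nat -> Omega -> R) g (M : R) :
  (forall n, null_mult (g_ n)) -> (forall w, g_ ^~ w @ \oo --> g w) ->
  (forall n w, `|g_ n w| <= M) -> null_mult g.
Proof.
move=> ng cg gM.
have mg : measurable_fun setT g.
  apply: (@measurable_fun_cvg _ _ _ setT g_) => // n.
  by have [] := ng n.
split=> //.
  exists M => w; have /cvg_norm cgw := cg w.
  by apply: (cvgr_to_le cgw); exact: nearW.
move=> W nW; have [mW _] := nW; have [L1W _] := exp_null_L1 nW.
have [|||||_ ->//] := @Ex_cvg0 _ _ _ P (fun n w => W w * g_ n w) (fun w => W w * g w)
  (fun w => M * `|W w|).
- by move=> n; apply: measurable_funM => //; have [] := ng n.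
- by move=> w; apply: cvgMl_tmp; exact: cg.
- exact/L1Z/L1_abs.
- by move=> n w; rewrite normrM mulrC ler_wpM2r.
- by move=> n; have [_ _ ->] := ng n.
Qed.

(** Coefficients at most [1 / k!] keep the partial sums below [expR |T|], and each monomial in [T]
    turns a null weight into a null weight, so the series can be integrated term by term.
    Boundedness of [F] is a separate assumption because the partial sums are polynomials. *)
Lemma null_mult_entire (c : nat -> R) (F : R -> R) (M : R) T :
  (forall k, `|c k| <= k`!%:R^-1) ->
  (forall x, series (fun k => c k * x ^+ k) @ \oo --> F x) ->
  (forall x, `|F x| <= M) -> S T -> null_mult (F \o T).
Proof.
move=> hc cF FM ST; have mT := mS ST.
have mf n : measurable_fun setT (fun w => series (fun k => c k * T w ^+ k) n).
  rewrite /series/=; apply: measurable_sum => k.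
  by apply: measurable_funM => //; exact: measurable_funX.
split.
- apply: (@measurable_fun_cvg _ _ _ setT
    (fun n w => series (fun k => c k * T w ^+ k) n)) => //.
- by exists M => w; exact: FM.
move=> W nW; have [mW _] := nW; have [L1W _] := exp_null_L1 nW.
have [|||||_ ->//] := @Ex_cvg0 _ _ _ P (fun n w => W w * series (fun k => c k * T w ^+ k) n)
  (fun w => W w * F (T w)) (fun w => `|W w| * expR `|T w|).
- by move=> n; exact: measurable_funM.
- by move=> w; apply: cvgMl_tmp; exact: cF.
- exact: exp_null_L1_expabs.
- move=> n w; rewrite normrM ler_wpM2l// /series/=.
  apply: (@le_trans _ _ (series (exp_coeff `|T w|) n)).
    rewrite /series/= (le_trans (ler_norm_sum _ _ _))//.
    apply: ler_sum => k _; rewrite normrM normrX /exp_coeff/= mulrC.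
    by rewrite ler_wpM2l// exprn_ge0.
  apply: nondecreasing_cvgn_le; last exact: is_cvg_series_exp_coeff.
  by apply: nondecreasing_series => k _ _; exact: exp_coeff_ge0.
- move=> n; rewrite /series/=.
  rewrite (_ : (fun w => _) = (fun w => \sum_(0 <= k < n) c k * (W w * T w ^+ k))).
    rewrite Ex_sum.
      apply: big1 => k _; have [h1 h2] := exp_null_L1 (exp_nullM_pow k nW ST).
      by rewrite ExZ// h2 mulr0.
    by move=> k; have [h1 h2] := exp_null_L1 (exp_nullM_pow k nW ST); exact: L1Z.
  by apply/funext => w; rewrite mulr_sumr; apply: eq_bigr => k _; ring.
Qed.

Lemma null_mult_cos T : S T -> null_mult (fun w => cos (T w)).
Proof.
apply: (@null_mult_entire (fun n => (~~ odd n)%:R * (-1) ^+ n./2 * (n`!%:R)^-1) _ 1).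
- move=> k; rewrite !normrM normrX normrN normr1 expr1n mulr1.
  by rewrite [X in _ * X]ger0_norm ?invr_ge0// ler_piMl ?invr_ge0//; case: odd; rewrite ?normr1 ?normr0.
- by move=> x; rewrite -cos_coeffE unlock; exact: is_cvg_series_cos_coeff.
- exact: cos_max.
Qed.

Lemma null_mult_sin T : S T -> null_mult (fun w => sin (T w)).
Proof.
apply: (@null_mult_entire (fun n => (odd n)%:R * (-1) ^+ n.-1./2 * (n`!%:R)^-1) _ 1).
- move=> k; rewrite !normrM normrX normrN normr1 expr1n mulr1.
  by rewrite [X in _ * X]ger0_norm ?invr_ge0// ler_piMl ?invr_ge0//; case: odd; rewrite ?normr1 ?normr0.
- by move=> x; rewrite -sin_coeffE unlock; exact: is_cvg_series_sin_coeff.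
- exact: sin_max.
Qed.

Lemma null_mult_sg g : null_mult g -> (forall w, `|g w| <= 1) ->
  null_mult (fun w => Num.sg (g w)).
Proof.
move=> ng g1; have := @null_mult_lim (fun n w => iter n (@smoothstep R) (g w)) (fun w => Num.sg (g w)) 1; apply.
- elim=> [|n ih] //=.
  have h := null_multM ih (null_multM ih ih).
  have := null_multD (null_multM (null_mult_cst (3 / 2)) ih)
                     (null_multM (null_mult_cst (- 2^-1)) h).
  set F := (X in null_mult X -> _); set G := (X in _ -> null_mult X).
  suff -> : F = G by [].
  by apply/funext => w; rewrite /F /G /smoothstep; field.
- by move=> w; exact: iter_smoothstep_cvg.
- by move=> n w; exact: iter_smoothstep_le1.
Qed.

Lemma null_mult_gt T a : S T -> null_mult (\1_[set w | a < T w]).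
Proof.
move=> ST.
have sg : null_mult (fun w => Num.sg (T w - a)).
  have := @null_mult_lim (fun n w => Num.sg (sin (n.+1%:R^-1 * (T w - a)))) (fun w => Num.sg (T w - a)) 1; apply.
  - move=> n; apply: null_mult_sg; last by move=> w; exact: sin_max.
    have STn := spanZ n.+1%:R^-1 ST; set b := n.+1%:R^-1 in STn *.
    (* [S] is not assumed to contain constants, so the shift by [a] is carried out by the addition
       formula of the sine. *)
    have := null_multD (null_multM (null_mult_sin STn) (null_mult_cst (cos (b * a))))
              (null_multM (null_mult_cos STn) (null_mult_cst (- sin (b * a)))).
    set F := (X in null_mult X -> _); set G := (X in _ -> null_mult X).
    suff -> : F = G by [].
    by apply/funext => w; rewrite /F /G mulrBr sinB mulrN.
  - by move=> w; exact: sgr_sin_cvg.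
  - by move=> n w; rewrite normr_sg; case: eqP.
(* The indicator of [y > 0] is half the sum of the sign of [y] and its square. *)
have := null_multM (null_mult_cst 2^-1) (null_multD sg (null_multM sg sg)).
set F := (X in null_mult X -> _); set G := (X in _ -> null_mult X).
suff -> : F = G by [].
apply/funext => w; rewrite /F /G indicE.
have -> : (w \in [set w | a < T w]) = (a < T w).
  by apply/idP/idP => [/set_mem|h]; last exact/mem_set.
rewrite -subr_gt0; have [h|h|->] := ltrgt0P (T w - a).
- by rewrite (gtr0_sg h) mulr1n; field.
- by rewrite (ltr0_sg h) mulr0n; ring.
- by rewrite sgr0 mulr0n; ring.
Qed.

Definition sigma_span := <<s \bigcup_(T in S) preimage_set_system setT T measurable >>.

(** Products, sums and constants give complements and finite unions of events; bounded limits give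
    the countable unions. *)
Lemma null_mult_sigma_algebra : sigma_algebra setT [set A | null_mult (\1_A)].
Proof.
split=> /=.
- by rewrite indic0; exact: null_mult_cst.
- move=> A nA; rewrite setTD.
  have := null_multD (null_mult_cst 1) (null_multM (null_mult_cst (-1)) nA).
  set F := (X in null_mult X -> _); suff -> : F = \1_(~` A) by [].
  by apply/funext => w; rewrite /F !indicE in_setC; case: (_ \in _) => /=; ring.
- move=> A nA.
  have nU n : null_mult (\1_(\bigcup_(i in `I_n) A i)).
    elim: n => [|n ih].
      by rewrite II0 bigcup_set0 indic0; exact: null_mult_cst.
    have := null_multD (nA n) (null_multD ih
      (null_multM (null_mult_cst (-1)) (null_multM (nA n) ih))).
    set F := (X in null_mult X -> _); set G := (X in _ -> null_mult X).
    suff -> : F = G by [].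
    apply/funext => w; rewrite /F /G IIS bigcup_setU bigcup_set1 !indicE in_setU.
    by case: (w \in A n); case: (w \in \bigcup_(i in `I_n) A i) => /=; ring.
  apply: (null_mult_lim nU) => [w|n w]; last exact: indic_le1.
  apply: cvg_near_cst; have [[i _ Aiw]|h] := pselect ((\bigcup_i A i) w).
    exists i.+1 => // n /= ilen; rewrite !indicE !mem_set//; last by exists i.
    by exists i.
  apply: nearW => n; rewrite !indicE !memNset//.
  by move=> [i _ Aiw]; apply: h; exists i.
Qed.

Lemma exp_null_sigma W A : exp_null W -> sigma_span A -> Ex P (fun w => W w * \1_A w) = 0.
Proof.
move=> nW SA; suff [_ _] : null_mult (\1_A) by exact.
apply: (smallest_sub null_mult_sigma_algebra _ SA) => B [T ST [C mC <-]].
rewrite setTI.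
(* Open right rays generate the Borel sets, and their preimages under [T] are the events of
   [null_mult_gt]. *)
have {mC} : <<s @RGenOInfty.G R >> C by move: mC; rewrite [X in X C -> _](@RGenOInfty.measurableE R).
apply: (@smallest_sub _ (sigma_algebra setT) _ [set C | null_mult (\1_(T @^-1` C))]).
  have [h0 hC hU] := null_mult_sigma_algebra; split=> /=.
  - by rewrite preimage_set0.
  - by move=> D nD; rewrite setTD preimage_setC -setTD; exact: hC.
  - by move=> D nD; rewrite preimage_bigcup; exact: hU.
move=> _ [a ->] /=.
rewrite (_ : _ @^-1` _ = [set w | a < T w]); first exact: null_mult_gt.
by apply/seteqP; split=> w /=; rewrite in_itv/= andbT.
Qed.

End exponentially_null_weights.

(** * A minorant of the positive part with an explicit Gaussian mean *)

Section tilting.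
Variable R : realType.

(* A quadratic in e^(sz) that lies below a multiple of the positive part of
   z - M, and whose mean under N(0, v) is at least 1 for all v in [beta, B]. *)
Lemma exp_quadratic_pos_part (M beta B : R) : 0 <= M -> 0 < beta ->
  exists s u0 u1 : R, [/\ 0 < s, 0 < u1,
    forall v, beta <= v <= B ->
      1 <= (u0 + u1) * expR (s ^+ 2 * v / 2) - expR ((2 * s) ^+ 2 * v / 2) - u0 * u1 &
    forall z, (u0 + u1) * expR (s * z) - expR (2 * s * z) - u0 * u1
      <= s * u1 ^+ 2 * Num.max (z - M) 0].
Proof.
(* [s] is so large that [s ^ 2 beta / 2 >= s M + 1]: for a variance of at least [beta] the mean of
   [expR (s Z)] exceeds [u0 = expR (s M)] by at least 1. *)
move=> M0 b0; set s := (2 * M + 2) / beta + 1.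
have s1 : 1 <= s by rewrite lerDr divr_ge0//; lra.
have s0 : 0 < s by lra.
have sb : s * M + 1 <= s ^+ 2 * beta / 2.
  have : s * beta = 2 * M + 2 + beta by rewrite /s mulrDl mul1r divfK ?gt_eqF.
  by rewrite expr2 => h; nra.
set u0 := expR (s * M).
have u01 : 1 <= u0 by rewrite -expR0 ler_expR mulr_ge0// ltW.
have hu0 : u0 + 1 <= expR (s ^+ 2 * beta / 2).
  apply: (le_trans _ (_ : expR (s * M + 1) <= _)); last by rewrite ler_expR.
  by rewrite expRD -/u0; have := expR_ge1Dx (1 : R); nra.
(* Let [E1] and [E2] be the means of [expR (s Z)] and [expR (2 s Z)]. From [E1 >= u0 + 1] and
   [E2 <= u1 - 1] the mean of the quadratic is at least [u0 ^ 2 + u0 + 1]. *)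
set u1 := Num.max u0 (expR ((2 * s) ^+ 2 * B / 2) + 1).
have u0u1 : u0 <= u1 by rewrite le_max lexx.
have u1K : expR ((2 * s) ^+ 2 * B / 2) + 1 <= u1 by rewrite le_max lexx orbT.
have u10 : 0 < u1 by lra.
exists s, u0, u1; split=> // [v /andP[bv vB]|z].
  have hE1 : u0 + 1 <= expR (s ^+ 2 * v / 2).
    by apply: (le_trans hu0); rewrite ler_expR ler_pM2r// ler_wpM2l// sqr_ge0.
  have : expR ((2 * s) ^+ 2 * v / 2) <= expR ((2 * s) ^+ 2 * B / 2).
    by rewrite ler_expR ler_pM2r// ler_wpM2l// sqr_ge0.
  by move: hE1 u1K u10 u01; clear; nra.
rewrite (_ : 2 * s * z = s * z + s * z); last by ring.
rewrite expRD; set u := expR (s * z).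
have ugt0 : 0 < u by exact: expR_gt0.
(* Positive only for [u] strictly between [u0] and [u1]. There [z > M], the first factor is at most
   [u1 s (z - M)] and the second at most [u1]. *)
rewrite (_ : _ - _ = (u - u0) * (u1 - u)); last by ring.
have [ZM|ZM] := leP (z - M) 0.
  have uu0 : u <= u0 by rewrite ler_expR ler_pM2l// -subr_le0.
  by rewrite mulr0 mulr_le0_ge0 ?subr_le0 ?subr_ge0// (le_trans uu0).
have uu0 : u0 <= u by rewrite ler_expR ler_pM2l// -subr_ge0 ltW.
have sz : 0 < s * (z - M) by rewrite mulr_gt0.
have [uu1|uu1] := leP u u1; last first.
  apply: (@le_trans _ _ 0); first by rewrite mulr_ge0_le0 ?subr_ge0// subr_le0 ltW.
  by rewrite !mulr_ge0 ?exprn_ge0// ltW.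
have h1 : u - u0 <= u * (s * (z - M)).
  have := expR_ge1Dx (- (s * (z - M))).
  rewrite (_ : - (s * (z - M)) = s * M - s * z); last by ring.
  rewrite expRB -/u -/u0 ler_pdivlMr//; move: ugt0; clear; nra.
apply: (@le_trans _ _ (u * (s * (z - M)) * u1)).
  by apply: ler_pM; rewrite ?subr_ge0// gerBl ltW.
rewrite (_ : s * u1 ^+ 2 * (z - M) = u1 * (s * (z - M)) * u1); last by ring.
by rewrite !ler_pM2r.
Qed.

End tilting.

(** * Variables that are Gaussian on an event: moments and positive parts *)

Section gaussian_variables.
Context {d : measure_display} {Omega : measurableType d} {R : realType}.
Variable P : probability Omega R.
Implicit Types (Z : Omega -> R) (A : set Omega) (v t : R).

(* On A, the law of Z has the Laplace transform of a centred normal law of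
   variance v; by uniqueness of Laplace transforms, Z is N(0, v) given A. *)
Definition gauss_on A Z v := [/\ measurable A, measurable_fun setT Z &
  forall t : R, L1 P (fun w => expR (t * Z w)) /\
    Ex P (fun w => expR (t * Z w) * \1_A w) = expR (t ^+ 2 * v / 2) * Ex P (\1_A)].

Lemma gauss_on_L1_expabs A Z v t : gauss_on A Z v -> L1 P (fun w => expR (t * `|Z w|)).
Proof.
move=> [_ mZ gt]; have e s := (gt s).1.
apply: (L1_le _ _ (L1D (e t) (e (- t)))).
  by apply: measurableT_comp => //; apply: measurable_funM => //; exact: measurableT_comp.
move=> w; rewrite ger0_norm ?expR_ge0//.
by have [_|_] := ger0P (Z w); rewrite ?mulNr ?mulrN ?lerDl ?lerDr expR_ge0.
Qed.

Lemma gauss_on_L1sqr A Z v : gauss_on A Z v -> L1 P (fun w => Z w ^+ 2).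
Proof.
move=> gZ; have [_ mZ _] := gZ.
apply: (L1_le _ _ (L1Z 2 (gauss_on_L1_expabs 1 gZ))); first exact: measurable_funX.
move=> w; rewrite normrX mul1r.
have := @expR_ge1Dxn _ `|Z w| 1 (normr_ge0 _).
by rewrite !factS fact0 => h; lra.
Qed.

Lemma gauss_on_L1 A Z v : gauss_on A Z v -> L1 P Z.
Proof.
move=> gZ; have [_ mZ _] := gZ.
apply: (L1_le _ _ (gauss_on_L1_expabs 1 gZ)) => // w.
by rewrite mul1r; have := expR_ge1Dx `|Z w|; lra.
Qed.

(** Derivative of the Laplace transform at 0, taken along [1 / n.+1]. On the right-hand side the
    quotient is [1 / n.+1] times a sequence converging to [v / 2], up to the mass of [A], and so
    tends to 0. *)
Lemma gauss_on_mean A Z v : gauss_on A Z v -> Ex P (fun w => Z w * \1_A w) = 0.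
Proof.
move=> gZ; have [mA mZ gt] := gZ; have mI := measurable_indicR (R := R) mA.
have [||||_ c1] := @Ex_dct _ _ _ P
  (fun n w => (expR (n.+1%:R^-1 * Z w) - 1) * n.+1%:R * \1_A w)
  (fun w => Z w * \1_A w) (fun w => expR (2 * `|Z w|)).
- move=> n; do 2 apply: measurable_funM => //; apply: measurable_funB => //.
  by apply: measurableT_comp => //; exact: measurable_funM.
- move=> w; apply: cvgMr_tmp.
  by apply: (@expR_diff_quotient_cvg _ (fun n => n.+1%:R)) => //; exact: cvg_invS.
- exact: gauss_on_L1_expabs gZ.
- move=> n w; rewrite normrM -[leRHS]mulr1.
  by rewrite ler_pM ?indic_le1 ?expR_diff_quotient_ub.
have c2 : Ex P (fun w => (expR (n.+1%:R^-1 * Z w) - 1) * n.+1%:R * \1_A w)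
    @[n --> \oo] --> 0 * (v / 2) * Ex P (\1_A).
  rewrite (_ : (fun n => _) = (fun n => n.+1%:R^-1 *
      ((expR ((n.+1%:R ^+ 2)^-1 * (v / 2)) - 1) * n.+1%:R ^+ 2) * Ex P (\1_A))).
    apply: cvgMr_tmp; apply: cvgM; first exact: cvg_invS.
    apply: (@expR_diff_quotient_cvg _ (fun n => n.+1%:R ^+ 2)).
      by move=> n; rewrite exprn_gt0.
    rewrite (_ : (fun n => _) = (fun n => n.+1%:R^-1 * n.+1%:R^-1)).
      by rewrite -[X in _ --> X](mulr0 0); apply: cvgM; exact: cvg_invS.
    by apply/funext => n; rewrite expr2 invfM.
  apply/funext => n; have [e1 e2] := gt n.+1%:R^-1.
  have I1 : L1 P (\1_A) by apply: L1_bdd mI _ => w; exact: indic_le1.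
  rewrite (_ : (fun w => _) = (fun w => n.+1%:R *
      (expR (n.+1%:R^-1 * Z w) * \1_A w - \1_A w))); last by apply/funext => w; ring.
  rewrite ExZ; last by apply: L1B => //; exact: L1_ind.
  rewrite ExB ?e2//; last exact: L1_ind.
  rewrite exprVn -mulrA; set e := expR _; field.
  by rewrite nat1r pnatr_eq0.
by rewrite (cvg_unique _ c1 c2)// !mul0r.
Qed.

(** Second derivative at 0. The symmetric second difference [expR h + expR (- h) - 2] equals
    [expR (- h)] times the square of [expR h - 1], which reduces its limit and its domination to
    those of the first-order quotient. *)
Lemma gauss_on_var A Z v : gauss_on A Z v ->
  Ex P (fun w => Z w ^+ 2 * \1_A w) = v * Ex P (\1_A).
Proof.
move=> gZ; have [mA mZ gt] := gZ; have mI := measurable_indicR (R := R) mA.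
pose q (n : nat) w := (expR (n.+1%:R^-1 * Z w) - 1) * n.+1%:R.
have mE (h : R) : measurable_fun setT (fun w => expR (h * Z w)).
  by apply: measurableT_comp => //; exact: measurable_funM.
have mq n : measurable_fun setT (q n).
  by apply: measurable_funM => //; apply: measurable_funB.
have [||||_ c1] := @Ex_dct _ _ _ P
  (fun n w => expR (- n.+1%:R^-1 * Z w) * q n w ^+ 2 * \1_A w)
  (fun w => Z w ^+ 2 * \1_A w) (fun w => expR (5 * `|Z w|)).
- by move=> n; do 2 apply: measurable_funM => //; exact: measurable_funX.
- move=> w; apply: cvgMr_tmp; rewrite -[X in _ --> X]mul1r; apply: cvgM.
    rewrite -[X in _ --> X]expR0; apply: continuous_cvg; first exact: continuous_expR.
    rewrite -[X in _ --> X](mul0r (Z w)) -oppr0; apply: cvgMr_tmp; apply: cvgN.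
    exact: cvg_invS.
  apply: (@cvgM _ _ _ _ (q ^~ w) (q ^~ w));
  by apply: (@expR_diff_quotient_cvg _ (fun n => n.+1%:R)) => //; exact: cvg_invS.
- exact: gauss_on_L1_expabs gZ.
- move=> n w; rewrite normrM -[leRHS]mulr1 ler_pM ?indic_le1//.
  rewrite normrM (_ : 5 * `|Z w| = `|Z w| + (2 * `|Z w| + 2 * `|Z w|)); last by ring.
  rewrite expRD ler_pM//.
    rewrite ger0_norm ?expR_ge0// ler_expR (le_trans (ler_norm _))//.
    by rewrite normrM ler_piMl// normrN gtr0_norm ?invr_gt0// invf_le1// ler1n.
  by rewrite expRD expr2 normrM ler_pM// expR_diff_quotient_ub.
have c2 : Ex P (fun w => expR (- n.+1%:R^-1 * Z w) * q n w ^+ 2 * \1_A w)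
    @[n --> \oo] --> 2 * (v / 2) * Ex P (\1_A).
  rewrite (_ : (fun n => _) = (fun n => 2 *
      ((expR ((n.+1%:R ^+ 2)^-1 * (v / 2)) - 1) * n.+1%:R ^+ 2) * Ex P (\1_A))).
    apply: cvgMr_tmp; apply: cvgMl_tmp.
    apply: (@expR_diff_quotient_cvg _ (fun n => n.+1%:R ^+ 2)).
      by move=> n; rewrite exprn_gt0.
    rewrite (_ : (fun n => _) = (fun n => n.+1%:R^-1 * n.+1%:R^-1)).
      by rewrite -[X in _ --> X](mulr0 0); apply: cvgM; exact: cvg_invS.
    by apply/funext => n; rewrite expr2 invfM.
  apply/funext => n; have [e1 e2] := gt n.+1%:R^-1; have [e3 e4] := gt (- n.+1%:R^-1).
  have I1 : L1 P (\1_A) by apply: L1_bdd mI _ => w; exact: indic_le1.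
  rewrite (_ : (fun w => _) = (fun w => n.+1%:R ^+ 2 *
      (expR (n.+1%:R^-1 * Z w) * \1_A w + expR (- n.+1%:R^-1 * Z w) * \1_A w
       + (- 2) * \1_A w))); last first.
    apply/funext => w; rewrite /q [- _ * Z w]mulNr expRN; have := expR_gt0 (n.+1%:R^-1 * Z w).
    by set e := expR _ => e0; field; rewrite gt_eqF.
  rewrite ExZ; last by apply: L1D; [apply: L1D; exact: L1_ind|exact: L1Z].
  rewrite !ExD ?ExZ//; [|exact: L1_ind..|by apply: L1D; exact: L1_ind|exact: L1Z].
  rewrite e2 e4 sqrrN exprVn -mulrA; set e := expR _; ring.
by rewrite (cvg_unique _ c1 c2)// mulrCA divff ?mulr1.
Qed.

(** [kappa] depends on [M], [beta] and [B] only, so one constant serves every event, time and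
    evaluation. The quadratic minorant can be integrated on [A] because it involves the Laplace
    transform at [s] and [2 s] only. *)
Lemma gauss_on_pos_part_lb (M beta B : R) : 0 <= M -> 0 < beta ->
  exists2 kappa, 0 < kappa & forall A Z v, gauss_on A Z v -> beta <= v <= B ->
    kappa * Ex P (\1_A) <= Ex P (fun w => Num.max (Z w - M) 0 * \1_A w).
Proof.
move=> M0 b0; have [s [u0 [u1 [s0 u10 lb ub]]]] := exp_quadratic_pos_part B M0 b0.
have su0 : 0 < s * u1 ^+ 2 by rewrite mulr_gt0// exprn_gt0.
exists (s * u1 ^+ 2)^-1; first by rewrite invr_gt0.
move=> A Z v gZ bvB; have [mA mZ gt] := gZ.
have [es1 es2] := gt s; have [ess1 ess2] := gt (2 * s).
have I1 : L1 P (\1_A).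
  by apply: L1_bdd; [exact: measurable_indicR|move=> w; exact: indic_le1].
set p := Ex P (\1_A) in es2 ess2 *.
have p0 : 0 <= p by apply: Ex_ge0 => w; rewrite indicE.
have L1max : L1 P (fun w => Num.max (Z w - M) 0).
  apply: (L1_le _ _ (L1D (L1_abs (gauss_on_L1 gZ)) (L1_cst _ M))).
    by apply: measurable_maxr => //; exact: measurable_funB.
  move=> w; rewrite ger0_norm ?le_max ?lexx ?orbT// ge_max addr_ge0// andbT.
  by rewrite lerD ?ler_norm// (le_trans _ M0)// oppr_le0.
rewrite mulrC ler_pdivrMr// mulrC -ExZ; last exact: L1_ind.
pose h w := (u0 + u1) * (expR (s * Z w) * \1_A w) +
            ((- 1) * (expR (2 * s * Z w) * \1_A w) + (- (u0 * u1)) * \1_A w).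
have L1h1 := L1_ind mA es1; have L1h2 := L1_ind mA ess1.
have L1h : L1 P h by apply: L1D; [|apply: L1D]; exact: L1Z.
apply: (@le_trans _ _ (Ex P h)).
  rewrite /h !ExD ?ExZ ?es2 ?ess2 -/p//; try exact: L1Z; last by apply: L1D; exact: L1Z.
  by rewrite -[leLHS]mul1r; apply: (le_trans (ler_wpM2r p0 (lb _ bvB))); lra.
apply: Ex_le => //; first exact/L1Z/L1_ind.
move=> w; rewrite /h indicE; case: (w \in A); rewrite ?mulr0 ?addr0// !mulr1.
by rewrite mulN1r addrA; exact: ub.
Qed.

End gaussian_variables.

(** * Linear spaces of centred Gaussian variables: orthogonality gives independence *)

Section gaussian_spaces.
Context {d : measure_display} {Omega : measurableType d} {R : realType}.
Variable P : probability Omega R.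
Implicit Types (X Y Z T : Omega -> R) (S H : set (Omega -> R)).

Definition linear_space H := H (fun=> 0) /\
  forall (a : R) X Y, H X -> H Y -> H (fun w => a * X w + Y w).

(** Joint normality is encoded by asking every element of a linear space to be centred normal. *)
Definition gauss_space H := linear_space H /\
  forall Z, H Z -> exists v, gauss_on P setT Z v.

Definition ip X Y : R := Ex P (fun w => X w * Y w).

Lemma ipC X Y : ip X Y = ip Y X.
Proof. by apply: Ex_ext => w; rewrite mulrC. Qed.

Lemma linear_spaceZ H a X : linear_space H -> H X -> H (fun w => a * X w).
Proof.
move=> [H0 HD] HX; have := HD a _ _ HX H0.
by rewrite (_ : (fun w => _) = (fun w => a * X w))//; apply/funext => w; rewrite addr0.
Qed.

Lemma linear_spaceB H X Y : linear_space H -> H X -> H Y -> H (fun w => X w - Y w).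
Proof.
move=> HL HX HY; have := HL.2 (-1) _ _ HY HX.
by rewrite (_ : (fun w => _) = (fun w => X w - Y w))//; apply/funext => w; rewrite mulN1r addrC.
Qed.

Variable H : set (Omega -> R).
Hypothesis gH : gauss_space H.

Lemma gauss_space_measurable Z : H Z -> measurable_fun setT Z.
Proof. by move=> HZ; have [v []] := gH.2 _ HZ. Qed.

Lemma gauss_space_L1sqr Z : H Z -> L1 P (fun w => Z w ^+ 2).
Proof. by move=> HZ; have [v] := gH.2 _ HZ; exact: gauss_on_L1sqr. Qed.

Lemma gauss_space_L1 Z : H Z -> L1 P Z.
Proof. by move=> HZ; have [v] := gH.2 _ HZ; exact: gauss_on_L1. Qed.

Lemma gauss_space_L1M X Y : H X -> H Y -> L1 P (fun w => X w * Y w).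
Proof.
move=> HX HY; apply: (L1_le _ _ (L1D (gauss_space_L1sqr HX) (gauss_space_L1sqr HY))).
  by apply: measurable_funM; exact: gauss_space_measurable.
move=> w; have := sqr_ge0 (`|X w| - `|Y w|); have := sqr_ge0 (`|X w| + `|Y w|).
rewrite normrM -(real_normK (num_real (X w))) -(real_normK (num_real (Y w))).
by nra.
Qed.

Lemma ipDl a X Y Z : H X -> H Y -> H Z ->
  ip (fun w => a * X w + Y w) Z = a * ip X Z + ip Y Z.
Proof.
move=> HX HY HZ; have XZ := gauss_space_L1M HX HZ; have YZ := gauss_space_L1M HY HZ.
rewrite /ip -ExZ// -ExD//; last exact: L1Z.
by apply: Ex_ext => w; ring.
Qed.

Lemma ipDr a X Y Z : H X -> H Y -> H Z ->
  ip Z (fun w => a * X w + Y w) = a * ip Z X + ip Z Y.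
Proof. by move=> *; rewrite ipC ipDl// !(ipC Z). Qed.

Lemma ip_ge0 X : 0 <= ip X X.
Proof. by apply: Ex_ge0 => w; rewrite -expr2 sqr_ge0. Qed.

Lemma ip_sqrD a X Y : H X -> H Y ->
  ip (fun w => a * X w + Y w) (fun w => a * X w + Y w) =
  a ^+ 2 * ip X X + 2 * a * ip X Y + ip Y Y.
Proof.
move=> HX HY; have HXY := gH.1.2 a _ _ HX HY.
by rewrite ipDl// !ipDr// (ipC Y X); ring.
Qed.

Lemma ip_CS X Y : H X -> H Y -> ip X Y ^+ 2 <= ip X X * ip Y Y.
Proof.
move=> HX HY; have X0 := ip_ge0 X; have Y0 := ip_ge0 Y.
have q a : 0 <= a ^+ 2 * ip X X + 2 * a * ip X Y + ip Y Y.
  by rewrite -ip_sqrD// ip_ge0.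
have [XX|XX] := eqVneq (ip X X) 0.
  (* If [X] has norm 0, the quadratic is affine in [a] and stays nonnegative only if its slope
     vanishes; otherwise this [a] would give it the value -1. *)
  rewrite XX mul0r; have := q (- (ip Y Y + 1) / 2 / ip X Y).
  have [->|XY] := eqVneq (ip X Y) 0; first by rewrite expr0n.
  rewrite XX mulr0 add0r (_ : 2 * _ * _ = - (ip Y Y + 1)); last by field.
  by move=> ?; lra.
have := q (- ip X Y / ip X X).
rewrite (_ : _ + ip Y Y = (ip X X * ip Y Y - ip X Y ^+ 2) / ip X X); last by field.
by rewrite pmulr_lge0 ?subr_ge0// invr_gt0 lt0r XX.
Qed.

Lemma gauss_space_gauss Z : H Z -> gauss_on P setT Z (ip Z Z).
Proof.
move=> HZ; have [v gZ] := gH.2 _ HZ.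
suff -> : ip Z Z = v by [].
have := gauss_on_var gZ; rewrite indicT Ex_cst mulr1 => <-.
by apply: Ex_ext => w; rewrite mulr1 expr2.
Qed.

Variable S : set (Omega -> R).
Hypotheses (LS : linear_space S) (SH : S `<=` H).

(* e^(tZ) minus its mean is exponentially null for S, so it has zero integral over
   the events of S. *)
Lemma gauss_space_orthogonal Z A : H Z -> (forall T, S T -> ip Z T = 0) ->
  sigma_span S A -> gauss_on P A Z (ip Z Z).
Proof.
move=> HZ ZS SA.
have mS T (ST : S T) := gauss_space_measurable (SH ST).
have mA : measurable A.
  apply: (smallest_sub _ _ SA); first exact: sigma_algebra_measurable.
  by move=> B [T ST [C mC <-]]; rewrite setTI -[_ @^-1` _]setTI; exact: mS.
have mZ := gauss_space_measurable HZ.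
split=> // t; have [_ _ gZ] := gauss_space_gauss HZ.
have [e1] := gZ t; rewrite indicT Ex_cst mulr1 => e2.
split=> //.
set c := expR _.
have I1 : L1 P (\1_A).
  by apply: L1_bdd; [exact: measurable_indicR|move=> w; exact: indic_le1].
have nW : exp_null P S (fun w => expR (t * Z w) - c).
  split.
    apply: measurable_funB => //; apply: measurableT_comp => //.
    exact: measurable_funM.
  move=> T ST; have HT := SH ST.
  have [_ _ gT] := gauss_space_gauss HT.
  have [_ _ gZT] := gauss_space_gauss (gH.1.2 t _ _ HZ HT).
  have [f1] := gT 1; rewrite indicT Ex_cst mulr1 => f2.
  have [h1] := gZT 1; rewrite indicT Ex_cst mulr1 => h2.
  have f1' : L1 P (fun w => expR (T w)) by apply: L1_ext f1 => w; rewrite mul1r.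
  have h1' : L1 P (fun w => expR (t * Z w + T w)) by apply: L1_ext h1 => w; rewrite mul1r.
  have E : (fun w => (expR (t * Z w) - c) * expR (T w)) =
           (fun w => expR (t * Z w + T w) - c * expR (T w)).
    by apply/funext => w; rewrite expRD; ring.
  rewrite E; split; first by apply: L1B => //; exact: L1Z.
  rewrite ExB ?ExZ//; last exact: L1Z.
  have -> : Ex P (fun w => expR (T w)) = expR (1 ^+ 2 * ip T T / 2).
    by rewrite -f2; apply: Ex_ext => w; rewrite mul1r mulr1.
  have -> : Ex P (fun w => expR (t * Z w + T w)) = expR (1 ^+ 2 *
     (t ^+ 2 * ip Z Z + 2 * t * ip Z T + ip T T) / 2).
    by rewrite -ip_sqrD// -h2; apply: Ex_ext => w; rewrite mul1r mulr1.
  (* By orthogonality the variance of [t Z + T] is the sum of the variances of [t Z] and [T], so the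
     Laplace transform factorizes. *)
  rewrite (ZS _ ST) /c -expRD; apply/eqP; rewrite subr_eq0; apply/eqP; congr expR.
  by field.
have := exp_null_sigma LS.1 LS.2 mS nW SA.
under Ex_ext => w do rewrite mulrBl.
rewrite ExB ?ExZ//; [by move/subr0_eq|exact: L1_ind|exact: L1Z].
Qed.

End gaussian_spaces.

(** * Integration against laws, and Laplace transforms of normal laws *)

Lemma cvg_monotone_integral {d : measure_display} {T : measurableType d} {R : realType}
    (mu : {measure set T -> \bar R}) (f_ : nat -> T -> \bar R) (f : T -> \bar R) :
  (forall n, measurable_fun setT (f_ n)) -> (forall n x, (0 <= f_ n x)%E) ->
  (forall x a b, (a <= b)%N -> (f_ a x <= f_ b x)%E) ->
  (forall x, f_ ^~ x @ \oo --> f x) ->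
  (\int[mu]_x f_ n x)%E @[n --> \oo] --> (\int[mu]_x f x)%E.
Proof.
move=> mf f0 nd cf.
rewrite (_ : (\int[mu]_x f x)%E = (\int[mu]_x limn (f_ ^~ x))%E).
  apply: cvg_monotone_convergence => //.
  by move=> x _ a b ab; exact: nd.
by apply: eq_integral => x _; apply/esym/cvg_lim => //; exact: cf.
Qed.

Section integration_by_law.
Context {d1 d2 : measure_display} {T1 : measurableType d1} {T2 : measurableType d2}.
Context {R : realType}.
Local Open Scope ereal_scope.

(** Simple functions and monotone convergence. One statement serves for a density with respect to
    Lebesgue measure ([X] the identity), for the law of a variable ([U = 1]), and for independence
    ([nu] a multiple of the law of [X]). *)
Lemma integral_density_law (mu : {measure set T1 -> \bar R})
    (nu : {measure set T2 -> \bar R}) (X : T1 -> T2) (U : T1 -> R) (g : T2 -> R) :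
  measurable_fun setT X -> measurable_fun setT U -> measurable_fun setT g ->
  (forall x, (0 <= U x)%R) -> (forall y, (0 <= g y)%R) ->
  (forall B, measurable B -> \int[mu]_(x in X @^-1` B) (U x)%:E = nu B) ->
  \int[mu]_x (U x * g (X x))%:E = \int[nu]_y (g y)%:E.
Proof.
move=> mX mU mg U0 g0 munu.
have mgE : measurable_fun setT (EFin \o g) by exact/measurable_EFinP.
pose h n := nnsfun_approx measurableT mgE n.
have hn0 n y : (0 <= h n y)%R by [].
have hcvg y : EFin \o h^~ y @ \oo --> (g y)%:E.
  by apply: cvg_nnsfun_approx => // z _; rewrite lee_fin.
have hnd y a b : (a <= b)%N -> (h a y <= h b y)%R.
  by move=> ab; exact/lefP/nd_nnsfun_approx.
have mhX n : measurable_fun setT (fun x => (U x * h n (X x))%R).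
  by apply: measurable_funM => //; exact: measurableT_comp.
have c1 : \int[mu]_x (U x * h n (X x))%:E @[n --> \oo] --> \int[mu]_x (U x * g (X x))%:E.
  apply: cvg_monotone_integral => //.
  - by move=> n; exact/measurable_EFinP.
  - by move=> n x; rewrite lee_fin mulr_ge0.
  - by move=> x a b ab; rewrite lee_fin ler_wpM2l// hnd.
  - move=> x; rewrite EFinM; under eq_fun do rewrite EFinM.
    by apply: cvgeZl => //; exact: hcvg.
have c2 : \int[nu]_y (h n y)%:E @[n --> \oo] --> \int[nu]_y (g y)%:E.
  by apply: cvg_monotone_integral => // n; exact/measurable_EFinP.
have E n : \int[mu]_x (U x * h n (X x))%:E = \int[nu]_y (h n y)%:E.
  transitivity (\int[mu]_x (\sum_(y \in range (h n)) (y * (U x * \1_(h n @^-1` [set y]) (X x)))%:E)).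
    apply: eq_integral => x _; rewrite fsumEFin//; congr EFin.
    rewrite [in LHS]fimfunE mulr_fsumr//.
    by apply: eq_fsbigr => y _; ring.
  transitivity (\int[nu]_x (\sum_(y \in range (h n)) (y * \1_(h n @^-1` [set y]) x)%:E)); last first.
    by apply: eq_integral => x _; rewrite [in RHS]fimfunE -fsumEFin.
  rewrite !ge0_integral_fsum//=; last 4 first.
  - move=> y; apply/measurable_EFinP; apply: measurable_funM => //.
  - by move=> y x _; rewrite EFinM; exact: nnfun_muleindic_ge0.
  - move=> y; apply/measurable_EFinP; do 2 apply: measurable_funM => //.
    by apply: measurableT_comp => //.
  - move=> y x _; rewrite mulrCA EFinM mule_ge0 ?lee_fin//.
    by have := nnfun_muleindic_ge0 (h n) y (X x); rewrite -EFinM lee_fin.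
  apply: eq_fsbigr => y /[!inE] -[z _ <-].
  have mB : measurable (h n @^-1` [set h n z]) by [].
  under eq_integral do rewrite EFinM.
  under [in RHS]eq_integral do rewrite EFinM.
  have m1 : measurable_fun setT (fun x => (\1_(h n @^-1` [set h n z]) x : R)%:E).
    exact/measurable_EFinP.
  have m2 : measurable_fun setT (fun x => (U x * \1_(h n @^-1` [set h n z]) (X x))%:E).
    by apply/measurable_EFinP; apply: measurable_funM => //; exact: measurableT_comp.
  rewrite !ge0_integralZl//=; first last.
  - by rewrite lee_fin.
  - by move=> x _; rewrite lee_fin mulr_ge0.
  - by rewrite lee_fin.
  congr (_ * _); rewrite integral_indic// setIT -munu// [RHS]integral_mkcond.
  apply: eq_integral => x _; rewrite patchE indicE.
  by case: ifPn => [|/negP] /[1!inE] hx; [rewrite mem_set// mulr1|rewrite memNset// mulr0].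
move: c1; rewrite (_ : (fun n => _) = (fun n => \int[nu]_y (h n y)%:E)); last exact/funext.
by move=> c1; exact: (cvg_unique _ c1 c2).
Qed.

End integration_by_law.

Section gaussian_transform.
Context {d : measure_display} {Omega : measurableType d} {R : realType}.
Variable P : probability Omega R.

Lemma normal_prob_mgf (m s t : R) : s != 0 ->
  (\int[normal_prob m s]_y (expR (t * y))%:E = (expR (t * m + t ^+ 2 * s ^+ 2 / 2))%:E)%E.
Proof.
move=> s0.
have mexp : measurable_fun setT (fun y : R => expR (t * y)).
  by apply: measurableT_comp => //; exact: measurable_funM.
rewrite -(@integral_density_law _ _ _ _ R lebesgue_measure (normal_prob m s) idfun
   (normal_pdf m s) (fun y => expR (t * y)))//; last 3 first.
- exact: measurable_id.
- exact: measurable_normal_pdf.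
- by move=> x; exact: normal_pdf_ge0.
(* Completing the square: tilting by [expR (t y)] shifts the mean of the density by [t s ^ 2]. *)
transitivity (\int[lebesgue_measure]_x
   ((expR (t * m + t ^+ 2 * s ^+ 2 / 2))%:E * (normal_pdf (m + t * s ^+ 2) s x)%:E))%E.
  apply: eq_integral => x _; rewrite -EFinM; congr EFin; rewrite /= !normal_pdfE//.
  rewrite mulrCA -!mulrA; congr (_ * _); rewrite /normal_fun -!expRD; congr expR.
  by field.
rewrite ge0_integralZl//=.
- by rewrite integral_normal_pdf mule1.
- by apply/measurable_EFinP; exact: measurable_normal_pdf.
- by move=> x _; rewrite lee_fin normal_pdf_ge0.
Qed.

Lemma has_gaussian_law_mgf (X : Omega -> R) (m v t : R) :
  measurable_fun setT X -> 0 <= v -> has_gaussian_law P X m v ->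
  (\int[P]_w (expR (t * X w))%:E = (expR (t * m + t ^+ 2 * v / 2))%:E)%E.
Proof.
move=> mX v0 lX.
have mexp : measurable_fun setT (fun y : R => expR (t * y)).
  by apply: measurableT_comp => //; exact: measurable_funM.
have H (nu : {measure set (measurableTypeR R) -> \bar R}) : (forall B, measurable B -> P (X @^-1` B) = nu B) ->
    (\int[P]_w (expR (t * X w))%:E = \int[nu]_y (expR (t * y))%:E)%E.
  move=> h; rewrite -(@integral_density_law _ _ _ _ R P nu X (fun=> 1) (fun y => expR (t * y)))//.
  - by apply: eq_integral => w _; rewrite mul1r.
  - move=> B mB; have mXB : measurable (X @^-1` B) by rewrite -[_ @^-1` _]setTI; exact: mX.
    by rewrite integral_cst// mul1e; exact: h.
have [v_eq0|v_neq0] := eqVneq v 0.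
  rewrite (H (\d_(m : measurableTypeR R))) ?integral_dirac//.
  - by rewrite diracT mul1e v_eq0 mulr0 mul0r addr0.
  - exact/measurable_EFinP.
  - by move=> B mB; rewrite lX// /gaussian_law v_eq0 eqxx.
rewrite (H (normal_prob m (Num.sqrt v))) ?normal_prob_mgf ?sqr_sqrtr//.
  by rewrite gt_eqF// sqrtr_gt0 lt0r v_neq0.
by move=> B mB; rewrite lX// /gaussian_law (negbTE v_neq0).
Qed.

(** The hypothesis on [U] says that [U] has constant mean [c] given [X]; the measure with density
    [U], pushed forward by [X], is then [c] times the law of [X]. Independence is used in this way
    one variable at a time. *)
Lemma indep_transfer (X U : Omega -> R) (g : R -> R) (c : R) :
  measurable_fun setT X -> measurable_fun setT U -> measurable_fun setT g ->
  0 <= c -> (forall x, 0 <= U x) -> (forall y, 0 <= g y) ->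
  (forall B, measurable B -> (\int[P]_(w in X @^-1` B) (U w)%:E = c%:E * P (X @^-1` B))%E) ->
  (\int[P]_w (U w * g (X w))%:E = c%:E * \int[P]_w (g (X w))%:E)%E.
Proof.
move=> mX mU mg c0 U0 g0 h.
have := mX; pose X' : {mfun Omega >-> R} := mfun_Sub (mem_set mX).
move=> _; pose nu := mscale (NngNum c0) (distribution P X').
rewrite (@integral_density_law _ _ _ _ R P nu X U g)//.
rewrite /nu ge0_integral_mscale//=; last 2 first.
- exact/measurable_EFinP.
- by move=> y _; rewrite lee_fin.
congr (_ * _)%E; rewrite ge0_integral_pushforward//=.
- exact/measurable_EFinP.
- by move=> y _; rewrite lee_fin.
Qed.

End gaussian_transform.

(** * Events and functions measurable for a generated sigma-algebra *)

Section sub_sigma_algebras.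
Context {d : measure_display} {Omega : measurableType d} {R : realType}.
Implicit Types (G : set (set Omega)) (X : Omega -> R).

Definition sigma_measurable G X :=
  forall B : set R, measurable B -> <<s G >> (X @^-1` B).

Lemma sigma_measurableP G X :
  sigma_measurable G X <-> measurable_fun [set: g_sigma_algebraType G] X.
Proof.
split=> [h _ B mB|h B mB]; first by rewrite setTI; exact: h.
by have := h measurableT B mB; rewrite setTI.
Qed.

Lemma sub_sigma_measurable G : G `<=` measurable -> <<s G >> `<=` measurable.
Proof. by move=> Gm; apply: smallest_sub => //; exact: sigma_algebra_measurable. Qed.

Lemma sigma_measurableT G : <<s G >> setT.
Proof. exact: (@measurableT _ (g_sigma_algebraType G)). Qed.

Lemma sigma_measurableI G A B : <<s G >> A -> <<s G >> B -> <<s G >> (A `&` B).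
Proof. exact: (@measurableI _ (g_sigma_algebraType G)). Qed.

Lemma sigma_measurableC G A : <<s G >> A -> <<s G >> (~` A).
Proof. exact: (@measurableC _ (g_sigma_algebraType G)). Qed.

Lemma sigma_measurableU G A B : <<s G >> A -> <<s G >> B -> <<s G >> (A `|` B).
Proof. exact: (@measurableU _ (g_sigma_algebraType G)). Qed.

Lemma sigma_measurable_lin G a X Y : sigma_measurable G X -> sigma_measurable G Y ->
  sigma_measurable G (fun w => a * X w + Y w).
Proof.
move=> /sigma_measurableP mX /sigma_measurableP mY; apply/sigma_measurableP.
by apply: measurable_funD => //; exact: measurable_funM.
Qed.

Lemma sigma_measurable_cst G c : sigma_measurable G (fun=> c).
Proof. by apply/sigma_measurableP; exact: measurable_cst. Qed.

End sub_sigma_algebras.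

(** * The Gaussian space of prior and noise along a fixed path *)

Section gaussian_model.
Context {d : measure_display} {Omega : measurableType d} {R : realType}.
Context {P : probability Omega R} {m : nat}.
Variables (f : 'rV[R]_m * nat -> {RV P >-> R})
  (eps_env : nat -> {RV P >-> R}) (eps_rep : nat -> nat -> {RV P >-> R})
  (Theta : set 'rV[R]_m) (T Q : {fset nat})
  (k : 'rV[R]_m * nat -> 'rV[R]_m * nat -> R)
  (sigma_env sigma_rep : R).
Hypotheses
  (f_gp : gaussian_process [set x | Theta x.1 /\ x.2 \in T] f (fun=> 0) k)
  (eps_env_law : forall n, has_gaussian_law P (eps_env n) 0 (sigma_env ^+ 2))
  (eps_rep_law : forall n q, q \in Q ->
     has_gaussian_law P (eps_rep n q) 0 (sigma_rep ^+ 2 / q%:R))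
  (indep : mutually_independent P (model_block f eps_env eps_rep Theta T Q)).

Let D : set ('rV[R]_m * nat) := [set x | Theta x.1 /\ x.2 \in T].
Let block := model_block f eps_env eps_rep Theta T Q.
Let blockT : eqType := (unit + (nat + nat))%type.

Definition prior_span : set (Omega -> R) := [set F |
  exists (n : nat) (x : 'I_n -> 'rV[R]_m * nat) (c : 'I_n -> R),
    (forall i, Theta (x i).1 /\ (x i).2 \in T) /\
    F = (fun w => \sum_(i < n) c i * f (x i) w)].

Lemma prior_span_linear : linear_space prior_span.
Proof.
split.
  exists 0%N, (fun=> (0, 0%N)), (fun=> 0); split; first by case.
  by apply/funext => w; rewrite big_ord0.
move=> a X Y [n [x [c [Dx ->]]]] [n' [x' [c' [Dx' ->]]]].
exists (n + n')%N, (fun i => match fintype.split i with inl j => x j | inr j => x' j end),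
  (fun i => match fintype.split i with inl j => a * c j | inr j => c' j end); split.
  by move=> i; case: fintype.splitP.
apply/funext => w; rewrite big_split_ord/= mulr_sumr.
congr (_ + _); apply: eq_bigr => i _.
  by rewrite (unsplitK (inl i)) mulrA.
by rewrite (unsplitK (inr i)).
Qed.

Lemma prior_span_f x : D x -> prior_span (f x).
Proof.
move=> Dx; exists 1%N, (fun=> x), (fun=> 1); split=> //.
by apply/funext => w; rewrite big_ord1 mul1r.
Qed.

Lemma prior_span_block F : prior_span F ->
  forall B, measurable B -> block (inl tt) (F @^-1` B).
Proof.
move=> [n [x [c [Dx ->]]]]; apply/sigma_measurableP.
apply: measurable_sum => i; apply: measurable_funM; first exact: measurable_cst.
apply/sigma_measurableP => B mB; apply: sub_sigma_algebra.
by exists (x i) => //; exists B => //; rewrite setTI.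
Qed.

Lemma prior_span_measurable F : prior_span F -> measurable_fun setT F.
Proof.
move=> [n [x [c [Dx ->]]]]; apply: measurable_sum => i.
by apply: measurable_funM => //; exact: measurable_cst.
Qed.

Lemma eps_env_block n B : measurable B -> block (inr (inl n)) (eps_env n @^-1` B).
Proof.
move=> mB; apply: sub_sigma_algebra; exists n => //.
by exists B => //; rewrite setTI.
Qed.

Lemma eps_rep_block n q B : q \in Q -> measurable B ->
  block (inr (inr n)) (eps_rep n q @^-1` B).
Proof.
move=> qQ mB; apply: sub_sigma_algebra; exists q => //.
by exists B => //; rewrite setTI.
Qed.

Lemma block_measurable j A : block j A -> measurable A.
Proof.
by case: j => [u|[n|n]]; apply: sub_sigma_measurable => B [i _ [C mC <-]];
  exact: measurable_funPT.
Qed.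

Lemma measurable_block_cap (J : seq blockT) A : (forall j, j \in J -> block j (A j)) ->
  measurable (\big[setI/setT]_(j <- J) A j).
Proof.
elim: J => [_|j J ih JA]; first by rewrite big_nil.
rewrite big_cons; apply: measurableI.
  by apply: (@block_measurable j); apply: JA; rewrite mem_head.
by apply: ih => i iJ; apply: JA; rewrite in_cons iJ orbT.
Qed.

(** Independence is stated for one family of events indexed by blocks, so an event of a further
    block enters as an update of the family. *)
Definition upd (A : blockT -> set Omega) j B i := if i == j then B else A i.

Lemma upd_cap j (J : seq blockT) A B : j \notin J ->
  \big[setI/setT]_(i <- j :: J) upd A j B i = B `&` \big[setI/setT]_(i <- J) A i.
Proof.
move=> jJ; rewrite big_cons {1}/upd eqxx; congr (_ `&` _).
rewrite big_seq_cond [RHS]big_seq_cond; apply: eq_bigr => i /andP[iJ _].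
by rewrite /upd; case: eqP => // ij; rewrite -ij iJ in jJ.
Qed.

Lemma upd_block j (J : seq blockT) A B : block j B ->
  (forall i, i \in J -> block i (A i)) ->
  (forall i, i \in j :: J -> block i (upd A j B i)).
Proof.
move=> bB bA i; rewrite in_cons /upd => /predU1P[->|iJ]; first by rewrite eqxx.
by case: eqP => [->//|_]; exact: bA.
Qed.

Lemma indep_cons j (J : seq blockT) A B : uniq (j :: J) -> block j B ->
  (forall i, i \in J -> block i (A i)) ->
  P (B `&` \big[setI/setT]_(i <- J) A i) = (P B * P (\big[setI/setT]_(i <- J) A i))%E.
Proof.
move=> uJ bB bA; have /= /andP[jJ uJ'] := uJ.
rewrite -(upd_cap A B jJ) (indep uJ (upd_block bB bA)) big_cons {1}/upd eqxx.
congr (_ * _)%E; rewrite (indep uJ' bA) big_seq_cond [RHS]big_seq_cond.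
apply: eq_bigr => i /andP[iJ _].
by rewrite /upd; case: eqP => // ij; rewrite -ij iJ in jJ.
Qed.

Definition fresh (n : nat) (j : blockT) :=
  match j with inl _ => false | inr (inl i) | inr (inr i) => (n <= i)%N end.

(* Z is centred Gaussian with variance v and independent of the noise blocks of
   all steps from n on. *)
Definition adapted_gauss n (Z : Omega -> R) (v : R) := [/\ measurable_fun setT Z, 0 <= v &
  forall (t : R) (J : seq blockT) A, uniq J -> (forall j, j \in J -> fresh n j) ->
    (forall j, j \in J -> block j (A j)) ->
  (\int[P]_w (expR (t * Z w) * \1_(\big[setI/setT]_(j <- J) A j) w)%:E =
   (expR (t ^+ 2 * v / 2))%:E * P (\big[setI/setT]_(j <- J) A j))%E].

Lemma adapted_gauss_on n Z v : adapted_gauss n Z v -> gauss_on P setT Z v.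
Proof.
move=> [mZ v0 gZ]; split=> // t.
have := gZ t [::] (fun=> setT) isT; rewrite big_nil probability_setT mule1.
move=> /(_ (fun _ => ltac:(by [])) (fun _ => ltac:(by []))) => h.
have mE : measurable_fun setT (fun w => expR (t * Z w)).
  by apply: measurableT_comp => //; exact: measurable_funM.
have h1 : L1 P (fun w => expR (t * Z w)).
  apply/integrableP; split; first exact/measurable_EFinP.
  rewrite (_ : (\int[P]_x _)%E = (expR (t ^+ 2 * v / 2))%:E) ?ltry//.
  rewrite -h; apply: eq_integral => w _.
  by rewrite /= ger0_norm ?expR_ge0// indicT mulr1.
split=> //; rewrite indicT Ex_cst mulr1.
by have := ExE (L1_ind (@measurableT _ Omega) h1); rewrite h indicT => -[<-].
Qed.

Lemma fresh_notin n j (J : seq blockT) : (forall i, i \in J -> fresh n i) ->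
  ~~ fresh n j -> j \notin J.
Proof. by move=> fJ; apply: contra => /fJ. Qed.

Lemma has_gaussian_law_centered (X : Omega -> R) (mn v : R) : measurable_fun setT X ->
  0 <= v -> has_gaussian_law P X mn v -> gauss_on P setT (fun w => X w - mn) v.
Proof.
move=> mX v0 lX; split=> //; first exact: measurable_funB.
move=> t; have mgf := has_gaussian_law_mgf t mX v0 lX.
have mE : measurable_fun setT (fun w => expR (t * X w)).
  by apply: measurableT_comp => //; exact: measurable_funM.
have h1 : L1 P (fun w => expR (t * X w)).
  apply/integrableP; split; first exact/measurable_EFinP.
  rewrite (_ : (\int[P]_x _)%E = (expR (t * mn + t ^+ 2 * v / 2))%:E) ?ltry//.
  by rewrite -mgf; apply: eq_integral => w _; rewrite /= ger0_norm ?expR_ge0.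
have E : (fun w => expR (t * (X w - mn))) = (fun w => expR (- (t * mn)) * expR (t * X w)).
  by apply/funext => w; rewrite -expRD; congr expR; ring.
rewrite E; split; first exact: L1Z.
rewrite indicT Ex_cst mulr1 (_ : (fun w => _) = (fun w => expR (- (t * mn)) * expR (t * X w))).
  have := ExE h1; rewrite mgf ExZ// => -[<-]; rewrite -expRD; congr expR; ring.
by rewrite -E; apply/funext => w; rewrite mulr1.
Qed.

Lemma has_gaussian_law_mean (X : Omega -> R) (mn v : R) : measurable_fun setT X ->
  0 <= v -> has_gaussian_law P X mn v -> L1 P X /\ Ex P X = mn.
Proof.
move=> mX v0 lX; have gX := has_gaussian_law_centered mX v0 lX.
have h1 := gauss_on_L1 gX; have := gauss_on_mean gX.
have LX : L1 P X by apply: L1_ext (L1D h1 (L1_cst P mn)) => w; rewrite subrK.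
rewrite (_ : (fun w => _) = (fun w => X w - mn)); last first.
  by apply/funext => w; rewrite indicT mulr1.
by rewrite ExB ?Ex_cst//; [move/subr0_eq|exact: L1_cst].
Qed.

Lemma prior_mean x : D x -> L1 P (f x) /\ Ex P (f x) = 0.
Proof.
move=> Dx; have [gp1 gp2 gp3] := f_gp.
have [mn [v [v0 lX]]] := gp1 1%N (fun=> x) (fun=> 1) (fun=> Dx).
have E : (fun w => \sum_(i < 1) 1 * f x w) = f x.
  by apply/funext => w; rewrite big_ord1 mul1r.
rewrite E in lX; have [h1 h2] := has_gaussian_law_mean (measurable_funPT (f x)) v0 lX.
by split=> //; have := gp2 x Dx; rewrite unlock ExE// => -[].
Qed.

Lemma adapted_gauss0 F : prior_span F -> exists v, adapted_gauss 0 F v.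
Proof.
move=> lF; have mF := prior_span_measurable lF.
have [n [x [c [Dx FE]]]] := lF; have [gp1 gp2 gp3] := f_gp.
have [mn [v [v0 lawF]]] := gp1 n x c Dx.
rewrite -FE in lawF.
exists v; have mgf t := has_gaussian_law_mgf t mF v0 lawF.
(* [gaussian_process] leaves the mean of a linear combination open; it is computed from the means of
   the summands. *)
have mn0 : mn = 0.
  have [_ <-] := has_gaussian_law_mean mF v0 lawF.
  have h i := prior_mean (Dx i).
  rewrite FE Ex_sum; first by rewrite big1// => i _; rewrite ExZ ?(h i).2 ?mulr0//; exact: (h i).1.
  by move=> i; apply: L1Z; exact: (h i).1.
split=> // t J A uJ fJ bA.
set I := \big[_/_]_(j <- J) _; have mI : measurable I by exact: measurable_block_cap.
have PI0 : 0 <= fine (P I) by rewrite fine_ge0.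
have PI : P I = (fine (P I))%:E by rewrite fineK// fin_num_measure.
under eq_integral do rewrite mulrC.
rewrite (@indep_transfer _ _ _ P F (\1_I) (fun y => expR (t * y)) (fine (P I)))//.
- by rewrite mgf -PI muleC mn0 mulr0 add0r.
- by apply: measurableT_comp => //; exact: measurable_funM.
- move=> B mB; have mFB : measurable (F @^-1` B) by rewrite -[_ @^-1` _]setTI; exact: mF.
  rewrite integral_indic// setIC -PI muleC /I.
  apply: (@indep_cons (inl tt)) => //; last exact: prior_span_block.
  by rewrite /= uJ andbT (fresh_notin fJ).
Qed.

Definition noise n q w := eps_env n w + eps_rep n q w.

(** The two noise terms of step [n] are independent of each other and of [Z] together with all later
    noise, so their Laplace transforms multiply in. Both blocks of step [n] are then spent, whence
    [n.+1]. *)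
Lemma adapted_gaussS n q Z v c : q \in Q -> adapted_gauss n Z v ->
  adapted_gauss n.+1 (fun w => Z w + c * noise n q w)
    (v + c ^+ 2 * (sigma_env ^+ 2 + sigma_rep ^+ 2 / q%:R)).
Proof.
move=> qQ [mZ v0 gZ]; have mN : measurable_fun setT (noise n q) by exact: measurable_funD.
split.
- by apply: measurable_funD => //; exact: measurable_funM.
- by rewrite addr_ge0// mulr_ge0 ?sqr_ge0// addr_ge0 ?divr_ge0 ?sqr_ge0.
move=> t J A uJ fJ bA; set I := \big[_/_]_(j <- J) _.
have mI : measurable I by exact: measurable_block_cap.
have fJn j : j \in J -> fresh n j by move=> /fJ; case: j => [//|[i|i]] /= /ltnW.
pose j1 : blockT := inr (inl n); pose j2 : blockT := inr (inr n).
have j1J : j1 \notin J by apply: (fresh_notin fJ); rewrite /= ltnn.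
have j2J : j2 \notin J by apply: (fresh_notin fJ); rewrite /= ltnn.
have j12 : j1 \notin j2 :: J by rewrite in_cons negb_or j1J andbT.
set K := expR (t ^+ 2 * v / 2).
have mexp a : measurable_fun setT (fun y : R => expR (a * y)).
  by apply: measurableT_comp => //; exact: measurable_funM.
have meZ : measurable_fun setT (fun w => expR (t * Z w)) by exact: measurableT_comp (mexp t) mZ.
have m1 B : measurable B -> measurable (eps_env n @^-1` B).
  by move=> mB; rewrite -[_ @^-1` _]setTI; exact: measurable_funPT.
have m2 B : measurable B -> measurable (eps_rep n q @^-1` B).
  by move=> mB; rewrite -[_ @^-1` _]setTI; exact: measurable_funPT.
(* Starts from product events in the two blocks of step [n]; [E1] and [E2] replace their indicators
   by exponentials, one block at a time. *)
have E0 B B' : measurable B -> measurable B' ->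
    (\int[P]_w (expR (t * Z w) *
        \1_(eps_env n @^-1` B `&` (eps_rep n q @^-1` B' `&` I)) w)%:E =
     K%:E * (P (eps_env n @^-1` B) * (P (eps_rep n q @^-1` B') * P I)))%E.
  move=> mB mB'.
  have bB := @eps_env_block n _ mB; have bB' := @eps_rep_block n _ _ qQ mB'.
  have u2 : uniq (j2 :: J) by rewrite /= j2J.
  have u1 : uniq (j1 :: j2 :: J) by rewrite /= j12 j2J.
  have b2 := upd_block bB' bA.
  have := gZ t (j1 :: j2 :: J) (upd (upd A j2 (eps_rep n q @^-1` B')) j1 (eps_env n @^-1` B)) u1.
  rewrite (upd_cap _ _ j12) (upd_cap _ _ j2J) => ->; last 2 first.
  - by move=> j; rewrite !in_cons => /or3P[/eqP->|/eqP->|/fJn//] /=.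
  - exact: upd_block.
  congr (_ * _)%E.
  rewrite -(indep_cons u2 bB' bA) -(upd_cap _ _ j2J).
  exact: (indep_cons u1 bB b2).
pose M1 := expR ((t * c) ^+ 2 * sigma_env ^+ 2 / 2).
pose M2 := expR ((t * c) ^+ 2 * (sigma_rep ^+ 2 / q%:R) / 2).
have H1 : (\int[P]_w (expR (t * c * eps_env n w))%:E = M1%:E)%E.
  rewrite (has_gaussian_law_mgf (t * c) (measurable_funPT _) _ (eps_env_law n)) ?sqr_ge0//.
  by rewrite mulr0 add0r.
have H2 : (\int[P]_w (expR (t * c * eps_rep n q w))%:E = M2%:E)%E.
  rewrite (has_gaussian_law_mgf (t * c) (measurable_funPT _) _ (eps_rep_law n qQ)).
    by rewrite mulr0 add0r.
  by rewrite divr_ge0 ?sqr_ge0.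
have fP B : measurable B -> P B = (fine (P B))%:E.
  by move=> mB; rewrite fineK// fin_num_measure.
have E1 B' : measurable B' ->
    (\int[P]_w (expR (t * Z w) * \1_(eps_rep n q @^-1` B' `&` I) w
        * expR (t * c * eps_env n w))%:E =
     (K * fine (P (eps_rep n q @^-1` B')) * fine (P I))%:E * M1%:E)%E.
  move=> mB'; rewrite -H1; apply: (@indep_transfer _ _ _ P (eps_env n) _
    (fun y => expR (t * c * y))) => //.
  - by apply: measurable_funM => //; apply: measurable_indicR; apply: measurableI => //; exact: m2.
  - by rewrite !mulr_ge0 ?expR_ge0// fine_ge0.
  move=> B mB; rewrite integral_mkcond.
  transitivity (\int[P]_w (expR (t * Z w) *
      \1_(eps_env n @^-1` B `&` (eps_rep n q @^-1` B' `&` I)) w)%:E)%E.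
    apply: eq_integral => w _; rewrite patchE !indicE !in_setI.
    by case: (w \in _) => //=; rewrite mulr0.
  rewrite E0// !EFinM !fineK ?fin_num_measure//; last exact: m2.
  by rewrite [(P _ * (_ * _))%E]muleC !muleA.
have E2 : (\int[P]_w (expR (t * Z w) * expR (t * c * eps_env n w) * \1_I w
        * expR (t * c * eps_rep n q w))%:E = (K * M1 * fine (P I))%:E * M2%:E)%E.
  rewrite -H2; apply: (@indep_transfer _ _ _ P (eps_rep n q) _
    (fun y => expR (t * c * y))) => //.
  - apply: measurable_funM; last exact: measurable_indicR.
    by apply: measurable_funM => //; apply: measurableT_comp (mexp _) _.
  - by rewrite !mulr_ge0 ?expR_ge0// fine_ge0.
  move=> B mB; rewrite integral_mkcond.
  transitivity (\int[P]_w (expR (t * Z w) * \1_(eps_rep n q @^-1` B `&` I) w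
        * expR (t * c * eps_env n w))%:E)%E.
    apply: eq_integral => w _; rewrite patchE !indicE !in_setI.
    by case: (w \in _) => /=; rewrite ?mulr0 ?mul0r//; congr EFin; ring.
  rewrite E1// !EFinM !fineK ?fin_num_measure//; last exact: m2.
  by rewrite -!muleA; congr (_ * _)%E; rewrite muleC -muleA muleCA.
transitivity (\int[P]_w (expR (t * Z w) * expR (t * c * eps_env n w) * \1_I w
        * expR (t * c * eps_rep n q w))%:E)%E.
  apply: eq_integral => w _; congr EFin; rewrite mulrAC; congr (_ * _).
  by rewrite -!expRD /noise; congr expR; ring.
rewrite E2 [in RHS]fP// -!EFinM; congr EFin.
rewrite mulrAC; congr (_ * _).
by rewrite -!expRD; congr expR; ring.
Qed.

(** Additivity of variances from [adapted_gaussS], applied to the zero variable. *)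
Lemma noise_var n q : q \in Q ->
  ip P (noise n q) (noise n q) = sigma_env ^+ 2 + sigma_rep ^+ 2 / q%:R.
Proof.
move=> qQ; have g0 : adapted_gauss n (fun=> 0) 0.
  split=> // t J A uJ fJ bA.
  have mI := measurable_block_cap bA.
  rewrite !mulr0 mul0r expR0 mul1e -[in RHS](setIT (\big[_/_]_(j <- J) _)) -integral_indic//.
  by apply: eq_integral => w _; rewrite mul1r.
have := gauss_on_var (adapted_gauss_on (adapted_gaussS 1 qQ g0)).
rewrite indicT Ex_cst mulr1 expr1n add0r mul1r => <-.
by apply: Ex_ext => w; rewrite add0r mul1r mulr1 expr2.
Qed.

Definition valid_eval (x : evaluation R m) :=
  [/\ Theta x.1.1, x.1.2 \in T & x.2 \in Q].

(* Paths of evaluations are listed most recent first. *)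
Definition valid_path (p : seq (evaluation R m)) := forall x, x \in p -> valid_eval x.

Lemma valid_path_cons x p : valid_path (x :: p) <-> valid_eval x /\ valid_path p.
Proof.
split=> [h|[hx hp] y]; last by rewrite in_cons => /predU1P[->|/hp].
by split=> [|y yp]; apply: h; rewrite in_cons ?eqxx// yp orbT.
Qed.

(** Large enough to contain both the prior values and the outcomes along [p]. The head of a path is
    its latest evaluation, so the noise belonging to [x] in [x :: p] has time index [size p]. *)
Fixpoint path_space (p : seq (evaluation R m)) : set (Omega -> R) :=
  if p is x :: p' then
    [set Z | exists Z' (c : R), path_space p' Z' /\
      Z = (fun w => Z' w + c * noise (size p') x.2 w)]
  else prior_span.

Lemma path_space_adapted p Z : valid_path p -> path_space p Z ->
  exists v, adapted_gauss (size p) Z v.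
Proof.
elim: p Z => [|x p ih] Z /=; first by move=> _; exact: adapted_gauss0.
move=> /valid_path_cons[[_ _ xQ] vp] [Z' [c [HZ' ->]]].
by have [v gv] := ih _ vp HZ'; eexists; exact: (adapted_gaussS c xQ gv).
Qed.

Lemma path_space_linear p : linear_space (path_space p).
Proof.
elim: p => [|x p [H0 HD]] /=; first exact: prior_span_linear.
split; first by exists (fun=> 0), 0; split=> //; apply/funext => w; rewrite mul0r addr0.
move=> a X Y [X' [c [HX ->]]] [Y' [c' [HY ->]]].
exists (fun w => a * X' w + Y' w), (a * c + c'); split; first exact: HD.
by apply/funext => w; ring.
Qed.

Lemma path_space_gauss p : valid_path p -> gauss_space P (path_space p).
Proof.
move=> vp; split=> [|Z HZ]; first exact: path_space_linear.
by have [v gv] := path_space_adapted vp HZ; exists v; exact: adapted_gauss_on gv.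
Qed.

Lemma path_space_prior p F : prior_span F -> path_space p F.
Proof.
move=> lF; elim: p => [//|x p ih] /=; exists F, 0; split=> //.
by apply/funext => w; rewrite mul0r addr0.
Qed.

Lemma path_space_consW x p Z : path_space p Z -> path_space (x :: p) Z.
Proof.
by move=> HZ; exists Z, 0; split=> //; apply/funext => w; rewrite mul0r addr0.
Qed.

Lemma path_space_noise x p : path_space (x :: p) (noise (size p) x.2).
Proof.
exists (fun=> 0), 1; split; first exact: (path_space_linear p).1.
by apply/funext => w; rewrite add0r mul1r.
Qed.

Lemma path_space_outcome x p : valid_eval x ->
  path_space (x :: p) (outcome f eps_env eps_rep (size p) x).
Proof.
move=> [xT xt xQ]; exists (f x.1), 1; split.
  by apply: path_space_prior; exact: prior_span_f.
by apply/funext => w; rewrite /outcome /noise mul1r addrA.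
Qed.

(** Polarization: by [adapted_gaussS] the variance of the sum is the sum of the variances, so the
    cross term is 0. *)
Lemma noise_orthogonal p Z x : valid_path p -> valid_eval x -> path_space p Z ->
  ip P Z (noise (size p) x.2) = 0.
Proof.
move=> vp vx HZ; have [_ _ xQ] := vx.
have [v gv] := path_space_adapted vp HZ.
have g1 := adapted_gauss_on (adapted_gaussS 1 xQ gv).
have gH : gauss_space P (path_space (x :: p)).
  by apply: path_space_gauss; apply/valid_path_cons.
have HN := path_space_noise x p; have HZ' := path_space_consW x HZ.
have h1 := gauss_on_var g1; have h2 := gauss_on_var (adapted_gauss_on gv).
rewrite !indicT !Ex_cst !mulr1 in h1 h2.
have := ip_sqrD gH 1 HN HZ'.
rewrite noise_var// (ipC P (noise _ _)).
have -> : ip P Z Z = v by rewrite -h2; apply: Ex_ext => w; rewrite mulr1 expr2.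
have -> : ip P (fun w => 1 * noise (size p) x.2 w + Z w) (fun w => 1 * noise (size p) x.2 w + Z w)
  = v + 1 ^+ 2 * (sigma_env ^+ 2 + sigma_rep ^+ 2 / x.2%:R).
  by rewrite -h1; apply: Ex_ext => w; rewrite mulr1; ring.
by rewrite !expr1n !mul1r !mulr1; lra.
Qed.

End gaussian_model.

(** * Linear regression by Gram-Schmidt orthogonalization *)

Section gram_schmidt.
Context {d : measure_display} {Omega : measurableType d} {R : realType}.
Variable P : probability Omega R.
Implicit Types (X Y Z T : Omega -> R) (Ys : seq (Omega -> R)).

Fixpoint span Ys : set (Omega -> R) :=
  if Ys is Y :: Ys' then
    [set Z | exists (a : R) Z', span Ys' Z' /\ Z = (fun w => a * Y w + Z' w)]
  else [set (fun=> 0)].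

Lemma span_linear Ys : linear_space (span Ys).
Proof.
elim: Ys => [|Y Ys [H0 HD]] /=.
  by split=> // a X Y -> ->; apply/funext => w; rewrite mulr0 addr0.
split; first by exists 0, (fun=> 0); split=> //; apply/funext => w; rewrite mul0r addr0.
move=> a X1 X2 [a1 [Z1 [HZ1 ->]]] [a2 [Z2 [HZ2 ->]]].
exists (a * a1 + a2), (fun w => a * Z1 w + Z2 w); split; first exact: HD.
by apply/funext => w; ring.
Qed.

Lemma span_consW Y Ys Z : span Ys Z -> span (Y :: Ys) Z.
Proof. by move=> HZ; exists 0, Z; split=> //; apply/funext => w; rewrite mul0r add0r. Qed.

Lemma span_head Y Ys : span (Y :: Ys) Y.
Proof.
exists 1, (fun=> 0); split; first exact: (span_linear Ys).1.
by apply/funext => w; rewrite mul1r addr0.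
Qed.

Lemma span_sub H Ys : linear_space H -> (forall Y, List.In Y Ys -> H Y) -> span Ys `<=` H.
Proof.
move=> [H0 HD]; elim: Ys => [|Y Ys ih] HYs Z /=; first by move=> ->.
move=> [a [Z' [sZ' ->]]]; apply: HD; first by apply: HYs; left.
by apply: ih => // X HX; apply: HYs; right.
Qed.

(* The residual of u in its regression on Ys, by the Gram-Schmidt process; the
   junk value x / 0 = 0 is the right coefficient for a null residual. *)
Fixpoint residual Ys (u : Omega -> R) : Omega -> R :=
  if Ys is Y :: Ys' then
    let e := residual Ys' Y in
    let r := residual Ys' u in
    fun w => r w - ip P r e / ip P e e * e w
  else u.

Variable H : set (Omega -> R).
Hypothesis gH : gauss_space P H.

Lemma residual_in Ys u : (forall Y, List.In Y Ys -> H Y) -> H u -> H (residual Ys u).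
Proof.
elim: Ys u => [//|Y Ys ih] u HYs Hu /=.
have HYs' X : List.In X Ys -> H X by move=> ?; apply: HYs; right.
apply: linear_spaceB; [exact: gH.1|exact: ih|].
by apply: linear_spaceZ; [exact: gH.1|apply: ih => //; apply: HYs; left].
Qed.

Lemma residual_lin Ys a X Y : (forall Y, List.In Y Ys -> H Y) -> H X -> H Y ->
  residual Ys (fun w => a * X w + Y w) =
  (fun w => a * residual Ys X w + residual Ys Y w).
Proof.
move=> + HX HY; elim: Ys => [//|Z Ys ih] HYs /=.
have HYs' V : List.In V Ys -> H V by move=> ?; apply: HYs; right.
rewrite ih//; apply/funext => w.
rewrite (ipDl gH); try by apply: residual_in => //; apply: HYs; left.
by rewrite mulrDl; ring.
Qed.

Lemma residual_span Ys u : span Ys (fun w => u w - residual Ys u w).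
Proof.
elim: Ys u => [|Y Ys ih] u /=; first by apply/funext => w; rewrite subrr.
set c := _ / _; have := (span_linear Ys).2 (- c) _ _ (ih Y) (ih u) => h.
exists c, (fun w => - c * (Y w - residual Ys Y w) + (u w - residual Ys u w)).
by split=> //; apply/funext => w; ring.
Qed.

Lemma residual_orthogonal Ys u T : (forall Y, List.In Y Ys -> H Y) -> H u ->
  span Ys T -> ip P (residual Ys u) T = 0.
Proof.
elim: Ys u T => [|Y Ys ih] u T HYs Hu /=.
  by move=> ->; rewrite /ip; under Ex_ext => w do rewrite mulr0; rewrite Ex_cst.
have HYs' V : List.In V Ys -> H V by move=> ?; apply: HYs; right.
have HY : H Y by apply: HYs; left.
set r := residual Ys u; set e := residual Ys Y.
have Hr : H r by exact: residual_in.
have He : H e by exact: residual_in.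
have e_orth Z : span Ys Z -> ip P e Z = 0 by exact: ih.
have r_orth Z : span Ys Z -> ip P r Z = 0 by exact: ih.
have HS : span Ys `<=` H by exact: span_sub gH.1 HYs'.
have E : (fun w => r w - ip P r e / ip P e e * e w) =
         (fun w => - (ip P r e / ip P e e) * e w + r w) by apply/funext => w; ring.
have Y_e : Y = (fun w => 1 * e w + (Y w - e w)) by apply/funext => w; ring.
have sYe : span Ys (fun w => Y w - e w) by exact: residual_span.
have ipY Z : H Z -> (forall V, span Ys V -> ip P Z V = 0) -> ip P Z Y = ip P Z e.
  move=> HZ Z_orth; rewrite {1}Y_e (ipDr gH)//; last exact: HS.
  by rewrite (Z_orth _ sYe) mul1r addr0.
move=> [a [Z [sZ ->]]].
have HrE : H (fun w => - (ip P r e / ip P e e) * e w + r w) by exact: gH.1.2.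
rewrite E (ipDr gH)//; last exact: HS.
rewrite !(ipDl gH)//; try exact: HS.
rewrite (e_orth _ sZ) (r_orth _ sZ) !ipY// mulr0 !addr0.
(* If the residual of [Y] is null, the coefficient is 0 by convention, and the product that it
   should cancel is 0 by Cauchy-Schwarz. *)
have [ee0|ee0] := eqVneq (ip P e e) 0; last by rewrite mulNr divfK// addNr mulr0.
have := ip_CS gH Hr He; rewrite ee0 mulr0 => h.
have -> : ip P r e = 0 by apply/eqP; rewrite -sqrf_eq0 eq_le h sqr_ge0.
by rewrite mulr0 addr0 mulr0.
Qed.

Lemma residual_ip Ys u v : (forall Y, List.In Y Ys -> H Y) -> H u -> H v ->
  ip P (residual Ys u) v = ip P (residual Ys u) (residual Ys v).
Proof.
move=> HYs Hu Hv; have Hru := residual_in HYs Hu; have Hrv := residual_in HYs Hv.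
have sv := residual_span Ys v; have HS := span_sub gH.1 HYs.
have {1}-> : v = (fun w => 1 * residual Ys v w + (v w - residual Ys v w)).
  by apply/funext => w; ring.
by rewrite (ipDr gH)// ?(residual_orthogonal HYs Hu sv) ?mul1r ?addr0//; exact: HS.
Qed.

Lemma residual_ip_le Ys u : (forall Y, List.In Y Ys -> H Y) -> H u ->
  ip P (residual Ys u) (residual Ys u) <= ip P u u.
Proof.
move=> HYs Hu; have Hru := residual_in HYs Hu.
have HS := span_sub gH.1 HYs; have su := residual_span Ys u; have Hsu := HS _ su.
have E : u = (fun w => 1 * residual Ys u w + (u w - residual Ys u w)).
  by apply/funext => w; ring.
rewrite {3 4}E (ip_sqrD gH)// (residual_orthogonal HYs Hu su).
by have := ip_ge0 P (fun w => u w - residual Ys u w); lra.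
Qed.

(** The update of the regression of [u] when [Y] is added to [Ys]: a multiple of the innovation
    [residual Ys Y], as in the Kalman filter. *)
Definition increment Y Ys u : Omega -> R :=
  fun w => residual Ys u w - residual (Y :: Ys) u w.

Lemma incrementE Y Ys u : increment Y Ys u = (fun w =>
  ip P (residual Ys u) (residual Ys Y) / ip P (residual Ys Y) (residual Ys Y)
  * residual Ys Y w).
Proof. by apply/funext => w; rewrite /increment/=; ring. Qed.

Lemma increment_orthogonal Y Ys u T : (forall Z, List.In Z (Y :: Ys) -> H Z) ->
  span Ys T -> ip P (increment Y Ys u) T = 0.
Proof.
move=> HYs sT.
have HYs' V : List.In V Ys -> H V by move=> ?; apply: HYs; right.
have HY : H Y by apply: HYs; left.
have HT := span_sub gH.1 HYs' sT; have HrY := residual_in HYs' HY.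
rewrite incrementE; set c := _ / _.
have -> : (fun w => c * residual Ys Y w) = (fun w => c * residual Ys Y w + (fun=> 0) w).
  by apply/funext => w; rewrite addr0.
rewrite (ipDl gH)//; last exact: gH.1.1.
rewrite (residual_orthogonal HYs' HY sT) mulr0 add0r /ip.
by under Ex_ext => w do rewrite mul0r; rewrite Ex_cst.
Qed.

Lemma increment_in Y Ys u : (forall Z, List.In Z (Y :: Ys) -> H Z) -> H u ->
  H (increment Y Ys u).
Proof.
move=> HYs Hu; apply: (linear_spaceB gH.1); apply: residual_in => // V VYs.
by apply: HYs; right.
Qed.

Lemma increment_var Y Ys u : (forall Z, List.In Z (Y :: Ys) -> H Z) -> H u ->
  ip P (increment Y Ys u) (increment Y Ys u) =
  ip P (residual Ys u) (residual Ys Y) ^+ 2 / ip P (residual Ys Y) (residual Ys Y).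
Proof.
move=> HYs Hu.
have HYs' V : List.In V Ys -> H V by move=> ?; apply: HYs; right.
have HY : H Y by apply: HYs; left.
have HrY := residual_in HYs' HY; have H0 := gH.1.1.
rewrite incrementE; set a := ip P (residual Ys u) _; set b := ip P (residual Ys Y) _.
have -> : (fun w => a / b * residual Ys Y w) = (fun w => a / b * residual Ys Y w + (fun=> 0) w).
  by apply/funext => w; rewrite addr0.
rewrite (ip_sqrD gH)// -/b.
have ip0 V : ip P V (fun=> 0) = 0.
  by rewrite /ip; under Ex_ext => w do rewrite mulr0; rewrite Ex_cst.
rewrite !ip0 mulr0 !addr0; have [->|b0] := eqVneq b 0; last by field.
by rewrite invr0 !mulr0.
Qed.

(** Supplies the upper bound on variances that [gauss_on_pos_part_lb] asks for, uniformly over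
    paths. *)
Lemma increment_var_le Y Ys u : (forall Z, List.In Z (Y :: Ys) -> H Z) -> H u ->
  ip P (increment Y Ys u) (increment Y Ys u) <= ip P u u.
Proof.
move=> HYs Hu.
have HYs' V : List.In V Ys -> H V by move=> ?; apply: HYs; right.
have HY : H Y by apply: HYs; left.
have Hru := residual_in HYs' Hu; have HrY := residual_in HYs' HY.
rewrite increment_var//; apply: le_trans (residual_ip_le HYs' Hu).
have [->|b0] := eqVneq (ip P (residual Ys Y) (residual Ys Y)) 0.
  by rewrite invr0 mulr0 ip_ge0.
by rewrite ler_pdivrMr ?(ip_CS gH)// lt0r b0 ip_ge0.
Qed.

(** The revealed variance is [a ^ 2 / b], with [a] the covariance of the error of [u] with [Y] and
    [b] the residual variance of [Y], which is at most [ip P Y Y]. If [b = 0], Cauchy-Schwarz forces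
    [a = 0]. *)
Lemma increment_var_ge Y Ys u : (forall Z, List.In Z (Y :: Ys) -> H Z) -> H u ->
  ip P (residual Ys u) Y ^+ 2 <=
  ip P (increment Y Ys u) (increment Y Ys u) * ip P Y Y.
Proof.
move=> HYs Hu.
have HYs' V : List.In V Ys -> H V by move=> ?; apply: HYs; right.
have HY : H Y by apply: HYs; left.
have Hru := residual_in HYs' Hu; have HrY := residual_in HYs' HY.
rewrite increment_var// residual_ip//.
set a := ip P _ _; set b := ip P (residual Ys Y) _.
have bY : b <= ip P Y Y by exact: residual_ip_le.
have b0 : 0 <= b by exact: ip_ge0.
have := ip_CS gH Hru HrY; rewrite -/a -/b.
have [bE|bN] := eqVneq b 0; first by rewrite bE invr0 !mulr0 mul0r.
move=> _; rewrite -mulrA -[leLHS]mulr1 ler_wpM2l ?sqr_ge0//.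
by rewrite mulrC ler_pdivlMr ?mul1r// lt0r bN.
Qed.

(** The regression error is orthogonal to the span of [Ys], hence independent of every event
    generated by that span. *)
Lemma residual_gauss_on Ys u A : (forall Y, List.In Y Ys -> H Y) -> H u ->
  sigma_span (span Ys) A ->
  gauss_on P A (residual Ys u) (ip P (residual Ys u) (residual Ys u)).
Proof.
move=> HYs Hu sA; apply: (gauss_space_orthogonal gH (span_linear Ys) _ _ _ sA).
- exact: span_sub gH.1 HYs.
- exact: residual_in.
- by move=> T; exact: residual_orthogonal.
Qed.

Lemma increment_gauss_on Y Ys u A : (forall Z, List.In Z (Y :: Ys) -> H Z) -> H u ->
  sigma_span (span Ys) A ->
  gauss_on P A (increment Y Ys u) (ip P (increment Y Ys u) (increment Y Ys u)).
Proof.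
move=> HYs Hu sA; apply: (gauss_space_orthogonal gH (span_linear Ys) _ _ _ sA).
- by apply: span_sub gH.1 _ => V VYs; apply: HYs; right.
- exact: increment_in.
- by move=> T; exact: increment_orthogonal.
Qed.

End gram_schmidt.

(** * Random variables selected by a label with finitely many values *)

Section finite_partitions.
Context {d : measure_display} {Omega : measurableType d} {R : realType}.
Variable P : probability Omega R.
Context {I : choiceType}.
Variables (pt : Omega -> I) (L : seq I).
Hypotheses (uL : uniq L) (ptL : forall w, pt w \in L)
  (mpt : forall i, measurable (pt @^-1` [set i])).
Implicit Types (phi : I -> Omega -> R) (A : set Omega).

Lemma paste_sum phi w :
  phi (pt w) w = \sum_(i <- L) phi i w * \1_(pt @^-1` [set i]) w.
Proof.
rewrite (bigD1_seq (pt w))//= indicE mem_set// mulr1 big1 ?addr0// => i iw.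
by rewrite indicE memNset ?mulr0// => h; move: iw; rewrite -h eqxx.
Qed.

Lemma paste_L1 phi : (forall i, i \in L -> L1 P (phi i)) -> L1 P (fun w => phi (pt w) w).
Proof.
move=> Lphi.
have h i : L1 P (fun w => (if i \in L then phi i w else 0) * \1_(pt @^-1` [set i]) w).
  apply: L1_ind => //; case: (boolP (i \in L)) => [/Lphi//|_].
  exact: L1_cst.
apply: (L1_ext _ (L1_sum L h)) => w; rewrite paste_sum big_seq [RHS]big_seq.
by apply: eq_bigr => i ->.
Qed.

Lemma paste_Ex phi A : measurable A -> (forall i, i \in L -> L1 P (phi i)) ->
  Ex P (fun w => phi (pt w) w * \1_A w) =
  \sum_(i <- L) Ex P (fun w => phi i w * \1_(A `&` pt @^-1` [set i]) w).
Proof.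
move=> mA Lphi.
have h i : L1 P (fun w => (if i \in L then phi i w else 0) * \1_(A `&` pt @^-1` [set i]) w).
  apply: L1_ind; first exact: measurableI.
  by case: (boolP (i \in L)) => [/Lphi//|_]; exact: L1_cst.
have E : \sum_(i <- L) Ex P (fun w => phi i w * \1_(A `&` pt @^-1` [set i]) w) =
  \sum_(i <- L) Ex P (fun w => (if i \in L then phi i w else 0) * \1_(A `&` pt @^-1` [set i]) w).
  by rewrite big_seq [RHS]big_seq; apply: eq_bigr => i ->.
rewrite E -Ex_sum//; apply: Ex_ext => w.
rewrite paste_sum mulr_suml big_seq [RHS]big_seq; apply: eq_bigr => i ->.
by rewrite indicI/= -mulrA [X in _ * X]mulrC.
Qed.

Lemma paste_Ex_eq phi psi A : measurable A ->
  (forall i, i \in L -> L1 P (phi i)) -> (forall i, i \in L -> L1 P (psi i)) ->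
  (forall i, i \in L -> Ex P (fun w => phi i w * \1_(A `&` pt @^-1` [set i]) w) =
     Ex P (fun w => psi i w * \1_(A `&` pt @^-1` [set i]) w)) ->
  Ex P (fun w => phi (pt w) w * \1_A w) = Ex P (fun w => psi (pt w) w * \1_A w).
Proof.
move=> mA Lphi Lpsi h; rewrite !paste_Ex// big_seq [RHS]big_seq.
exact: eq_bigr.
Qed.

Lemma paste_Ex_le phi psi A : measurable A ->
  (forall i, i \in L -> L1 P (phi i)) -> (forall i, i \in L -> L1 P (psi i)) ->
  (forall i, i \in L -> Ex P (fun w => phi i w * \1_(A `&` pt @^-1` [set i]) w) <=
     Ex P (fun w => psi i w * \1_(A `&` pt @^-1` [set i]) w)) ->
  Ex P (fun w => phi (pt w) w * \1_A w) <= Ex P (fun w => psi (pt w) w * \1_A w).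
Proof.
move=> mA Lphi Lpsi h; rewrite !paste_Ex// big_seq [leRHS]big_seq.
exact: ler_sum.
Qed.

Lemma paste_sigma_measurable (G : set (set Omega)) phi :
  (forall i B, i \in L -> measurable B -> <<s G >> (phi i @^-1` B `&` pt @^-1` [set i])) ->
  sigma_measurable G (fun w => phi (pt w) w).
Proof.
move=> h B mB.
rewrite (_ : _ @^-1` B = \big[setU/set0]_(i <- L) (phi i @^-1` B `&` pt @^-1` [set i])).
  rewrite big_seq.
  by elim/big_ind : _ => [|X Y|i iL]; [exact: (@measurable0 _ (g_sigma_algebraType G))
    |exact: sigma_measurableU|exact: h].
rewrite -bigcup_seq; apply/seteqP; split=> [w /= hw|w [i _ [/= hw ptw]]].
  by exists (pt w); [exact: ptL|].
by rewrite /= ptw.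
Qed.

End finite_partitions.

(** * Conditional expectations: existence, uniqueness, monotonicity *)

Section conditional_expectation.
Context {d : measure_display} {Omega : measurableType d} {R : realType}.
Variable P : probability Omega R.
Implicit Types (G : set (set Omega)) (X Y : Omega -> R) (A : set Omega).

Lemma is_cond_expP G X Y : G `<=` measurable -> L1 P X -> sigma_measurable G Y ->
  L1 P Y -> (forall A, <<s G >> A ->
    Ex P (fun w => Y w * \1_A w) = Ex P (fun w => X w * \1_A w)) ->
  is_cond_exp P <<s G >> X Y.
Proof.
move=> Gm LX mY LY h; split=> // A GA; have mA := sub_sigma_measurable Gm GA.
by rewrite !int_setE// h.
Qed.

Lemma is_cond_exp_Ex G X Y A : G `<=` measurable -> L1 P X ->
  is_cond_exp P <<s G >> X Y -> <<s G >> A ->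
  Ex P (fun w => Y w * \1_A w) = Ex P (fun w => X w * \1_A w).
Proof.
move=> Gm LX [_ LY h] GA; have mA := sub_sigma_measurable Gm GA.
by have := h A GA; rewrite !int_setE// => -[].
Qed.

(** The event where [Y] exceeds [Y'] belongs to the conditioning sigma-algebra; comparing integrals
    over it forces the nonnegative difference there to have integral 0. *)
Lemma is_cond_exp_le G X X' Y Y' : G `<=` measurable -> L1 P X -> L1 P X' ->
  is_cond_exp P <<s G >> X Y -> is_cond_exp P <<s G >> X' Y' ->
  (forall A, <<s G >> A ->
    Ex P (fun w => X w * \1_A w) <= Ex P (fun w => X' w * \1_A w)) ->
  {ae P, forall w, Y w <= Y' w}.
Proof.
move=> Gm LX LX' cY cY' h; have [mY LY _] := cY; have [mY' LY' _] := cY'.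
set A := [set w | 0 < Y w - Y' w].
have GA : <<s G >> A.
  have : sigma_measurable G (fun w => (-1) * Y' w + Y w) by exact: sigma_measurable_lin.
  move=> /(_ `]0, +oo[%classic (measurable_itv _)).
  rewrite (_ : _ @^-1` _ = A)//; apply/seteqP.
  by split=> w; rewrite /A/= in_itv/= andbT mulN1r addrC.
have mA := sub_sigma_measurable Gm GA.
pose Z w := (Y w - Y' w) * \1_A w.
have Z0 w : 0 <= Z w.
  rewrite /Z indicE; have [Aw|] := boolP (w \in A); last by rewrite mulr0.
  by rewrite mulr1 ltW//; exact: (set_mem Aw).
have LZ : L1 P Z by apply: L1_ind => //; exact: L1B.
have EZ : Ex P Z = 0.
  apply/eqP; rewrite eq_le Ex_ge0// andbT /Z.
  under Ex_ext => w do rewrite mulrBl.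
  rewrite ExB; [|exact: L1_ind..].
  by rewrite (is_cond_exp_Ex Gm LX cY GA) (is_cond_exp_Ex Gm LX' cY' GA) subr_le0 h.
have : ae_eq P setT (EFin \o Z) (cst 0%E).
  have mZ : measurable_fun setT (EFin \o Z) by exact/measurable_EFinP/(L1_measurable LZ).
  apply/(ae_eq_integral_abs P measurableT mZ).
  by under eq_integral => w _ do rewrite /= ger0_norm//; rewrite ExE// EZ.
apply: filterS => w /(_ I) /= -[]; rewrite /Z indicE.
have [Aw|Aw _] := boolP (w \in A).
  by rewrite mulr1 => h0; move: (set_mem Aw); rewrite /A /= h0 ltxx.
by rewrite leNgt; apply/negP => h0; move/negP: Aw; apply; apply/mem_set; rewrite /A/= subr_gt0.
Qed.

Lemma is_cond_exp_unique G X Y Y' : G `<=` measurable -> L1 P X ->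
  is_cond_exp P <<s G >> X Y -> is_cond_exp P <<s G >> X Y' ->
  {ae P, forall w, Y w = Y' w}.
Proof.
move=> Gm LX cY cY'.
have h1 := is_cond_exp_le Gm LX LX cY cY' (fun _ _ => lexx _).
have h2 := is_cond_exp_le Gm LX LX cY' cY (fun _ _ => lexx _).
by apply: filterS2 h1 h2 => w h1 h2; apply/eqP; rewrite eq_le h1 h2.
Qed.

(** Radon-Nikodym on the smaller sigma-algebra: the charge with density [X] is restricted to it and
    differentiated with respect to the restriction of [P], encoded as the law of the identity map
    into [g_sigma_algebraType G]. *)
Lemma cond_exp_exists G X : G `<=` measurable -> L1 P X ->
  exists Y, is_cond_exp P <<s G >> X Y.
Proof.
move=> Gm LX; pose T' := g_sigma_algebraType G.
have mid : measurable_fun setT (idfun : Omega -> T').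
  by move=> _ B mB; rewrite setTI; exact: (sub_sigma_measurable Gm mB).
pose idG : {mfun Omega >-> T'} := mfun_Sub (mem_set mid).
pose nuX (A : set T') : \bar R := induced_charge LX A.
have nu0 : nuX set0 = 0%E by exact: charge0.
have nufin (A : set T') : measurable A -> nuX A \is a fin_num.
  by move=> mA; apply: (fin_num_measure (induced_charge LX)); exact: (sub_sigma_measurable Gm mA).
have nuadd : semi_sigma_additive nuX.
  move=> F mF tF mUF; have mF' n : measurable (F n : set Omega).
    exact: (sub_sigma_measurable Gm (mF n)).
  exact: (@charge_semi_sigma_additive _ _ _ (induced_charge LX) F mF' tF
    (sub_sigma_measurable Gm mUF)).
pose nuC := isCharge.Build _ T' R nuX nu0 nufin nuadd.
pose nu : {charge set T' -> \bar R} := HB.pack nuX nuC.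
pose mu := distribution P idG.
have dom : nu `<< mu.
  apply/null_content_dominatesP => A mA muA0; apply: null_set_integral => //.
  - exact: (sub_sigma_measurable Gm mA).
  - by apply: measurable_funTS; exact/measurable_EFinP/(L1_measurable LX).
have intY := Radon_Nikodym_integrable dom.
pose Y (w : T') : R := fine (Radon_Nikodym nu mu w).
have YE w : (Y w)%:E = Radon_Nikodym nu mu w by rewrite fineK// Radon_Nikodym_fin_num.
have mY : measurable_fun [set: T'] Y.
  by apply/measurable_EFinP; apply: eq_measurable_fun (measurable_int _ intY) => w _ /=.
have LY : P.-integrable [set: Omega] (EFin \o (Y : Omega -> R)).
  have /integrableP[_ Yoo] := intY; apply/integrableP; split.
    by apply/measurable_EFinP; exact: measurableT_comp mY mid.
  move: Yoo; rewrite ge0_integral_pushforward//=; last first.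
    by apply: measurableT_comp => //; exact: measurable_int intY.
  by under [X in (X < _)%E -> _]eq_integral do rewrite -YE.
exists Y; split.
- exact/sigma_measurableP.
- exact: LY.
move=> A GA; have := Radon_Nikodym_integral dom GA.
rewrite -[LHS]/(\int[P]_(w in A) (X w)%:E)%E => ->.
under [RHS]eq_integral do rewrite -YE.
apply/esym; apply: (@integral_pushforward _ _ Omega T' R (idfun : Omega -> T') mid P A
    (EFin \o Y)) => //.
- exact/measurable_EFinP.
- by apply: (integrableS measurableT) => //; exact: (sub_sigma_measurable Gm GA).
Qed.

Lemma cond_expP G X : G `<=` measurable -> L1 P X ->
  is_cond_exp P <<s G >> X (cond_exp P <<s G >> X).
Proof.
move=> Gm LX; have [Y cY] := cond_exp_exists Gm LX.
by apply: (@xgetPex _ (cst 0) [set Y | is_cond_exp P <<s G >> X Y]); exists Y.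
Qed.

End conditional_expectation.

(** The sets whose trace on [S] lies in [C] form a sigma-algebra, complements being taken inside
    [S]. This reduces the comparison of two sigma-algebras on an atom to generators. *)
Lemma trace_sigma_algebra (T : Type) (G C : set (set T)) (S : set T) :
  sigma_algebra setT C -> C S -> (forall A, G A -> C (A `&` S)) ->
  forall A, <<s G >> A -> C (A `&` S).
Proof.
move=> [C0 CC CU] CS GC.
have CI A B : C A -> C B -> C (A `&` B).
  move=> CA CB; rewrite -[A `&` B]setCK setCI -setTD; apply/CC.
  rewrite -bigcup2E; apply/CU => -[|[|n]] //=; rewrite -setTD; exact/CC.
apply: (@smallest_sub _ (sigma_algebra setT) _ [set A | C (A `&` S)]) => //=.
split=> /=; first by rewrite set0I.
- move=> A CA; rewrite setTD.
  have -> : ~` A `&` S = S `&` (setT `\` (A `&` S)).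
    by rewrite setTD setCI setIUr setICr setU0 setIC.
  by apply: CI => //; exact: CC.
- by move=> A CA; rewrite setI_bigcupl; exact: CU.
Qed.

(** * The history of an adaptive rule on the event of a fixed path *)

Section sampling.
Context {d : measure_display} {Omega : measurableType d} {R : realType}.
Context {P : probability Omega R} {m : nat}.
Variables (f : 'rV[R]_m * nat -> {RV P >-> R})
  (eps_env : nat -> {RV P >-> R}) (eps_rep : nat -> nat -> {RV P >-> R})
  (policy : seq (evaluation R m * R) -> evaluation R m).
Implicit Types (p : seq (evaluation R m)) (A : set Omega).

Local Notation decision := (decision f eps_env eps_rep policy).
Local Notation observation := (observation f eps_env eps_rep policy).
Local Notation outcome := (outcome f eps_env eps_rep).
Local Notation filtration := (filtration f eps_env eps_rep policy).
Local Notation history_events := (history_events f eps_env eps_rep policy).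
Local Notation next_filtration := (next_filtration f eps_env eps_rep policy).

Hypothesis policy_meas : forall n x, filtration n (decision n @^-1` [set x]).

Fixpoint path (n : nat) (w : Omega) : seq (evaluation R m) :=
  if n is n'.+1 then decision n' w :: path n' w else [::].

Fixpoint outcomes p : seq (Omega -> R) :=
  if p is x :: p' then outcome (size p') x :: outcomes p' else [::].

(** On this event the random evaluations are those of [p], so the observations coincide with the
    fixed variables [outcomes p]. *)
Definition atom p : set Omega := path (size p) @^-1` [set p].

Lemma size_path n w : size (path n w) = n.
Proof. by elim: n => //= n ->. Qed.

Lemma atom_cons x p : atom (x :: p) = (decision (size p) @^-1` [set x]) `&` atom p.
Proof. by apply/seteqP; split=> w; rewrite /atom/=; [move=> [-> ->]|move=> [-> ->]]. Qed.

Lemma measurable_outcome n x : measurable_fun setT (outcome n x).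
Proof. by apply: measurable_funD => //; exact: measurable_funD. Qed.

Lemma history_events_sub n : history_events n `<=` history_events n.+1.
Proof. by move=> A [i /= im hA]; exists i => //=; exact: ltnW. Qed.

Lemma filtration_sub n : filtration n `<=` filtration n.+1.
Proof. by apply: sub_sigma_algebra2; exact: history_events_sub. Qed.

Lemma filtration_next_sub n x : filtration n `<=` next_filtration n x.
Proof. by apply: sub_sigma_algebra2 => A ?; left. Qed.

Lemma sigma_span_cons x p :
  sigma_span (span (outcomes p)) `<=` sigma_span (span (outcomes (x :: p))).
Proof.
apply: sub_sigma_algebra2 => A [T sT hA]; exists T => //; exact: span_consW.
Qed.

Lemma sigma_span_preimage p T (B : set R) : span (outcomes p) T -> measurable B ->
  sigma_span (span (outcomes p)) (T @^-1` B).
Proof.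
move=> sT mB; apply: sub_sigma_algebra; exists T => //.
by exists B => //; rewrite setTI.
Qed.

Lemma decision_atom p i w w' : (i < size p)%N -> atom p w -> atom p w' ->
  decision i w = decision i w'.
Proof.
elim: p => //= x p ih; rewrite atom_cons ltnS leq_eqVlt => /predU1P[->|ip].
  by move=> [/= -> _] [/= -> _].
by move=> [_ aw] [_ aw']; exact: ih.
Qed.

Lemma observation_atom p i : (i < size p)%N ->
  exists2 Y, span (outcomes p) Y & forall w, atom p w -> observation i w = Y w.
Proof.
elim: p => //= x p ih; rewrite ltnS leq_eqVlt => /predU1P[->|/ih[Y sY hY]].
  exists (outcome (size p) x); first exact: span_head.
  by move=> w; rewrite atom_cons => -[/= <- _].
exists Y; first exact: span_consW.
by move=> w; rewrite atom_cons => -[_ /hY].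
Qed.

(** On the atom a fixed outcome agrees with the random observation of the same step. The latter is
    measurable for the history on the whole space, which the fixed outcome need not be. *)
Lemma span_atom p T : span (outcomes p) T ->
  exists2 T', sigma_measurable (history_events (size p)) T' &
    forall w, atom p w -> T w = T' w.
Proof.
elim: p T => [|x p ih] T /=.
  by move=> ->; exists (fun=> 0) => //; exact: sigma_measurable_cst.
move=> [a [Z [/ih[Z' mZ' hZ'] ->]]].
exists (fun w => a * observation (size p) w + Z' w).
  apply: sigma_measurable_lin => [B mB|B mB].
    apply: sub_sigma_algebra; exists (size p) => /=; first exact: ltnSn.
    by right; exists B => //; rewrite setTI.
  by apply: filtration_sub; exact: mZ'.
by move=> w; rewrite atom_cons => -[/= <- /hZ' ->].
Qed.

Lemma sigma_span_algebra p : sigma_algebra setT (sigma_span (span (outcomes p))).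
Proof. exact: smallest_sigma_algebra. Qed.

(** On its atom the history knows nothing beyond the fixed outcomes. The two claims feed each other:
    that the atom of [x :: p] is an event of the outcomes is the trace statement for [p], applied to
    the event that the next decision is [x]. *)
Lemma atom_trace p : sigma_span (span (outcomes p)) (atom p) /\
  forall A, filtration (size p) A -> sigma_span (span (outcomes p)) (A `&` atom p).
Proof.
have H q : sigma_span (span (outcomes q)) (atom q) ->
    forall A, filtration (size q) A -> sigma_span (span (outcomes q)) (A `&` atom q).
  move=> hq; apply: trace_sigma_algebra => //; first exact: sigma_span_algebra.
  move=> A [i /= iq [|]] [B mB <-]; rewrite setTI.
    have [[w [aw Bw]]|h] := pselect (exists w, atom q w /\ B (decision i w)).
      rewrite (_ : _ `&` _ = atom q)//; apply/seteqP; split=> [w' []//|w' aw'].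
      by split=> //=; rewrite (decision_atom iq aw' aw).
    rewrite (_ : _ `&` _ = set0); first by have [] := sigma_span_algebra q.
    by apply/seteqP; split=> // w [Bw aw]; apply: h; exists w.
  have [Y sY hY] := observation_atom iq.
  rewrite (_ : _ `&` _ = Y @^-1` B `&` atom q).
    by apply: sigma_measurableI => //; exact: sigma_span_preimage.
  by apply/seteqP; split=> w [/= h aw]; split=> //=; move: h; rewrite hY.
suff h : sigma_span (span (outcomes p)) (atom p) by split=> //; exact: H.
elim: p => [|x p ih].
  by rewrite (_ : atom _ = setT); [exact: sigma_measurableT|apply/seteqP; split].
rewrite atom_cons; apply: (@sigma_span_cons x p).
have hd : filtration (size p) (decision (size p) @^-1` [set x]) by [].
exact: (H p ih _ hd).
Qed.

Lemma filtration_atom p : filtration (size p) (atom p).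
Proof.
elim: p => [|x p ih].
  by rewrite (_ : atom _ = setT); [exact: sigma_measurableT|apply/seteqP; split].
rewrite atom_cons; apply: (@filtration_sub (size p)).
by apply: sigma_measurableI => //; exact: policy_meas.
Qed.

Lemma filtration_trace p A : sigma_span (span (outcomes p)) A ->
  filtration (size p) (A `&` atom p).
Proof.
move: A; apply: trace_sigma_algebra; first exact: smallest_sigma_algebra.
  exact: filtration_atom.
move=> A [T sT [B mB <-]]; rewrite setTI; have [T' mT' hT'] := span_atom sT.
rewrite (_ : _ `&` _ = T' @^-1` B `&` atom p).
  by apply: sigma_measurableI; [exact: mT'|exact: filtration_atom].
by apply/seteqP; split=> w [/= h aw]; split=> //=; move: h; rewrite hT'.
Qed.

(** Here [x] is an arbitrary evaluation, possibly not the chosen one; hence the trace is taken on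
    [atom p] and not on the atom of [x :: p]. *)
Lemma next_atom_trace x p A : next_filtration (size p) x A ->
  sigma_span (span (outcomes (x :: p))) (A `&` atom p).
Proof.
have ha : sigma_span (span (outcomes (x :: p))) (atom p).
  by apply: sigma_span_cons; exact: (atom_trace p).1.
move: A; apply: trace_sigma_algebra => //; first exact: sigma_span_algebra.
move=> A [hA|[B mB <-]].
  by apply: sigma_span_cons; apply: (atom_trace p).2; exact: sub_sigma_algebra.
rewrite setTI; apply: sigma_measurableI => //.
by apply: (@sigma_span_preimage (x :: p)) => //; exact: span_head.
Qed.

Lemma next_filtration_trace x p A : sigma_span (span (outcomes (x :: p))) A ->
  next_filtration (size p) x (A `&` atom p).
Proof.
have ha : next_filtration (size p) x (atom p).
  by apply: filtration_next_sub; exact: filtration_atom.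
move: A; apply: trace_sigma_algebra => //; first exact: smallest_sigma_algebra.
move=> A [T sT [B mB <-]]; rewrite setTI.
have [a [Z [sZ TE]]] := sT.
have [Z' mZ' hZ'] := span_atom sZ.
have mT' : sigma_measurable (history_events (size p) `|`
    preimage_set_system setT (outcome (size p) x) measurable)
    (fun w => a * outcome (size p) x w + Z' w).
  apply: sigma_measurable_lin => [C mC|C mC].
    by apply: sub_sigma_algebra; right; exists C => //; rewrite setTI.
  by apply: filtration_next_sub; exact: mZ'.
rewrite (_ : _ `&` _ = (fun w => a * outcome (size p) x w + Z' w) @^-1` B `&` atom p).
  by apply: sigma_measurableI => //; exact: mT'.
by apply/seteqP; split=> w [/= h aw]; split=> //=; move: h; rewrite TE hZ'.
Qed.

End sampling.

(** * Maxima over finite sets and their conditional expectations *)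

Section fset_maximum.
Context {I : choiceType} {R : realType}.
Implicit Types (A : {fset I}) (F : I -> R).

Lemma seq_maxP (x : I) (s : seq I) F :
  (exists2 i, i \in x :: s & \big[Num.max/F x]_(y <- s) F y = F i) /\
  (forall i, i \in x :: s -> F i <= \big[Num.max/F x]_(y <- s) F y).
Proof.
split; last first.
  move=> i /[1!in_cons] /predU1P[->|].
    by elim: s => [|y s ih]; rewrite ?big_nil ?big_cons ?le_max ?ih ?orbT// lexx.
  elim: s => //= y s ih /[1!in_cons] /predU1P[->|/ih h]; rewrite big_cons le_max ?lexx//.
  by rewrite h orbT.
elim: s => [|y s [i ixs ih]]; first by exists x; rewrite ?mem_head// big_nil.
rewrite big_cons ih /Num.max; case: ifP => _.
  by exists i => //; move: ixs; rewrite !in_cons => /orP[->//|->]; rewrite !orbT.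
by exists y => //; rewrite !in_cons eqxx orbT.
Qed.

Lemma fset_maxP A F : A != fset0 ->
  (exists2 i, i \in A & fset_max A F = F i) /\ (forall i, i \in A -> F i <= fset_max A F).
Proof.
case/fset0Pn => i0 i0A; rewrite /fset_max.
have inA i : (i \in A) = (i \in enum_fset A) by [].
move: i0A; rewrite inA; case E : (enum_fset A) => [//|x s] _.
have [[i ixs h1] h2] := seq_maxP x s F.
by split=> [|j]; [exists i => //; rewrite inA E|rewrite inA E; exact: h2].
Qed.

Lemma fset_max_le A F (M : R) : A != fset0 -> (forall i, i \in A -> F i <= M) ->
  fset_max A F <= M.
Proof. by move=> A0 h; have [[i iA ->] _] := fset_maxP F A0; exact: h. Qed.

End fset_maximum.

Section fset_max_expectation.
Context {d : measure_display} {Omega : measurableType d} {R : realType}.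
Context {I : choiceType}.
Variable P : probability Omega R.
Implicit Types (A : {fset I}) (X Y : I -> Omega -> R).

Lemma measurable_fset_max d' (Omega' : measurableType d') A (X : I -> Omega' -> R) :
  (forall i, i \in A -> measurable_fun setT (X i)) ->
  measurable_fun setT (fun w => fset_max A (X^~ w)).
Proof.
rewrite /fset_max => mX.
have {}mX i : i \in enum_fset A -> measurable_fun setT (X i) by exact: mX.
case: (enum_fset A) mX => [_|x s mX]; first exact: measurable_cst.
have mx : measurable_fun setT (X x) by apply: mX; rewrite mem_head.
have {}mX i : i \in s -> measurable_fun setT (X i).
  by move=> xs; apply: mX; rewrite in_cons xs orbT.
elim: s mX => [|y s ih] mX; first by under eq_fun do rewrite big_nil.
under eq_fun do rewrite big_cons; apply: measurable_maxr.
  by apply: mX; rewrite mem_head.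
by apply: ih => i xs; apply: mX; rewrite in_cons xs orbT.
Qed.

Lemma L1_fset_max A X : A != fset0 -> (forall i, i \in A -> L1 P (X i)) ->
  L1 P (fun w => fset_max A (X^~ w)).
Proof.
move=> A0 LX.
have L1s : L1 P (fun w => \sum_(i <- enum_fset A) (if i \in A then `|X i w| else 0)).
  apply: L1_sum => i; have [iA|_] := boolP (i \in A); last exact: L1_cst.
  by apply: L1_abs; exact: LX.
apply: (L1_le _ _ L1s).
  by apply: measurable_fset_max => i iA; apply: (@L1_measurable _ _ _ P); exact: LX.
move=> w; have [[i iA ->] _] := fset_maxP (X^~ w) A0.
rewrite (bigD1_seq i)/= ?fset_uniq// iA lerDl sumr_ge0// => j _.
by case: ifP.
Qed.

Lemma ae_all_in (J : eqType) (s : seq J) (Pr : J -> Omega -> Prop) :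
  (forall j, j \in s -> {ae P, forall w, Pr j w}) ->
  {ae P, forall w, forall j, j \in s -> Pr j w}.
Proof.
elim: s => [|j s ih] h; first by apply: aeW => w j.
have h1 : {ae P, forall w, Pr j w} by apply: h; rewrite mem_head.
have h2 : {ae P, forall w, forall j, j \in s -> Pr j w}.
  by apply: ih => i si; apply: h; rewrite in_cons si orbT.
by apply: filterS2 h1 h2 => w h1 h2 i /[1!in_cons] /predU1P[->//|/h2].
Qed.

(** Conditional Jensen inequality for the maximum: a conditional expectation of the maximum
    dominates each [Y i] almost surely, hence also their maximum. *)
Lemma cond_exp_fset_max (G : set (set Omega)) A X Y B : G `<=` measurable ->
  A != fset0 -> (forall i, i \in A -> L1 P (X i)) ->
  (forall i, i \in A -> is_cond_exp P <<s G >> (X i) (Y i)) -> <<s G >> B ->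
  Ex P (fun w => fset_max A (Y^~ w) * \1_B w) <=
  Ex P (fun w => fset_max A (X^~ w) * \1_B w).
Proof.
move=> Gm A0 LX cY GB; have mB := sub_sigma_measurable Gm GB.
have LM := L1_fset_max A0 LX.
have LY i : i \in A -> L1 P (Y i) by move=> /cY[].
have [Z cZ] := cond_exp_exists Gm LM; have [_ LZ _] := cZ.
rewrite -(is_cond_exp_Ex Gm LM cZ GB).
apply: Ex_le_ae; [by apply: L1_ind => //; exact: L1_fset_max|exact: L1_ind|].
have h i : i \in enum_fset A -> {ae P, forall w, Y i w <= Z w}.
  move=> iA; apply: (is_cond_exp_le Gm (LX i iA) LM (cY i iA) cZ) => C GC.
  have mC := sub_sigma_measurable Gm GC.
  apply: Ex_le; [by apply: L1_ind => //; exact: LX|exact: L1_ind|].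
  move=> w; rewrite ler_wpM2r ?indicE//; exact: (fset_maxP (X^~ w) A0).2.
apply: filterS (ae_all_in h) => w hw.
by rewrite ler_wpM2r ?indicE//; apply: fset_max_le.
Qed.

End fset_max_expectation.

(** * Elementary estimates for costs and for the choice of constants *)

Section real_estimates.
Variable R : realType.

(** Clears the costs from a comparison of two values per cost, on the event whose indicator is
    [i]. *)
Lemma ratio_indic_le (a b c e i : R) : 1 <= c -> 1 <= e ->
  i = 0 \/ (i = 1 /\ a / c <= b / e) -> e * (a * i) <= c * (b * i).
Proof.
move=> c1 e1 [->|[->]]; first by rewrite !mulr0.
rewrite ler_pdivrMr ?(lt_le_trans _ c1)//.
by rewrite mulrAC ler_pdivlMr ?(lt_le_trans _ e1)// !mulr1 [e * a]mulrC [c * b]mulrC.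
Qed.

Lemma le_of_sqr_le_split (V C b v1 v2 : R) : 0 < C -> 0 < b -> 0 <= V ->
  V ^+ 2 <= 2 * C * (v1 + v2) -> v1 < b ^+ 2 / (4 * C) -> v2 < b ^+ 2 / (4 * C) -> V <= b.
Proof.
move=> C0 b0 V0 h h1 h2; have b0' := ltW b0; rewrite -(@ler_sqr _ V b) ?nnegrE//.
apply: (le_trans h).
have -> : b ^+ 2 = 2 * C * (b ^+ 2 / (4 * C) + b ^+ 2 / (4 * C)) by field; rewrite gt_eqF.
by rewrite ler_pM2l ?mulr_gt0// ltW// ltrD.
Qed.

(** Three terms of at most [e / 4] each. The factor [4 (B + 1) K / e] is made for the second, the
    bounds on [kappa * p1] and [kappa * p2] for the third; [B + 1] stands in for [B], which may be
    0. *)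
Lemma V_leading_budget (B K e kappa a p1 p2 : R) : 0 <= B -> 0 < K -> 0 < e -> 0 < kappa ->
  a <= K -> kappa * p1 < e * kappa / (8 * (B + 1)) -> kappa * p2 < e * kappa / (8 * (B + 1)) ->
  e / 4 + (B / (4 * (B + 1) * K / e) * a + B * (p1 + p2)) < e.
Proof.
move=> B0 K0 e0 k0 aK h1 h2; have B1 : 0 < B + 1 by rewrite ltr_wpDl.
have {h1}h1 : p1 < e / (8 * (B + 1)) by rewrite -(ltr_pM2l k0) mulrA [kappa * e]mulrC.
have {h2}h2 : p2 < e / (8 * (B + 1)) by rewrite -(ltr_pM2l k0) mulrA [kappa * e]mulrC.
have h3 : B / (4 * (B + 1) * K / e) * a <= e / 4.
  have -> : B / (4 * (B + 1) * K / e) * a = e / 4 * (B / (B + 1) * (a / K)).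
    by field; rewrite !gt_eqF.
  have e4 : 0 <= e / 4 by rewrite divr_ge0// ltW.
  rewrite ler_piMr//.
  have : a / K <= 1 by rewrite ler_pdivrMr ?mul1r.
  have : 0 <= B / (B + 1) by rewrite divr_ge0// ltW.
  have : B / (B + 1) <= 1 by rewrite ler_pdivrMr// mul1r lerDl.
  by move: (B / (B + 1)) (a / K) => y z; nra.
have h4 : B * (p1 + p2) <= e / 4.
  apply: (@le_trans _ _ ((B + 1) * (e / (8 * (B + 1)) + e / (8 * (B + 1))))); last first.
    by rewrite le_eqVlt; apply/orP; left; apply/eqP; field; rewrite gt_eqF.
  apply: (@le_trans _ _ (B * (e / (8 * (B + 1)) + e / (8 * (B + 1))))).
    by apply: ler_wpM2l => //; rewrite ltW// ltrD.
  by rewrite ler_pM2r ?lerDl// addr_gt0// divr_gt0 ?mulr_gt0.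
by move: h3 h4; lra.
Qed.

Lemma cvg0_sum (I : eqType) (s : seq I) (a : I -> nat -> R) :
  (forall i, i \in s -> a i @ \oo --> 0) ->
  (fun n => \sum_(i <- s) a i n) @ \oo --> 0.
Proof.
elim: s => [|i s ih] h.
  rewrite (_ : (fun=> _) = fun=> 0); first exact: cvg_cst.
  by apply/funext => n; rewrite big_nil.
rewrite (_ : (fun=> _) = fun n => a i n + \sum_(j <- s) a j n); last first.
  by apply/funext => n; rewrite big_cons.
rewrite -[X in _ --> X](addr0 0); apply: cvgD; first by apply: h; rewrite mem_head.
by apply: ih => j hj; apply: h; rewrite in_cons hj orbT.
Qed.

End real_estimates.

(** * Posterior means and variances along the random path *)

Section posterior.
Context {d : measure_display} {Omega : measurableType d} {R : realType}.
Context {P : probability Omega R} {m : nat}.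
Variables (f : 'rV[R]_m * nat -> {RV P >-> R})
  (eps_env : nat -> {RV P >-> R}) (eps_rep : nat -> nat -> {RV P >-> R})
  (policy : seq (evaluation R m * R) -> evaluation R m)
  (Theta : set 'rV[R]_m) (Theta_bar : {fset 'rV[R]_m}) (T Q : {fset nat})
  (k : 'rV[R]_m * nat -> 'rV[R]_m * nat -> R)
  (sigma_env sigma_rep : R).
Hypotheses
  (Theta_bar_sub : [set` Theta_bar] `<=` Theta)
  (f_gp : gaussian_process [set x | Theta x.1 /\ x.2 \in T] f (fun=> 0) k)
  (eps_env_law : forall n, has_gaussian_law P (eps_env n) 0 (sigma_env ^+ 2))
  (eps_rep_law : forall n q, q \in Q ->
     has_gaussian_law P (eps_rep n q) 0 (sigma_rep ^+ 2 / q%:R))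
  (indep : mutually_independent P (model_block f eps_env eps_rep Theta T Q)).

Local Notation decision := (decision f eps_env eps_rep policy).
Local Notation outcome := (outcome f eps_env eps_rep).
Local Notation filtration := (filtration f eps_env eps_rep policy).
Local Notation history_events := (history_events f eps_env eps_rep policy).
Local Notation next_filtration := (next_filtration f eps_env eps_rep policy).
Local Notation path := (path f eps_env eps_rep policy).
Local Notation outcomes := (outcomes f eps_env eps_rep).
Local Notation atom := (atom f eps_env eps_rep policy).
Local Notation prior_span := (prior_span f Theta T).
Local Notation path_space := (path_space f eps_env eps_rep Theta T).
Local Notation valid_eval := (valid_eval Theta T Q).
Local Notation valid_path := (valid_path Theta T Q).
Local Notation noise := (noise eps_env eps_rep).

Hypotheses
  (policy_in : forall n w, evaluations Theta_bar T Q (decision n w))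
  (policy_meas : forall n x, filtration n (decision n @^-1` [set x])).

Implicit Types (p : seq (evaluation R m)) (A : set Omega) (u : Omega -> R).

Definition all_evals : seq (evaluation R m) :=
  [seq (xt, q) | xt <- [seq (th, t) | th <- enum_fset Theta_bar, t <- enum_fset T],
                 q <- enum_fset Q].

Lemma mem_all_evals x : reflect (evaluations Theta_bar T Q x) (x \in all_evals).
Proof.
apply: (iffP allpairsP) => [[[xt q] /= [/allpairsP[[th t] /= [h1 h2 ->]] h3 ->]]|].
  by split.
by case: x => [[th t] q] [/= h1 h2 h3]; exists ((th, t), q); split=> //;
  apply/allpairsP; exists (th, t).
Qed.

Fixpoint all_paths n : seq (seq (evaluation R m)) :=
  if n is n'.+1 then [seq x :: p | x <- all_evals, p <- all_paths n'] else [:: [::]].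

Lemma eval_valid x : evaluations Theta_bar T Q x -> valid_eval x.
Proof. by move=> [h1 h2 h3]; split=> //; exact: Theta_bar_sub. Qed.

Lemma path_all_paths n w : path n w \in undup (all_paths n).
Proof.
rewrite mem_undup; elim: n => //= n ih; apply/allpairsP.
by exists (decision n w, path n w); split=> //; apply/mem_all_evals; exact: policy_in.
Qed.

Lemma all_paths_valid n p : p \in undup (all_paths n) -> size p = n /\ valid_path p.
Proof.
rewrite mem_undup; elim: n p => [|n ih] p /=; first by rewrite inE => /eqP ->.
move=> /allpairsP[[x p'] /= [/mem_all_evals hx /ih[sp vp] ->]] /=.
by rewrite sp; split=> //; apply/valid_path_cons; split=> //; exact: eval_valid.
Qed.

(** The decision at step [n] is measurable through [filtration n], whose measurability is the
    induction hypothesis; the observation is pasted from the outcomes of finitely many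
    evaluations. *)
Lemma history_events_measurable n : history_events n `<=` measurable.
Proof.
elim: n => [|n ih]; first by move=> A [i].
have Fm : filtration n `<=` measurable by exact: sub_sigma_measurable.
have dm (S : set (evaluation R m)) (C : evaluation R m -> set Omega) :
    (forall x, measurable (C x)) ->
    measurable [set w | S (decision n w) /\ C (decision n w) w].
  move=> mC.
  rewrite (_ : [set w | _] = \big[setU/set0]_(x <- all_evals)
     (decision n @^-1` [set x] `&` [set w | S x] `&` C x)).
    elim/big_ind : _ => [//|X Y mX mY|x _]; first exact: measurableU.
    apply: measurableI => //; apply: measurableI; first by apply: Fm; exact: policy_meas.
    have [Sx|Sx] := pselect (S x); first by rewrite (_ : [set w | _] = setT)//; apply/seteqP; split.
    by rewrite (_ : [set w | _] = set0)//; apply/seteqP; split.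
  rewrite -bigcup_seq; apply/seteqP; split=> [w /= [h1 h2]|w [x _ [[/= -> h1] h2]]//].
  by exists (decision n w) => //=; apply/mem_all_evals; exact: policy_in.
move=> A [i /= iSn hA].
have [ltin|] := ltnP i n; first by apply: ih; exists i.
rewrite leq_eqVlt ltnNge -ltnS iSn orbF => /eqP ni.
move: hA; rewrite -ni => -[] [B mB <-]; rewrite setTI.
  rewrite (_ : _ @^-1` B = [set w | B (decision n w) /\ setT w]); last first.
    by apply/seteqP; split=> [w|w []].
  exact: (@dm _ (fun=> setT)).
rewrite (_ : _ @^-1` B = [set w | setT (decision n w) /\ (outcome n (decision n w) @^-1` B) w]).
  apply: (@dm _ (fun x => outcome n x @^-1` B)) => x; rewrite -[_ @^-1` _]setTI.
  exact: measurable_outcome.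
by apply/seteqP; split=> [w|w []].
Qed.

Lemma filtration_measurable n : filtration n `<=` measurable.
Proof. by apply: sub_sigma_measurable; exact: history_events_measurable. Qed.

Lemma next_events_measurable n x : history_events n `|`
  preimage_set_system setT (outcome n x) measurable `<=` measurable.
Proof.
move=> A [|[B mB <-]]; first exact: history_events_measurable.
exact: measurable_outcome.
Qed.

Lemma path_measurable n p : measurable (path n @^-1` [set p]).
Proof.
have [<-|np] := eqVneq (size p) n.
  by apply: (@filtration_measurable (size p)); exact: filtration_atom.
rewrite (_ : _ @^-1` _ = set0)//; apply/seteqP; split=> // w /= h.
by move: np; rewrite -h size_path eqxx.
Qed.

Lemma outcomes_path_space p Y : valid_path p -> List.In Y (outcomes p) -> path_space p Y.
Proof.
elim: p => [//|x p ih] /valid_path_cons[vx vp] [<-|/(ih vp) h].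
  exact: (path_space_outcome _ _ _ p vx).
exact: path_space_consW.
Qed.

Lemma outcomes_path_space_cons x p Y : valid_eval x -> valid_path p ->
  List.In Y (outcome (size p) x :: outcomes p) -> path_space (x :: p) Y.
Proof. by move=> vx vp; apply: (@outcomes_path_space (x :: p)); apply/valid_path_cons. Qed.

Let gauss_path p (vp : valid_path p) : gauss_space P (path_space p) :=
  path_space_gauss f_gp eps_env_law eps_rep_law indep vp.

Lemma valid_cons x p : valid_eval x -> valid_path p -> valid_path (x :: p).
Proof. by move=> vx vp; apply/valid_path_cons. Qed.

(* Posterior mean of u after n steps, and after one more evaluation x; r_ n u is
   the posterior error, V_ n u the posterior variance, dmu the change of the mean. *)
Definition r_ n u w := residual P (outcomes (path n w)) u w.
Definition V_ n u w :=
  ip P (residual P (outcomes (path n w)) u) (residual P (outcomes (path n w)) u).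
Definition mu_ n u w := u w - r_ n u w.
Definition nmu n x u w := u w - residual P (outcome n x :: outcomes (path n w)) u w.
Definition dmu n x u w := increment P (outcome n x) (outcomes (path n w)) u w.
Definition Vd n x u w :=
  ip P (increment P (outcome n x) (outcomes (path n w)) u)
       (increment P (outcome n x) (outcomes (path n w)) u).

Lemma nmuE n x u w : nmu n x u w = mu_ n u w + dmu n x u w.
Proof. by rewrite /nmu /mu_ /dmu /r_ /increment; ring. Qed.

Lemma mu_S n u w : mu_ n.+1 u w = nmu n (decision n w) u w.
Proof. by rewrite /mu_ /nmu /r_/= size_path. Qed.

Lemma prior_L1 u : prior_span u -> L1 P u.
Proof.
move=> pu; have gH : gauss_space P (path_space [::]) by exact: gauss_path.
exact: (gauss_space_L1 gH).
Qed.

Section fixed_time.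
Variables (n : nat) (u : Omega -> R).
Hypothesis pu : prior_span u.

Let u_in p : path_space p u. Proof. exact: path_space_prior. Qed.

Lemma L1_residual p : valid_path p -> L1 P (residual P (outcomes p) u).
Proof.
move=> vp; apply: (gauss_space_L1 (gauss_path vp)).
by apply: (residual_in (gauss_path vp)) => // Y; exact: outcomes_path_space.
Qed.

Lemma L1sqr_residual p : valid_path p -> L1 P (fun w => residual P (outcomes p) u w ^+ 2).
Proof.
move=> vp; apply: (gauss_space_L1sqr (gauss_path vp)).
by apply: (residual_in (gauss_path vp)) => // Y; exact: outcomes_path_space.
Qed.

Lemma L1_increment x p : valid_eval x -> valid_path p ->
  L1 P (increment P (outcome (size p) x) (outcomes p) u).
Proof.
move=> vx vp; have vxp := valid_cons vx vp.
apply: (gauss_space_L1 (gauss_path vxp)); apply: (increment_in (gauss_path vxp)) => //.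
by move=> Y; exact: outcomes_path_space_cons.
Qed.

Lemma residual_gauss p A : valid_path p -> filtration (size p) A ->
  gauss_on P (A `&` atom p) (residual P (outcomes p) u)
    (ip P (residual P (outcomes p) u) (residual P (outcomes p) u)).
Proof.
move=> vp FA; apply: (residual_gauss_on (gauss_path vp)) => //.
  by move=> Y; exact: outcomes_path_space.
exact: (atom_trace policy_meas p).2.
Qed.

Lemma increment_gauss x p A : valid_eval x -> valid_path p -> filtration (size p) A ->
  gauss_on P (A `&` atom p) (increment P (outcome (size p) x) (outcomes p) u)
    (ip P (increment P (outcome (size p) x) (outcomes p) u)
          (increment P (outcome (size p) x) (outcomes p) u)).
Proof.
move=> vx vp FA; have vxp := valid_cons vx vp.
apply: (increment_gauss_on (gauss_path vxp)) => //.
  by move=> Y; exact: outcomes_path_space_cons.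
exact: (atom_trace policy_meas p).2.
Qed.

Let paste (phi : seq (evaluation R m) -> Omega -> R) :
  (forall p, p \in undup (all_paths n) -> L1 P (phi p)) ->
  L1 P (fun w => phi (path n w) w).
Proof.
exact: (paste_L1 (undup_uniq (all_paths n)) (path_all_paths n) (path_measurable n)).
Qed.

Lemma L1_r : L1 P (r_ n u).
Proof.
have := @paste (fun p => residual P (outcomes p) u); apply => p /all_paths_valid[_ vp].
exact: L1_residual.
Qed.

Lemma L1_r2 : L1 P (fun w => r_ n u w ^+ 2).
Proof.
have := @paste (fun p w => residual P (outcomes p) u w ^+ 2); apply => p /all_paths_valid[_ vp].
exact: L1sqr_residual.
Qed.

Lemma L1_V : L1 P (V_ n u).
Proof.
have := @paste (fun p _ => ip P (residual P (outcomes p) u) (residual P (outcomes p) u)); apply.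
by move=> p _; exact: L1_cst.
Qed.

Lemma L1_mu : L1 P (mu_ n u).
Proof. by apply: L1B; [exact: prior_L1|exact: L1_r]. Qed.

Lemma L1_dmu x : valid_eval x -> L1 P (dmu n x u).
Proof.
move=> vx.
have := @paste (fun p => increment P (outcome n x) (outcomes p) u); apply => p /all_paths_valid[<- vp].
exact: L1_increment.
Qed.

Lemma V_ge0 w : 0 <= V_ n u w. Proof. exact: ip_ge0. Qed.

Lemma V_le w : V_ n u w <= ip P u u.
Proof.
have [_ vp] := all_paths_valid (path_all_paths n w).
apply: (residual_ip_le (gauss_path vp)) => //.
by move=> Y; exact: outcomes_path_space.
Qed.

Lemma Ex_r A : filtration n A -> Ex P (fun w => r_ n u w * \1_A w) = 0.
Proof.
move=> FA; have mA := filtration_measurable FA.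
rewrite /r_ (paste_Ex (undup_uniq (all_paths n)) (path_all_paths n) (path_measurable n)
  (phi := fun p => residual P (outcomes p) u))//; last first.
  by move=> p /all_paths_valid[_ vp]; exact: L1_residual.
rewrite big_seq big1// => p /all_paths_valid[sp vp].
by rewrite -sp; apply: gauss_on_mean; apply: residual_gauss => //; rewrite sp.
Qed.

(** Given the path, the error has a deterministic variance; the identity is summed over the finitely
    many paths. *)
Lemma Ex_r2 A : filtration n A ->
  Ex P (fun w => r_ n u w ^+ 2 * \1_A w) = Ex P (fun w => V_ n u w * \1_A w).
Proof.
move=> FA; have mA := filtration_measurable FA.
apply: (paste_Ex_eq (undup_uniq (all_paths n)) (path_all_paths n) (path_measurable n)
  (phi := fun p w => residual P (outcomes p) u w ^+ 2)
  (psi := fun p w => ip P (residual P (outcomes p) u) (residual P (outcomes p) u))) => //.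
- by move=> p /all_paths_valid[_ vp]; exact: L1sqr_residual.
- by move=> p _; exact: L1_cst.
move=> p /all_paths_valid[sp vp].
have FA' : filtration (size p) A by rewrite sp.
have := gauss_on_var (residual_gauss vp FA'); rewrite /atom sp => ->.
by rewrite ExZ//; apply: L1_bdd; [apply: measurable_indicR; apply: measurableI => //;
  exact: path_measurable|move=> w; exact: indic_le1].
Qed.

Lemma Ex_dmu x A : valid_eval x -> filtration n A ->
  Ex P (fun w => dmu n x u w * \1_A w) = 0.
Proof.
move=> vx FA; have mA := filtration_measurable FA.
rewrite /dmu (paste_Ex (undup_uniq (all_paths n)) (path_all_paths n) (path_measurable n)
  (phi := fun p => increment P (outcome n x) (outcomes p) u))//; last first.
  by move=> p /all_paths_valid[<- vp]; exact: L1_increment.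
rewrite big_seq big1// => p /all_paths_valid[sp vp].
by rewrite -sp; apply: gauss_on_mean; apply: increment_gauss => //; rewrite sp.
Qed.

(** Adaptive choice of the evaluations does no harm: on each atom the regression lies in the span of
    the fixed outcomes, and the error integrates to 0 over every event of the history. *)
Lemma mu_cond_exp : is_cond_exp P (filtration n) u (mu_ n u).
Proof.
have Lu := prior_L1 pu.
apply: is_cond_expP => //.
- exact: history_events_measurable.
- apply: (paste_sigma_measurable (path_all_paths n)
    (phi := fun p w => u w - residual P (outcomes p) u w)) => p B /all_paths_valid[sp vp] mB.
  rewrite -sp; apply: filtration_trace => //; apply: sigma_span_preimage => //.
  exact: residual_span.
- exact: L1_mu.
move=> A FA; have mA := filtration_measurable FA.
under Ex_ext => w do rewrite mulrBl.
by rewrite ExB ?Ex_r ?subr0//; apply: L1_ind => //; exact: L1_r.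
Qed.

Lemma nmu_cond_exp x : valid_eval x -> is_cond_exp P (next_filtration n x) u (nmu n x u).
Proof.
move=> vx; have Lu := prior_L1 pu.
have Lnmu : L1 P (nmu n x u).
  by apply: (L1_ext _ (L1D L1_mu (L1_dmu vx))) => w; rewrite nmuE.
apply: is_cond_expP => //.
- exact: next_events_measurable.
- apply: (paste_sigma_measurable (path_all_paths n)
    (phi := fun p w => u w - residual P (outcome n x :: outcomes p) u w)).
  move=> p B /all_paths_valid[sp vp] mB.
  rewrite -sp; apply: next_filtration_trace => //.
  by apply: (@sigma_span_preimage _ _ _ _ _ _ _ _ (x :: p)) => //; exact: residual_span.
move=> A FA.
have mA := sub_sigma_measurable (@next_events_measurable n x) FA.
have Lr p : p \in undup (all_paths n) ->
    L1 P (fun w => u w - residual P (outcome n x :: outcomes p) u w).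
  move=> /all_paths_valid[sp vp]; apply: L1B => //; rewrite -sp.
  have vxp := valid_cons vx vp; apply: (gauss_space_L1 (gauss_path vxp)).
  by apply: (residual_in (gauss_path vxp)) => // Y; exact: (@outcomes_path_space (x :: p)).
apply: (paste_Ex_eq (undup_uniq (all_paths n)) (path_all_paths n) (path_measurable n)
  (phi := fun p w => u w - residual P (outcome n x :: outcomes p) u w)
  (psi := fun p => u)) => //.
move=> p /[dup] hp /all_paths_valid[sp vp]; have vxp := valid_cons vx vp.
have gA : gauss_on P (A `&` atom p) (residual P (outcomes (x :: p)) u)
   (ip P (residual P (outcomes (x :: p)) u) (residual P (outcomes (x :: p)) u)).
  apply: (residual_gauss_on (gauss_path vxp)) => //.
    by move=> Y; exact: (@outcomes_path_space (x :: p)).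
  by apply: next_atom_trace => //; rewrite sp.
have mAp : measurable (A `&` path n @^-1` [set p]).
  by apply: measurableI => //; exact: path_measurable.
under Ex_ext => w do rewrite mulrBl.
rewrite ExB; [|exact: L1_ind|].
  by have := gauss_on_mean gA; rewrite /atom sp /= sp => ->; rewrite subr0.
apply: L1_ind => //; have := gauss_on_L1 gA.
by rewrite /= sp.
Qed.

End fixed_time.

(** On each atom meeting [A] the change of the mean is Gaussian with variance between [beta] and the
    prior variance of [u], so one [kappa] works for all [n], [x] and [A]. *)
Lemma dmu_pos_part_lb u (M beta : R) : prior_span u -> 0 <= M -> 0 < beta ->
  exists2 kappa, 0 < kappa & forall n x A, valid_eval x -> filtration n A ->
    (forall w, A w -> beta <= Vd n x u w) ->
    kappa * Ex P (\1_A) <= Ex P (fun w => Num.max (dmu n x u w - M) 0 * \1_A w).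
Proof.
move=> pu M0 b0; have [kappa k0 hk] := gauss_on_pos_part_lb P (ip P u u) M0 b0.
exists kappa => // n x A vx FA hA; have mA := filtration_measurable FA.
have L1A (B : set Omega) : measurable B -> L1 P (\1_B).
  by move=> mB; apply: L1_bdd; [exact: measurable_indicR|move=> w; exact: indic_le1].
rewrite -ExZ; last exact: L1A.
apply: (paste_Ex_le (undup_uniq (all_paths n)) (path_all_paths n) (path_measurable n)
  (phi := fun p w => kappa)
  (psi := fun p w => Num.max (increment P (outcome n x) (outcomes p) u w - M) 0)) => //.
- by move=> p _; exact: L1_cst.
- move=> p /all_paths_valid[sp vp]; have := L1_increment pu vx vp; rewrite sp => Li.
  apply: (L1_le _ _ (L1D (L1_abs Li) (L1_cst P M))).
    apply: measurable_maxr => //; apply: measurable_funB => //; exact: L1_measurable Li.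
  move=> w; rewrite ger0_norm ?le_max ?lexx ?orbT// ge_max addr_ge0// andbT.
  by rewrite lerD ?ler_norm// (le_trans _ M0)// oppr_le0.
move=> p /all_paths_valid[sp vp]; have mAp : measurable (A `&` path n @^-1` [set p]).
  by apply: measurableI => //; exact: path_measurable.
rewrite ExZ; last exact: L1A.
(* [Vd] is constant where the path equals [p], so a single point of [A] there yields the lower bound
   on the variance; if there is none, the inequality is trivial. *)
have [[w [Aw pw]]|h0] := pselect (exists w, A w /\ path n w = p); last first.
  rewrite (_ : A `&` _ = set0).
    rewrite indic0 Ex_cst mulr0; apply: Ex_ge0 => w.
    by rewrite mulr0.
  by apply/seteqP; split=> // w [/= Aw pw]; apply: h0; exists w.
have FA' : filtration (size p) A by rewrite sp.
have := increment_gauss pu vx vp FA'; rewrite /atom sp => gA.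
apply: (hk _ _ _ gA); apply/andP; split.
  by have := hA w Aw; rewrite /Vd pw.
have vxp := valid_cons vx vp; rewrite -sp.
apply: (increment_var_le (gauss_path vxp)); last exact: path_space_prior.
by move=> Y; exact: outcomes_path_space_cons.
Qed.

Lemma path_valid n w : valid_path (path n w).
Proof. by have [] := all_paths_valid (path_all_paths n w). Qed.

Lemma r_lin n a X Y w : prior_span X -> prior_span Y ->
  r_ n (fun w => a * X w + Y w) w = a * r_ n X w + r_ n Y w.
Proof.
move=> pX pY; have vp := @path_valid n w.
rewrite /r_ (residual_lin (gauss_path vp))//; last 2 first.
- exact: path_space_prior.
- exact: path_space_prior.
by move=> Z; exact: outcomes_path_space.
Qed.

Lemma nmu_lin n x a X Y w : valid_eval x -> prior_span X -> prior_span Y ->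
  nmu n x (fun w => a * X w + Y w) w = a * nmu n x X w + nmu n x Y w.
Proof.
move=> vx pX pY; have vxp := valid_cons vx (@path_valid n w).
rewrite /nmu (residual_lin (gauss_path vxp)); last 2 first.
- exact: path_space_prior.
- exact: path_space_prior.
  by ring.
by have := @outcomes_path_space_cons x (path n w); rewrite size_path => h Z; apply: h => //; exact: path_valid.
Qed.

Lemma dmu_lin n x a X Y w : valid_eval x -> prior_span X -> prior_span Y ->
  dmu n x (fun w => a * X w + Y w) w = a * dmu n x X w + dmu n x Y w.
Proof.
move=> vx pX pY.
have E u : dmu n x u w = nmu n x u w - (u w - r_ n u w).
  by rewrite nmuE /mu_; ring.
by rewrite !E nmu_lin// r_lin//; ring.
Qed.

Definition lambda_ q : R := sigma_env ^+ 2 + sigma_rep ^+ 2 / q%:R.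

Definition diff z z' : Omega -> R := fun w => -1 * f z' w + f z w.

(* With r the residual of diff z z', its posterior variance is <r, f z> - <r, f z'>;
   each term is bounded, by Cauchy-Schwarz, by what one evaluation at that point reveals. *)
Lemma V_le_Vd n z z' q w : valid_eval (z, q) -> valid_eval (z', q) ->
  V_ n (diff z z') w ^+ 2 <= 2 * (lambda_ q + ip P (f z) (f z) + ip P (f z') (f z')) *
    (Vd n (z, q) (diff z z') w + Vd n (z', q) (diff z z') w).
Proof.
move=> vz vz'; set u := diff z z'; set p := path n w; have vp : valid_path p by exact: path_valid.
have [zT zt qQ] := vz; have [zT' zt' _] := vz'.
have pz : prior_span (f z) by exact: prior_span_f.
have pz' : prior_span (f z') by exact: prior_span_f.
have pu : prior_span u by exact: (prior_span_linear f Theta T).2.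
have gp := gauss_path vp.
have oY Y : List.In Y (outcomes p) -> path_space p Y by exact: outcomes_path_space.
have prior_path v : prior_span v -> path_space p v by exact: path_space_prior.
set r := residual P (outcomes p) u.
have pr : path_space p r by apply: (residual_in gp) => //; exact: prior_path.
have key y : valid_eval (y, q) -> prior_span (f y) ->
    ip P r (f y) ^+ 2 <= Vd n (y, q) u w * (lambda_ q + ip P (f y) (f y)).
  move=> vy py; have vyp := valid_cons vy vp; have gyp := gauss_path vyp.
  have pN := path_space_noise f eps_env eps_rep Theta T (y, q) p.
  have YE : outcome (size p) (y, q) = (fun w => 1 * noise (size p) q w + f y w).
    by apply/funext => w'; rewrite /outcome /noise/=; ring.
  have pf : path_space ((y, q) :: p) (f y) by exact: path_space_prior.
  have prS : path_space ((y, q) :: p) r by exact: path_space_consW.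
  (* The noise of the next step is orthogonal to the prior and to all earlier noise, so a noisy
     outcome at [y] has the same covariance with the error as [f y] itself. *)
  have N0 v : path_space p v -> ip P v (noise (size p) q) = 0.
    by move=> pv; exact: (noise_orthogonal f_gp eps_env_law eps_rep_law indep vp vy pv).
  have rY : ip P r (outcome (size p) (y, q)) = ip P r (f y).
    by rewrite YE (ipDr gyp)// N0// mulr0 add0r.
  have YY : ip P (outcome (size p) (y, q)) (outcome (size p) (y, q)) =
      lambda_ q + ip P (f y) (f y).
    rewrite YE (ip_sqrD gyp)// (ipC P (noise (size p) q) (f y)) (N0 _ (prior_path _ py)).
    rewrite mulr0 addr0.
    by rewrite expr1n mul1r (noise_var eps_env_law eps_rep_law indep).
  rewrite -rY -YY.
  have := increment_var_ge (Y := outcome (size p) (y, q)) (Ys := outcomes p) gyp.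
  rewrite /Vd -/p size_path; apply; last exact: path_space_prior.
  by move=> Z; have := @outcomes_path_space_cons (y, q) p Z vy vp; rewrite size_path.
have VE : V_ n u w = - ip P r (f z') + ip P r (f z).
  rewrite /V_ -/p -/r -[LHS](residual_ip gp)//; try exact: prior_path.
  by rewrite (ipDr gp)// ?mulN1r//; exact: prior_path.
have hz := key z vz pz; have hz' := key z' vz' pz'.
have lz := ip_ge0 P (f z); have lz' := ip_ge0 P (f z').
have d1 : 0 <= Vd n (z, q) u w by exact: ip_ge0.
have d2 : 0 <= Vd n (z', q) u w by exact: ip_ge0.
rewrite VE; set a := ip P r (f z') in hz' *; set b := ip P r (f z) in hz *.
(* Squaring the difference costs the factor 2; the two factors [lambda_ q + ip P (f y) (f y)] are
   both enlarged to the common one of the statement. *)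
have : (- a + b) ^+ 2 <= 2 * a ^+ 2 + 2 * b ^+ 2 by have := sqr_ge0 (a + b); lra.
have := mulr_ge0 d1 lz'; have := mulr_ge0 d2 lz.
by move: hz hz'; lra.
Qed.

(** * Expected gains under the acquisition rule *)

Hypotheses (Theta_bar_neq0 : Theta_bar != fset0)
  (T_neq0 : T != fset0) (T_gt0 : forall t, t \in T -> (0 < t)%N)
  (Q_neq0 : Q != fset0) (Q_gt0 : forall q, q \in Q -> (0 < q)%N)
  (policy_argmax : forall n, {ae P, forall w,
     is_argmax (evaluations Theta_bar T Q)
       (acquisition f eps_env eps_rep policy Theta_bar T n w) (decision n w)}).

Local Notation tm := (tau_max T).

Lemma tau_max_in : tm \in T.
Proof.
case/fset0Pn: T_neq0 => t0; rewrite /tau_max.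
have inT i : (i \in T) = (i \in enum_fset T) by [].
rewrite !inT; case: (enum_fset T) => // t s _.
elim: s t => [|t' s ih] t; first by rewrite big_cons big_nil maxn0 mem_head.
rewrite big_cons; case/orP: (leq_total t (\max_(i <- t' :: s) i)) => [/maxn_idPr ->|/maxn_idPl ->].
  by rewrite in_cons ih orbT.
exact: mem_head.
Qed.

Lemma prior_point th : th \in Theta_bar -> prior_span (f (th, tm)).
Proof.
move=> hth; apply: prior_span_f; split; last exact: tau_max_in.
exact: Theta_bar_sub.
Qed.

Lemma eval_point th q : th \in Theta_bar -> q \in Q ->
  evaluations Theta_bar T Q ((th, tm), q).
Proof. by move=> hth hq; split=> //; exact: tau_max_in. Qed.

Definition max_mu n w := fset_max Theta_bar (fun th => mu_ n (f (th, tm)) w).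
Definition max_nmu n x w := fset_max Theta_bar (fun th => nmu n x (f (th, tm)) w).
Definition gain n x w := max_nmu n x w - max_mu n w.

Lemma L1_nmu n x u : valid_eval x -> prior_span u -> L1 P (nmu n x u).
Proof.
move=> vx pu; apply: (L1_ext _ (L1D (L1_mu n pu) (L1_dmu n pu vx))) => w.
by rewrite nmuE.
Qed.

Lemma L1_max_mu n : L1 P (max_mu n).
Proof. by apply: L1_fset_max => // th hth; apply: L1_mu; exact: prior_point. Qed.

Lemma L1_max_nmu n x : valid_eval x -> L1 P (max_nmu n x).
Proof. by move=> vx; apply: L1_fset_max => // th hth; apply: L1_nmu => //; exact: prior_point. Qed.

Lemma L1_gain n x : valid_eval x -> L1 P (gain n x).
Proof. by move=> vx; apply: L1B; [exact: L1_max_nmu|exact: L1_max_mu]. Qed.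

Lemma mu_cond_exp_nmu n x u : valid_eval x -> prior_span u ->
  is_cond_exp P (filtration n) (nmu n x u) (mu_ n u).
Proof.
move=> vx pu; have [mmu _ _] := mu_cond_exp n pu.
have Lmu := L1_mu n pu; have Ld := L1_dmu n pu vx.
apply: is_cond_expP => //; [exact: history_events_measurable|exact: L1_nmu|].
move=> A FA; have mA := filtration_measurable FA.
rewrite [RHS](Ex_ext P (Y := fun w => mu_ n u w * \1_A w + dmu n x u w * \1_A w)).
  by rewrite ExD ?Ex_dmu ?addr0//; exact: L1_ind.
by move=> w; rewrite nmuE mulrDl.
Qed.

Lemma Ex_gain_ge0 n x A : valid_eval x -> filtration n A ->
  0 <= Ex P (fun w => gain n x w * \1_A w).
Proof.
move=> vx FA; have mA := filtration_measurable FA.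
under Ex_ext => w do rewrite mulrBl.
rewrite ExB; [|by apply: L1_ind => //; exact: L1_max_nmu|by apply: L1_ind => //; exact: L1_max_mu].
rewrite subr_ge0.
apply: (cond_exp_fset_max (G := history_events n) (X := fun th => nmu n x (f (th, tm)))
  (Y := fun th => mu_ n (f (th, tm)))) => //.
- exact: history_events_measurable.
- by move=> th hth; apply: L1_nmu => //; exact: prior_point.
- by move=> th hth; apply: mu_cond_exp_nmu => //; exact: prior_point.
Qed.

Lemma gain_decision n w : gain n (decision n w) w = max_mu n.+1 w - max_mu n w.
Proof.
rewrite /gain; congr (_ - _); congr fset_max; apply/funext => th.
by rewrite mu_S.
Qed.

Lemma eq_fset_max (F G : 'rV[R]_m -> R) :
  (forall th, th \in Theta_bar -> F th = G th) ->
  fset_max Theta_bar F = fset_max Theta_bar G.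
Proof.
move=> FG; apply/eqP; rewrite eq_le; apply/andP; split; apply: fset_max_le => // th hth.
  by rewrite FG//; exact: (fset_maxP G Theta_bar_neq0).2.
by rewrite -FG//; exact: (fset_maxP F Theta_bar_neq0).2.
Qed.

Lemma posterior_mean_ae n th : th \in Theta_bar ->
  {ae P, forall w, posterior_mean f eps_env eps_rep policy n (th, tm) w =
     mu_ n (f (th, tm)) w}.
Proof.
move=> hth; have pf := prior_point hth.
apply: (is_cond_exp_unique (@history_events_measurable n) (prior_L1 pf)).
  by apply: cond_expP; [exact: history_events_measurable|exact: prior_L1].
exact: mu_cond_exp.
Qed.

Lemma next_posterior_mean_cond_exp n x th : th \in Theta_bar ->
  is_cond_exp P (next_filtration n x) (f (th, tm))
    (next_posterior_mean f eps_env eps_rep policy n x (th, tm)).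
Proof.
move=> hth; apply: cond_expP; first exact: next_events_measurable.
exact/prior_L1/prior_point.
Qed.

Lemma next_posterior_mean_ae n x th : valid_eval x -> th \in Theta_bar ->
  {ae P, forall w, next_posterior_mean f eps_env eps_rep policy n x (th, tm) w =
     nmu n x (f (th, tm)) w}.
Proof.
move=> vx hth; have pf := prior_point hth.
apply: (is_cond_exp_unique (@next_events_measurable n x) (prior_L1 pf)).
  exact: next_posterior_mean_cond_exp.
exact: nmu_cond_exp.
Qed.

Lemma max_posterior_mean_ae n :
  {ae P, forall w, max_posterior_mean f eps_env eps_rep policy Theta_bar T n w = max_mu n w}.
Proof.
have h : forall th, th \in enum_fset Theta_bar -> _ := @posterior_mean_ae n.
by apply: filterS (ae_all_in h) => w hw; exact: eq_fset_max.
Qed.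

Lemma next_max_posterior_mean_ae n x : valid_eval x ->
  {ae P, forall w, next_max_posterior_mean f eps_env eps_rep policy Theta_bar T n x w =
     max_nmu n x w}.
Proof.
move=> vx.
have h : forall th, th \in enum_fset Theta_bar -> _ := fun th => @next_posterior_mean_ae n x th vx.
by apply: filterS (ae_all_in h) => w hw; exact: eq_fset_max.
Qed.

Local Notation value := (evaluation_value f eps_env eps_rep policy Theta_bar T).

(** Acquisition values are built from arbitrary versions of conditional expectations. Their
    integrals over events of the history agree with those of the explicit gain, and only such
    integrals are compared later. *)
Lemma Ex_value n x : valid_eval x -> L1 P (value n x) /\ forall A, filtration n A ->
  Ex P (fun w => value n x w * \1_A w) = Ex P (fun w => gain n x w * \1_A w).
Proof.
move=> vx.
have L1n : L1 P (next_max_posterior_mean f eps_env eps_rep policy Theta_bar T n x).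
  by apply: L1_fset_max => // th hth; have [] := next_posterior_mean_cond_exp n x hth.
have L1m : L1 P (max_posterior_mean f eps_env eps_rep policy Theta_bar T n).
  apply: L1_fset_max => // th hth.
  have [//] : is_cond_exp P (filtration n) (f (th, tm))
     (posterior_mean f eps_env eps_rep policy n (th, tm)).
  by apply: cond_expP; [exact: history_events_measurable|exact/prior_L1/prior_point].
have cE := cond_expP (@history_events_measurable n) L1n; have [_ LE _] := cE.
split; first exact: L1B.
move=> A FA; have mA := filtration_measurable FA.
under Ex_ext => w do rewrite mulrBl.
under [RHS]Ex_ext => w do rewrite mulrBl.
have Ln := L1_max_nmu n vx; have Lm := L1_max_mu n.
rewrite !ExB; try exact: L1_ind.
congr (_ - _).
  rewrite (is_cond_exp_Ex (@history_events_measurable n) L1n cE FA).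
  apply: Ex_ae; [exact: L1_ind|by apply: L1_ind => //; exact: L1_max_nmu|].
  by apply: filterS (next_max_posterior_mean_ae n vx) => w ->.
apply: Ex_ae; [exact: L1_ind|by apply: L1_ind => //; exact: L1_max_mu|].
by apply: filterS (max_posterior_mean_ae n) => w ->.
Qed.

Definition cost (x : evaluation R m) : R := x.2%:R * x.1.2%:R.

Lemma cost_ge1 x : evaluations Theta_bar T Q x -> 1 <= cost x.
Proof.
by move=> [_ /T_gt0 h1 /Q_gt0 h2]; rewrite /cost -natrM ler1n muln_gt0 h1 h2.
Qed.

(* The chosen evaluation pays for every other one, up to the ratio of costs. *)
Lemma Ex_gain_le n x : evaluations Theta_bar T Q x ->
  Ex P (gain n x) <= cost x * (Ex P (max_mu n.+1) - Ex P (max_mu n)).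
Proof.
move=> ex; have vx := eval_valid ex; have cx := cost_ge1 ex.
have mdec y : measurable (decision n @^-1` [set y]).
  by apply: (@filtration_measurable n); exact: policy_meas.
have step y : evaluations Theta_bar T Q y ->
    Ex P (fun w => gain n x w * \1_(decision n @^-1` [set y]) w) <=
    cost x * Ex P (fun w => gain n y w * \1_(decision n @^-1` [set y]) w).
  move=> ey; have vy := eval_valid ey; have cy := cost_ge1 ey.
  have [Lx Ex_x] := Ex_value n vx; have [Ly Ex_y] := Ex_value n vy.
  have Fy : filtration n (decision n @^-1` [set y]) by exact: policy_meas.
  have gx := Ex_gain_ge0 vx Fy.
  suff : cost y * Ex P (fun w => gain n x w * \1_(decision n @^-1` [set y]) w) <=
         cost x * Ex P (fun w => gain n y w * \1_(decision n @^-1` [set y]) w).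
    by apply: le_trans; rewrite ler_peMl.
  have mD := mdec y; have LxD := L1_ind mD Lx; have LyD := L1_ind mD Ly.
  rewrite -(Ex_x _ Fy) -(Ex_y _ Fy) -(ExZ (cost y) LxD) -(ExZ (cost x) LyD).
  apply: Ex_le_ae; [exact: L1Z|exact: L1Z|].
  apply: filterS (policy_argmax n) => w [_ /(_ x ex) h].
  apply: ratio_indic_le => //.
  have [/set_mem/= dw|nd] := boolP (w \in decision n @^-1` [set y]).
    by right; split; [rewrite indicE mem_set|move: h; rewrite dw].
  by left; rewrite indicE (negbTE nd).
have dec_in w : decision n w \in undup all_evals.
  by rewrite mem_undup; apply/mem_all_evals; exact: policy_in.
have L1p y : y \in undup all_evals -> L1 P (gain n y).
  by rewrite mem_undup => /mem_all_evals/eval_valid vy; exact: L1_gain.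
have -> : Ex P (gain n x) = Ex P (fun w => gain n x w * \1_(@setT Omega) w).
  by apply: Ex_ext => w; rewrite indicT mulr1.
have -> : Ex P (max_mu n.+1) - Ex P (max_mu n) =
    Ex P (fun w => gain n (decision n w) w * \1_(@setT Omega) w).
  rewrite -ExB; [|exact: L1_max_mu..].
  by apply: Ex_ext => w; rewrite indicT mulr1 gain_decision.
rewrite (paste_Ex (undup_uniq all_evals) dec_in mdec (phi := fun=> gain n x))//; last first.
  by move=> *; exact: L1_gain.
rewrite (paste_Ex (undup_uniq all_evals) dec_in mdec (phi := gain n))//.
rewrite mulr_sumr big_seq [leRHS]big_seq; apply: ler_sum => y.
rewrite mem_undup => /mem_all_evals ey; rewrite !setTI; exact: step.
Qed.

(** Jensen again. The bound does not depend on [n], which makes the nondecreasing expected maxima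
    converge. *)
Lemma Ex_max_mu_le n : Ex P (max_mu n) <= Ex P (fun w => fset_max Theta_bar (fun th => f (th, tm) w)).
Proof.
have := cond_exp_fset_max (P := P) (G := history_events n)
  (X := fun th w => f (th, tm) w) (Y := fun th => mu_ n (f (th, tm)))
  (@history_events_measurable n) Theta_bar_neq0.
move=> /(_ setT) h.
rewrite (Ex_ext P (Y := fun w => max_mu n w * \1_(@setT Omega) w)).
  rewrite [leRHS](Ex_ext P (Y := fun w => fset_max Theta_bar (fun th => f (th, tm) w)
    * \1_(@setT Omega) w)).
    apply: h; last exact: sigma_measurableT.
      by move=> th hth; exact/prior_L1/prior_point.
    by move=> th hth; apply: mu_cond_exp; exact: prior_point.
  by move=> w; rewrite indicT mulr1.
by move=> w; rewrite indicT mulr1.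
Qed.

Lemma Ex_gain_cvg0 x : evaluations Theta_bar T Q x -> Ex P (gain n x) @[n --> \oo] --> 0.
Proof.
move=> ex; have vx := eval_valid ex; have cx := cost_ge1 ex.
have g0 n : 0 <= Ex P (gain n x).
  have FT : filtration n setT by exact: sigma_measurableT.
  have := Ex_gain_ge0 vx FT.
  by rewrite (Ex_ext P (Y := gain n x))// => w; rewrite indicT mulr1.
pose e n := Ex P (max_mu n).
have nde : nondecreasing_seq e.
  apply/nondecreasing_seqP => n; rewrite -subr_ge0.
  have := le_trans (g0 n) (Ex_gain_le n ex).
  by rewrite pmulr_rge0//; lra.
have cve : cvgn e.
  apply: nondecreasing_is_cvgn => //.
  by exists (Ex P (fun w => fset_max Theta_bar (fun th => f (th, tm) w))) => _ [n _ <-];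
    exact: Ex_max_mu_le.
apply: (@squeeze_cvgr _ _ _ _ (fun=> 0) (fun n => cost x * (e n.+1 - e n))).
- by apply: nearW => n; rewrite g0 Ex_gain_le.
- exact: cvg_cst.
- rewrite -[X in _ --> X](mulr0 (cost x)) -(subrr (limn e)).
  apply: cvgMl_tmp; apply: cvgB => //.
  by rewrite (@cvg_shiftS _ e).
Qed.

(** * Posterior variance on the event that a given point leads *)

Lemma mu_sigma_measurable n u : prior_span u -> sigma_measurable (history_events n) (mu_ n u).
Proof. by move=> pu; have [] := mu_cond_exp n pu. Qed.

Lemma max_mu_sigma_measurable n : sigma_measurable (history_events n) (max_mu n).
Proof.
apply/sigma_measurableP; apply: measurable_fset_max => th hth.
by apply/sigma_measurableP; apply: mu_sigma_measurable; exact: prior_point.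
Qed.

Lemma Vd_sigma_measurable n x u : sigma_measurable (history_events n) (Vd n x u).
Proof.
apply: (paste_sigma_measurable (path_all_paths n) (phi := fun p _ =>
   ip P (increment P (outcome n x) (outcomes p) u)
        (increment P (outcome n x) (outcomes p) u))) => p B /all_paths_valid[sp vp] mB.
have Fp : filtration n (path n @^-1` [set p]).
  have : filtration (size p) (atom p) by exact: filtration_atom.
  by rewrite /atom sp.
set c := ip P _ _; have [Bc|Bc] := pselect (B c).
  rewrite (_ : _ @^-1` B = setT) ?setTI//.
  by apply/seteqP; split.
rewrite (_ : _ @^-1` B = set0) ?set0I; first exact: (@measurable0 _ (g_sigma_algebraType _)).
by apply/seteqP; split.
Qed.

(** Ties are allowed: for [ts] in [Theta_bar] these events cover the whole space but may overlap. *)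
Definition leading n ts := [set w | mu_ n (f (ts, tm)) w = max_mu n w].

Lemma filtration_leading n ts : ts \in Theta_bar -> filtration n (leading n ts).
Proof.
move=> hts; have h := sigma_measurable_lin (-1) (@max_mu_sigma_measurable n)
  (@mu_sigma_measurable n _ (prior_point hts)).
have := h [set 0] (measurable_set1 0); rewrite (_ : _ @^-1` _ = leading n ts)//.
apply/seteqP; split=> w /=; rewrite /leading/= mulN1r addrC.
  by move/eqP; rewrite subr_eq0 => /eqP.
by move=> ->; rewrite subrr.
Qed.

Lemma mu_lin n a X Y w : prior_span X -> prior_span Y ->
  mu_ n (fun w => a * X w + Y w) w = a * mu_ n X w + mu_ n Y w.
Proof. by move=> pX pY; rewrite /mu_ r_lin//; ring. Qed.

Lemma prior_diff th ts : th \in Theta_bar -> ts \in Theta_bar ->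
  prior_span (diff (th, tm) (ts, tm)).
Proof.
by move=> hth hts; apply: (prior_span_linear f Theta T).2; exact: prior_point.
Qed.

(** The new maximum is at least the new means of [th] and [ts], while the old maximum is the mean of
    [ts]. The term [dmu n x (f (ts, tm))] is common to both bounds and has zero integral over events
    of the history. *)
Lemma gain_lb n x th ts (M : R) w : valid_eval x ->
  th \in Theta_bar -> ts \in Theta_bar -> leading n ts w ->
  `|mu_ n (diff (th, tm) (ts, tm)) w| <= M ->
  Num.max (dmu n x (diff (th, tm) (ts, tm)) w - M) 0 + dmu n x (f (ts, tm)) w <= gain n x w.
Proof.
move=> vx hth hts; rewrite /leading/= => lead.
have pth := prior_point hth; have pts := prior_point hts.
rewrite /diff mu_lin// dmu_lin// ler_norml => /andP[lb _].
have h1 := (fset_maxP (fun th => nmu n x (f (th, tm)) w) Theta_bar_neq0).2 th hth.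
have h2 := (fset_maxP (fun th => nmu n x (f (th, tm)) w) Theta_bar_neq0).2 ts hts.
rewrite !nmuE in h1 h2; rewrite /gain -lead -/(max_nmu n x w).
rewrite -/(max_nmu n x w) in h1 h2.
by rewrite -lerBrDr ge_max; apply/andP; split; move: h1 h2 lb; lra.
Qed.

(** All three conditions are decided by the history up to time [n], so the Gaussian estimate for the
    change of the mean applies on this event. *)
Definition pivotal n x th ts (M beta : R) : set Omega :=
  leading n ts `&` (mu_ n (diff (th, tm) (ts, tm)) @^-1` `[- M, M] `&`
    Vd n x (diff (th, tm) (ts, tm)) @^-1` `[beta, +oo[).

Lemma filtration_pivotal n x th ts M beta : th \in Theta_bar -> ts \in Theta_bar ->
  filtration n (pivotal n x th ts M beta).
Proof.
move=> hth hts; apply: sigma_measurableI; first exact: filtration_leading.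
apply: sigma_measurableI.
  by apply: (@mu_sigma_measurable n _ (prior_diff hth hts)); exact: measurable_itv.
by apply: Vd_sigma_measurable; exact: measurable_itv.
Qed.

Lemma pivotal_gain th ts (M beta : R) : th \in Theta_bar -> ts \in Theta_bar ->
  0 <= M -> 0 < beta ->
  exists2 kappa, 0 < kappa & forall n x, evaluations Theta_bar T Q x ->
    kappa * Ex P (\1_(pivotal n x th ts M beta)) <= Ex P (gain n x).
Proof.
move=> hth hts M0 b0; have pu := prior_diff hth hts; have pts := prior_point hts.
have [kappa k0 hk] := dmu_pos_part_lb pu M0 b0; exists kappa => // n x ex.
have vx := eval_valid ex; set A := pivotal n x th ts M beta.
have FA : filtration n A by exact: filtration_pivotal.
have FAC : filtration n (~` A) by exact: sigma_measurableC.
have mA := filtration_measurable FA; have mAC := filtration_measurable FAC.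
have Lg := L1_gain n vx; have Ld := L1_dmu n pu vx; have Lts := L1_dmu n pts vx.
set u := diff (th, tm) (ts, tm) in pu hk Ld *.
have Lmax : L1 P (fun w => Num.max (dmu n x u w - M) 0).
  apply: (L1_le _ _ (L1D (L1_abs Ld) (L1_cst P M))).
    by apply: measurable_maxr => //; apply: measurable_funB => //; exact: L1_measurable Ld.
  move=> w; rewrite ger0_norm ?le_max ?lexx ?orbT// ge_max addr_ge0// andbT.
  by rewrite lerD ?ler_norm// (le_trans _ M0)// oppr_le0.
have VA w : A w -> beta <= Vd n x u w by move=> [_ [_ /=]]; rewrite in_itv/= andbT.
apply: (le_trans (hk n x A vx FA VA)).
have -> : Ex P (gain n x) =
    Ex P (fun w => gain n x w * \1_A w) + Ex P (fun w => gain n x w * \1_(~` A) w).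
  rewrite -ExD; [|exact: L1_ind..]; apply: Ex_ext => w.
  by rewrite -mulrDr !indicE in_setC; case: (w \in A); rewrite ?addr0 ?add0r mulr1.
(* Inserts a term of zero integral over [A], to match the bound of [gain_lb]. *)
have -> : Ex P (fun w => Num.max (dmu n x u w - M) 0 * \1_A w) =
    Ex P (fun w => Num.max (dmu n x u w - M) 0 * \1_A w + dmu n x (f (ts, tm)) w * \1_A w).
  by rewrite ExD ?Ex_dmu ?addr0//; exact: L1_ind.
(* The complement of [A] is an event of the history too, so the gain has a nonnegative integral
   there. *)
apply: (@le_trans _ _ (Ex P (fun w => gain n x w * \1_A w))); last first.
  by rewrite lerDl; exact: Ex_gain_ge0.
apply: Ex_le; [by apply: L1D; exact: L1_ind|exact: L1_ind|move=> w].
rewrite -mulrDl indicE; have [/set_mem [Lw [/= mw _]]|_] := boolP (w \in A); last by rewrite !mulr0.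
rewrite !mulr1; apply: gain_lb => //.
by move: mw; rewrite in_itv/= ler_norml.
Qed.

(** The error is controlled by [|r| <= 1 + r ^ 2]. The bound is uniform in [n], so that [M] can be
    fixed before [n]. *)
Lemma Ex_abs_mu_le n u : prior_span u ->
  Ex P (fun w => `|mu_ n u w|) <= Ex P (fun w => `|u w|) + 1 + ip P u u.
Proof.
move=> pu; have Lu := prior_L1 pu; have Lr2 := L1_r2 n pu; have Lm := L1_mu n pu.
have FT : filtration n setT by exact: sigma_measurableT.
have r2 : Ex P (fun w => r_ n u w ^+ 2) <= ip P u u.
  rewrite (Ex_ext P (Y := fun w => r_ n u w ^+ 2 * \1_(@setT Omega) w)).
    rewrite Ex_r2// -[leRHS](Ex_cst P); apply: Ex_le.
    - by apply: L1_ind => //; exact: L1_V.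
    - exact: L1_cst.
    - by move=> w; rewrite indicT mulr1; exact: V_le.
  by move=> w; rewrite indicT mulr1.
apply: (@le_trans _ _ (Ex P (fun w => (`|u w| + 1) + r_ n u w ^+ 2))).
  apply: Ex_le.
  - exact: L1_abs.
  - by apply: L1D => //; apply: L1D; [exact: L1_abs|exact: L1_cst].
  move=> w; rewrite /mu_; apply: (le_trans (ler_normB _ _)).
  rewrite -addrA lerD2l; have := sqr_ge0 (1 - `|r_ n u w|).
  have := normr_ge0 (r_ n u w); rewrite -(real_normK (num_real (r_ n u w))).
  by move: (`|r_ n u w|) => y; nra.
have La := L1_abs Lu; have L1' := L1_cst P 1.
by rewrite (ExD (L1D La L1') Lr2) (ExD La L1') Ex_cst lerD2l.
Qed.

Hypothesis lambda_gt0 : forall q, q \in Q -> 0 < lambda_ q.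

(* Where the mean of u is at most M and some Vd is at least beta, a gain is made;
   elsewhere V is at most b or the mean is large. *)
Lemma V_leading_le th ts q n (M b : R) : th \in Theta_bar -> ts \in Theta_bar -> q \in Q ->
  0 < M -> 0 < b -> let u := diff (th, tm) (ts, tm) in
  let beta := b ^+ 2 / (4 * (lambda_ q + ip P (f (th, tm)) (f (th, tm))
                                     + ip P (f (ts, tm)) (f (ts, tm)))) in
  forall w, V_ n u w * \1_(leading n ts) w <= b + (ip P u u / M * `|mu_ n u w| +
    ip P u u * (\1_(pivotal n ((th, tm), q) th ts M beta) w +
                \1_(pivotal n ((ts, tm), q) th ts M beta) w)).
Proof.
move=> hth hts hq M0 b0 u beta w; have B0 := ip_ge0 P u.
have pos (x : R) : 0 <= x -> 0 <= ip P u u * x by exact: mulr_ge0.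
have ind0 A : 0 <= (\1_A w : R) by rewrite indicE.
have mu0 : 0 <= ip P u u / M * `|mu_ n u w| by rewrite mulr_ge0// divr_ge0// ltW.
have piv0 := pos _ (addr_ge0 (ind0 (pivotal n (th, tm, q) th ts M beta))
                     (ind0 (pivotal n (ts, tm, q) th ts M beta))).
rewrite [\1_(leading _ _) w]indicE; have [/set_mem Lw|_] := boolP (w \in leading n ts); last first.
  by rewrite mulr0 !addr_ge0// ltW.
rewrite mulr1; have VB := @V_le n u (prior_diff hth hts) w.
have V0 := V_ge0 n u w.
(* A mean above [M] pays for the variance: [V] is at most [ip P u u], hence at most [ip P u u / M]
   times the absolute mean. *)
have [muM|muM] := ltP M `|mu_ n u w|.
  apply: (le_trans VB); rewrite -[leLHS]add0r; apply: lerD; first exact: ltW.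
  rewrite -[leLHS]addr0; apply: lerD => //.
  by rewrite -mulrA ler_peMr// mulrC ler_pdivlMr// mul1r ltW.
have mw : w \in mu_ n u @^-1` `[- M, M] by rewrite inE/= in_itv/= -ler_norml.
have big x : beta <= Vd n x u w -> \1_(pivotal n x th ts M beta) w = 1 :> R.
  move=> h; rewrite indicE (_ : _ \in _)// inE; split=> //; split; first exact: set_mem.
  by rewrite /= in_itv/= h.
have [v1|v1] := leP beta (Vd n ((th, tm), q) u w).
  apply: (le_trans VB); rewrite -[leLHS]add0r; apply: lerD; first exact: ltW.
  rewrite -[leLHS]add0r; apply: lerD => //.
  by rewrite (big _ v1) ler_peMr// lerDl.
have [v2|v2] := leP beta (Vd n ((ts, tm), q) u w).
  apply: (le_trans VB); rewrite -[leLHS]add0r; apply: lerD; first exact: ltW.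
  rewrite -[leLHS]add0r; apply: lerD => //.
  by rewrite (big _ v2) ler_peMr// lerDr.
rewrite -[leLHS]addr0; apply: lerD; last exact: addr_ge0.
(* Neither evaluation would reveal a variance of [beta]; through [V_le_Vd], [beta] is chosen so that
   this forces [V <= b]. *)
apply: (le_of_sqr_le_split _ b0 V0 _ v1 v2).
  by rewrite ltr_wpDr ?ip_ge0// ltr_wpDr ?ip_ge0// lambda_gt0.
by apply: V_le_Vd; apply: eval_valid; exact: eval_point.
Qed.

Lemma Ex_V_leading_cvg0 th ts : th \in Theta_bar -> ts \in Theta_bar ->
  Ex P (fun w => V_ n (diff (th, tm) (ts, tm)) w * \1_(leading n ts) w) @[n --> \oo] --> 0.
Proof.
move=> hth hts; have [q hq] := fset0Pn _ Q_neq0.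
have pu := prior_diff hth hts; set u := diff (th, tm) (ts, tm) in pu *.
have ex1 := eval_point hth hq; have ex2 := eval_point hts hq.
set x1 := ((th, tm), q) in ex1; set x2 := ((ts, tm), q) in ex2.
set B := ip P u u; have B0 : 0 <= B by exact: ip_ge0.
set K := Ex P (fun w => `|u w|) + 1 + B.
have K0 : 0 < K by rewrite ltr_wpDr// ltr_wpDl// Ex_ge0.
apply/cvgr0Pnorm_lt => e e0.
have B1 : 0 < B + 1 by rewrite ltr_wpDl.
(* Order of choice: [e] determines [M] and [b = e / 4], these determine [beta], then [kappa], and
   [n] comes last. With [K] bounding the mean of [|mu|], this [M] keeps the contribution of large
   means below or equal to [e / 4]. *)
have M0 : 0 < 4 * (B + 1) * K / e by rewrite divr_gt0 ?mulr_gt0.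
have b0 : 0 < e / 4 by rewrite divr_gt0.
have := fun n => @V_leading_le th ts q n _ _ hth hts hq M0 b0.
set M := 4 * (B + 1) * K / e in M0 *; set beta := _ / (4 * _) => /= Vle.
have beta0 : 0 < beta.
  rewrite divr_gt0 ?exprn_gt0// mulr_gt0//.
  by rewrite ltr_wpDr ?ip_ge0// ltr_wpDr ?ip_ge0// lambda_gt0.
have [kappa k0 hk] := pivotal_gain hth hts (ltW M0) beta0.
have d0 : 0 < e * kappa / (8 * (B + 1)) by rewrite divr_gt0 ?mulr_gt0.
have c1 := Ex_gain_cvg0 ex1; have c2 := Ex_gain_cvg0 ex2.
move/cvgr0Pnorm_lt : c1 => /(_ _ d0) c1; move/cvgr0Pnorm_lt : c2 => /(_ _ d0) c2.
near=> n.
have g1 : `|Ex P (gain n x1)| < e * kappa / (8 * (B + 1)) by near: n.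
have g2 : `|Ex P (gain n x2)| < e * kappa / (8 * (B + 1)) by near: n.
have mL : measurable (leading n ts) by apply: filtration_measurable; exact: filtration_leading.
rewrite ger0_norm; last by apply: Ex_ge0 => w; rewrite mulr_ge0 ?V_ge0// indicE.
have Lm := L1_abs (L1_mu n pu).
have L1p x : L1 P (\1_(pivotal n x th ts M beta)).
  apply: L1_bdd; last by move=> w; exact: indic_le1.
  by apply: measurable_indicR; apply: (@filtration_measurable n); exact: filtration_pivotal.
have i1 := le_lt_trans (le_trans (hk n x1 ex1) (ler_norm _)) g1.
have i2 := le_lt_trans (le_trans (hk n x2 ex2) (ler_norm _)) g2.
apply: (@le_lt_trans _ _ (e / 4 + (B / M * Ex P (fun w => `|mu_ n u w|) +
   B * (Ex P (\1_(pivotal n x1 th ts M beta)) + Ex P (\1_(pivotal n x2 th ts M beta)))))).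
  have Ls := L1D (L1p x1) (L1p x2).
  rewrite -(ExD (L1p x1) (L1p x2)) -(ExZ B Ls) -(ExZ (B / M) Lm) -(ExD (L1Z _ Lm) (L1Z _ Ls)).
  rewrite -{1}(Ex_cst P (e / 4)) -(ExD (L1_cst _ _) (L1D (L1Z _ Lm) (L1Z _ Ls))).
  apply: Ex_le => //.
  - by apply: L1_ind => //; exact: L1_V.
  - by apply: L1D; [exact: L1_cst|apply: L1D; exact: L1Z].
have := Ex_abs_mu_le n pu; rewrite -/B -/K => muK.
exact: V_leading_budget muK i1 i2.
Unshelve. all: by end_near. Qed.

Lemma r_diff n th th' ts w : th \in Theta_bar -> th' \in Theta_bar -> ts \in Theta_bar ->
  r_ n (diff (th, tm) (th', tm)) w =
  r_ n (diff (th, tm) (ts, tm)) w - r_ n (diff (th', tm) (ts, tm)) w.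
Proof.
by move=> h1 h2 h3; rewrite /diff !r_lin; [ring|exact: prior_point..].
Qed.

Lemma leading_cover n w : exists2 ts, ts \in Theta_bar & leading n ts w.
Proof.
have [[ts hts E] _] := fset_maxP (fun th => mu_ n (f (th, tm)) w) Theta_bar_neq0.
by exists ts => //; rewrite /leading/= -E.
Qed.

(** Where [ts] leads, the error of the pair is the difference of two errors relative to [ts].
    Overlaps of the leading events only add nonnegative terms, and since these events belong to the
    history, squared errors integrate there like variances. *)
Lemma Ex_r2_diff_le n th th' : th \in Theta_bar -> th' \in Theta_bar ->
  Ex P (fun w => r_ n (diff (th, tm) (th', tm)) w ^+ 2) <=
  \sum_(ts <- enum_fset Theta_bar)
    (2 * Ex P (fun w => V_ n (diff (th, tm) (ts, tm)) w * \1_(leading n ts) w) +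
     2 * Ex P (fun w => V_ n (diff (th', tm) (ts, tm)) w * \1_(leading n ts) w)).
Proof.
move=> hth hth'.
pose F ts w := 2 * (r_ n (diff (th, tm) (ts, tm)) w ^+ 2 * \1_(leading n ts) w) +
               2 * (r_ n (diff (th', tm) (ts, tm)) w ^+ 2 * \1_(leading n ts) w).
(* Extended by 0 because [Ex_sum] asks for integrability at every index. *)
pose G ts := if ts \in Theta_bar then F ts else fun=> 0.
have mL ts : ts \in Theta_bar -> measurable (leading n ts).
  by move=> hts; apply: filtration_measurable; exact: filtration_leading.
have L1r t ts : t \in Theta_bar -> ts \in Theta_bar ->
    L1 P (fun w => r_ n (diff (t, tm) (ts, tm)) w ^+ 2 * \1_(leading n ts) w).
  move=> ht hts; apply: L1_ind; first exact: mL.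
  by apply: L1_r2; exact: prior_diff.
have LG ts : L1 P (G ts).
  rewrite /G; case: ifP => [hts|_]; last exact: L1_cst.
  by apply: L1D; apply: L1Z; exact: L1r.
have -> : \sum_(ts <- enum_fset Theta_bar)
    (2 * Ex P (fun w => V_ n (diff (th, tm) (ts, tm)) w * \1_(leading n ts) w) +
     2 * Ex P (fun w => V_ n (diff (th', tm) (ts, tm)) w * \1_(leading n ts) w)) =
  \sum_(ts <- enum_fset Theta_bar) Ex P (G ts).
  apply: eq_big_seq => ts hts; have {}hts : ts \in Theta_bar by [].
  rewrite /G hts /F (ExD (L1Z 2 (L1r _ _ hth hts)) (L1Z 2 (L1r _ _ hth' hts))).
  rewrite (ExZ 2 (L1r _ _ hth hts)) (ExZ 2 (L1r _ _ hth' hts)).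
  by rewrite !Ex_r2//; [exact: prior_diff|exact: filtration_leading|
    exact: prior_diff|exact: filtration_leading].
rewrite -(Ex_sum _ LG); apply: Ex_le; [|exact: L1_sum|move=> w].
  by apply: L1_r2; exact: prior_diff.
have G0 ts : 0 <= G ts w.
  rewrite /G; case: ifP => // _; rewrite /F.
  by rewrite addr_ge0// mulr_ge0// mulr_ge0 ?sqr_ge0// indicE.
have [ts hts lts] := leading_cover n w.
rewrite (big_rem ts)//=; apply: (@le_trans _ _ (G ts w)); last first.
  by rewrite lerDl sumr_ge0.
rewrite /G hts /F indicE mem_set// !mulr1 (r_diff n _ hth hth' hts).
by have := sqr_ge0 (r_ n (diff (th, tm) (ts, tm)) w + r_ n (diff (th', tm) (ts, tm)) w);
  move: (r_ _ _ _) (r_ n (diff (th', tm) _) _) => a b; nra.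
Qed.

Lemma Ex_r2_cvg0 th th' : th \in Theta_bar -> th' \in Theta_bar ->
  Ex P (fun w => r_ n (diff (th, tm) (th', tm)) w ^+ 2) @[n --> \oo] --> 0.
Proof.
move=> hth hth'.
have le n := @Ex_r2_diff_le n _ _ hth hth'.
apply: (@squeeze_cvgr _ _ _ _ (fun=> 0) (fun n => \sum_(ts <- enum_fset Theta_bar)
    (2 * Ex P (fun w => V_ n (diff (th, tm) (ts, tm)) w * \1_(leading n ts) w) +
     2 * Ex P (fun w => V_ n (diff (th', tm) (ts, tm)) w * \1_(leading n ts) w)))).
- apply: nearW => n; apply/andP; split; last exact: le.
  by apply: Ex_ge0 => w; exact: sqr_ge0.
- exact: cvg_cst.
apply: cvg0_sum => ts hts; have {}hts : ts \in Theta_bar by [].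
rewrite -[X in _ --> X](addr0 0); apply: cvgD.
  by rewrite -[X in _ --> X](mulr0 2); apply: cvgMl_tmp; exact: Ex_V_leading_cvg0.
by rewrite -[X in _ --> X](mulr0 2); apply: cvgMl_tmp; exact: Ex_V_leading_cvg0.
Qed.

Lemma Ex_abs_r_cvg0 th th' : th \in Theta_bar -> th' \in Theta_bar ->
  Ex P (fun w => `|r_ n (diff (th, tm) (th', tm)) w|) @[n --> \oo] --> 0.
Proof.
move=> hth hth'; have pu := prior_diff hth hth'.
apply/cvgr0Pnorm_lt => e e0; have e2 : 0 < e ^+ 2 / 4 by rewrite divr_gt0 ?exprn_gt0.
move/cvgr0Pnorm_lt : (Ex_r2_cvg0 hth hth') => /(_ _ e2) c.
near=> n.
have cn : `|Ex P (fun w => r_ n (diff (th, tm) (th', tm)) w ^+ 2)| < e ^+ 2 / 4 by near: n.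
have {}cn := le_lt_trans (ler_norm _) cn.
rewrite ger0_norm; last exact: Ex_ge0.
have Lr2 := L1_r2 n pu; have La := L1_abs (L1_r n pu).
(* [y <= e / 4 + y ^ 2 / e], which is [(y - e / 2) ^ 2 >= 0] divided by [e]. *)
apply: (@le_lt_trans _ _ (e / 4 + e^-1 * Ex P (fun w => r_ n (diff (th, tm) (th', tm)) w ^+ 2))).
  rewrite -(ExZ e^-1 Lr2) -{1}(Ex_cst P (e / 4)) -(ExD (L1_cst _ _) (L1Z _ Lr2)).
  apply: Ex_le => //; first by apply: L1D; [exact: L1_cst|exact: L1Z].
  move=> w; rewrite -(real_normK (num_real (r_ n _ w))); move: `|_| => y.
  rewrite -(ler_pM2l e0) mulrDr (mulrA e e^-1) divff ?gt_eqF// mul1r.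
  by have := sqr_ge0 (y - e / 2); nra.
move: cn; move: (Ex _ _) => z cn.
rewrite -(ltr_pM2l e0) mulrDr (mulrA e e^-1) divff ?gt_eqF// mul1r.
by rewrite expr2 in cn; have := mulr_gt0 e0 e0; lra.
Unshelve. all: by end_near. Qed.

(** * Almost sure convergence by a maximal inequality *)

Fixpoint crossed n u (s eps : R) N : set Omega :=
  if N is N'.+1 then crossed n u s eps N' `|`
     [set w | eps <= s * (mu_ (n + N') u w - mu_ n u w)]
  else set0.

Lemma filtration_le n j : filtration n `<=` filtration (n + j).
Proof.
elim: j => [|j ih]; first by rewrite addn0.
by rewrite addnS => A /ih; exact: filtration_sub.
Qed.

Lemma filtration_step n j u (s eps : R) : prior_span u ->
  filtration (n + j) [set w | eps <= s * (mu_ (n + j) u w - mu_ n u w)].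
Proof.
move=> pu.
have m1 := @mu_sigma_measurable (n + j) u pu.
have m2 : sigma_measurable (history_events (n + j)) (mu_ n u).
  by move=> B mB; apply: filtration_le; exact: mu_sigma_measurable.
have m0 : sigma_measurable (history_events (n + j)) (fun=> 0 : R).
  exact: sigma_measurable_cst.
have m3 := sigma_measurable_lin s (sigma_measurable_lin (-1) m2 m1) m0.
have := m3 _ (measurable_itv `[eps, +oo[).
rewrite (_ : _ @^-1` _ = [set w | eps <= s * (mu_ (n + j) u w - mu_ n u w)])//.
by apply/seteqP; split=> w /=; rewrite in_itv/= andbT addr0 mulN1r addrC.
Qed.

Lemma filtration_crossed n u (s eps : R) N : prior_span u ->
  filtration (n + N) (crossed n u s eps N).
Proof.
move=> pu; elim: N => [|N ih] /=; first exact: (@measurable0 _ (g_sigma_algebraType _)).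
rewrite addnS; apply: filtration_sub; apply: sigma_measurableU => //.
exact: filtration_step.
Qed.

(* Doob's maximal inequality: split at the first crossing. *)
Lemma Ex_crossed_le n u (s eps : R) N : prior_span u ->
  eps * Ex P (\1_(crossed n u s eps N)) <=
  s * Ex P (fun w => r_ n u w * \1_(crossed n u s eps N) w).
Proof.
move=> pu; elim: N => [|N ih] /=.
  rewrite indic0 Ex_cst mulr0 (Ex_ext P (Y := fun=> 0)) ?Ex_cst ?mulr0// => w.
  by rewrite mulr0.
set A := crossed _ _ _ _ N in ih *; set B := [set w | _].
have FA : filtration (n + N) A by exact: filtration_crossed.
have FB : filtration (n + N) B by exact: filtration_step.
have FS : filtration (n + N) (B `&` ~` A).
  by apply: sigma_measurableI => //; exact: sigma_measurableC.
have mA := filtration_measurable FA; have mS := filtration_measurable FS.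
set S := B `&` ~` A in FS mS.
have LA : L1 P (\1_A : Omega -> R).
  by apply: L1_bdd; [exact: measurable_indicR|move=> w; exact: indic_le1].
have LS : L1 P (\1_S : Omega -> R).
  by apply: L1_bdd; [exact: measurable_indicR|move=> w; exact: indic_le1].
have Lr := L1_r n pu; have LrN := L1_r (n + N) pu.
have ind w : \1_(A `|` B) w = \1_A w + \1_S w :> R.
  rewrite !indicE /S in_setU in_setI in_setC.
  by case: (w \in A); case: (w \in B); rewrite /= ?addr0 ?add0r.
rewrite (Ex_ext P (ind)) (ExD LA LS).
have -> : Ex P (fun w => r_ n u w * \1_(A `|` B) w) =
    Ex P (fun w => r_ n u w * \1_A w) + Ex P (fun w => r_ n u w * \1_S w).
  by rewrite -ExD; [apply: Ex_ext => w; rewrite ind mulrDr|exact: L1_ind..].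
rewrite !mulrDr; apply: lerD => //.
(* The change of the mean from [n] to [n + N] is [r_ n u - r_ (n + N) u], and the later error
   integrates to 0 over [S], an event known at time [n + N]. Every crossing is thus charged to the
   error at time [n]. *)
have -> : Ex P (fun w => r_ n u w * \1_S w) =
    Ex P (fun w => (mu_ (n + N) u w - mu_ n u w) * \1_S w).
  rewrite [RHS](Ex_ext P (Y := fun w => r_ n u w * \1_S w - r_ (n + N) u w * \1_S w)).
    by rewrite (ExB (L1_ind mS Lr) (L1_ind mS LrN)) (Ex_r pu FS) subr0.
  by move=> w; rewrite /mu_; ring.
have LD : L1 P (fun w => (mu_ (n + N) u w - mu_ n u w) * \1_S w).
  by apply: L1_ind => //; apply: L1B; exact: L1_mu.
rewrite -(ExZ eps LS) -(ExZ s LD); apply: Ex_le; [exact: L1Z|exact: L1Z|move=> w].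
rewrite mulrA indicE; have [/set_mem [Bw _]|_] := boolP (w \in S); last by rewrite !mulr0.
by rewrite !mulr1.
Qed.

Lemma Ex_crossed_le_abs n u (s eps : R) N : prior_span u -> `|s| = 1 -> 0 < eps ->
  Ex P (\1_(crossed n u s eps N)) <= Ex P (fun w => `|r_ n u w|) / eps.
Proof.
move=> pu s1 e0; have mA : measurable (crossed n u s eps N).
  by apply: filtration_measurable; exact: filtration_crossed.
have Lr := L1_r n pu; have LA := L1_ind mA Lr; have Lr' := L1_abs Lr.
rewrite ler_pdivlMr// mulrC; apply: (le_trans (@Ex_crossed_le n u s eps N pu)).
apply: (le_trans (ler_norm _)); rewrite normrM s1 mul1r.
apply: (le_trans (Ex_abs LA)); apply: Ex_le => //; first exact: L1_abs.
by move=> w; rewrite normrM ler_piMr// ?indic_le1.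
Qed.

Fixpoint exceeds n u (eps : R) N : set Omega :=
  if N is N'.+1 then exceeds n u eps N' `|` [set w | eps <= `|r_ (n + N') u w|]
  else set0.

Lemma measurable_abs_ge (X : Omega -> R) (eps : R) : L1 P X ->
  measurable [set w | eps <= `|X w|].
Proof.
move=> LX; have mX := L1_measurable (L1_abs LX).
have := mX measurableT `[eps, +oo[%classic (measurable_itv _); rewrite setTI.
by rewrite (_ : _ @^-1` _ = [set w | eps <= `|X w|])//; apply/seteqP; split=> w /=;
  rewrite in_itv/= andbT.
Qed.

Lemma measurable_exceeds n u eps N : prior_span u -> measurable (exceeds n u eps N).
Proof.
move=> pu; elim: N => [|N ih] //=; apply: measurableU => //.
by apply: measurable_abs_ge; exact: L1_r.
Qed.

(** A difference of two errors is a change of the mean, so the triangle inequality splits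
    [eps + eps] between the error at time [n] and a crossing of sign [1] or [-1]. *)
Lemma exceeds_sub n u eps N : 0 < eps -> exceeds n u (eps + eps) N `<=`
  [set w | eps <= `|r_ n u w|] `|` (crossed n u 1 eps N `|` crossed n u (-1) eps N).
Proof.
move=> e0; elim: N => [|N ih] //= w [/ih[h|[h|h]]|h]; [by left|by right; left; left|by right; right; left|].
have [h0|h0] := leP eps `|r_ n u w|; first by left.
have : eps <= `|mu_ (n + N) u w - mu_ n u w|.
  have -> : mu_ (n + N) u w - mu_ n u w = r_ n u w - r_ (n + N) u w.
    by rewrite /mu_; ring.
  have := lerB_dist (r_ (n + N) u w) (r_ n u w); rewrite distrC; move: h h0 => /=.
  by move: `|_| `|_| `|_| => a b c; lra.
rewrite ler_normr => /orP[h1|h1]; right; [left|right]; right => /=.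
  by rewrite mul1r.
by rewrite mulN1r.
Qed.

(** The factor 3 collects Markov's inequality for the error at time [n] and the maximal inequality
    for either sign. *)
Lemma Ex_exceeds_le n u eps N : prior_span u -> 0 < eps ->
  Ex P (\1_(exceeds n u (eps + eps) N)) <= 3 * (Ex P (fun w => `|r_ n u w|) / eps).
Proof.
move=> pu e0; set K := Ex P (fun w => `|r_ n u w|) / eps.
have Lr := L1_r n pu; have La := L1_abs Lr.
have LI A : measurable A -> L1 P (\1_A : Omega -> R).
  by move=> mA; apply: L1_bdd; [exact: measurable_indicR|move=> w; exact: indic_le1].
have Lc s : L1 P (\1_(crossed n u s eps N) : Omega -> R).
  by apply: LI; apply: filtration_measurable; exact: filtration_crossed.
have LE := LI _ (@measurable_exceeds n u (eps + eps) N pu).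
have c1 := @Ex_crossed_le_abs n u 1 eps N pu (normr1 _) e0.
have c2 := @Ex_crossed_le_abs n u (-1) eps N pu (normrN1 _) e0.
have Lb := LI _ (measurable_abs_ge eps Lr).
have c3 : Ex P (\1_[set w | eps <= `|r_ n u w|]) <= K.
  rewrite /K mulrC -(ExZ eps^-1 La); apply: Ex_le => //; first exact: L1Z.
  move=> w; rewrite indicE; have [/set_mem/= h|_] := boolP (w \in _).
    by rewrite mulrC ler_pdivlMr// mul1r.
  by rewrite mulr_ge0// invr_ge0 ltW.
apply: (@le_trans _ _ (Ex P (\1_[set w | eps <= `|r_ n u w|]) +
  (Ex P (\1_(crossed n u 1 eps N)) + Ex P (\1_(crossed n u (-1) eps N))))).
  rewrite -(ExD (Lc 1) (Lc (-1))) -(ExD Lb (L1D (Lc 1) (Lc (-1)))).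
  apply: Ex_le => //; first by apply: L1D => //; exact: L1D.
  move=> w; rewrite !indicE; have [/set_mem h|_] := boolP (w \in exceeds _ _ _ _).
    have := exceeds_sub e0 h.
    by case=> [h1|[h1|h1]]; rewrite (mem_set h1)/= ?lerDl ?lerDr ?addr_ge0//
      1?addrCA ?lerDl ?addr_ge0// addrA lerDr.
  by rewrite !addr_ge0.
by rewrite -/K in c1 c2; lra.
Qed.

(** For fixed [n] the bound survives the passage of [N] to infinity by continuity of [P] from below;
    it then tends to 0 in [n] because the errors do so in L1. *)
Lemma negligible_exceeds th th' eps : th \in Theta_bar -> th' \in Theta_bar -> 0 < eps ->
  P.-negligible (\bigcap_n \bigcup_N exceeds n (diff (th, tm) (th', tm)) (eps + eps) N).
Proof.
move=> hth hth' e0; have pu := prior_diff hth hth'.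
set u := diff _ _ in pu *; set E := fun n => \bigcup_N exceeds n u (eps + eps) N.
have mE n : measurable (E n).
  by apply: bigcup_measurable => N _; exact: measurable_exceeds.
have mI : measurable (\bigcap_n E n) by exact: bigcap_measurable.
exists (\bigcap_n E n); split => //.
have PE n : (P (E n) <= (3 * (Ex P (fun w => `|r_ n u w|) / eps))%:E)%E.
  have nd : {homo (exceeds n u (eps + eps)) : a b / (a <= b)%N >-> (a <= b)%O}.
    by apply/nondecreasing_seqP => N; apply/subsetPset => w; left.
  have c := nondecreasing_cvg_mu (mu := P) (fun N => @measurable_exceeds n u (eps + eps) N pu)
    (mE n) nd.
  rewrite -(cvg_lim _ c)//; apply: lime_le; first by apply/cvg_ex; exists (P (E n)).
  apply: nearW => N /=; have := @Ex_exceeds_le n u eps N pu e0.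
  rewrite Ex_indic; last exact: measurable_exceeds.
  by rewrite -lee_fin fineK// fin_num_measure//; exact: measurable_exceeds.
have P0 n : (P (\bigcap_n E n) <= (3 * (Ex P (fun w => `|r_ n u w|) / eps))%:E)%E.
  by apply: le_trans (PE n); apply: le_measure; rewrite ?inE//; exact: bigcap_inf.
apply/eqP; rewrite eq_le measure_ge0 andbT -(fineK (fin_num_measure P _ mI)) lee_fin.
have c : (3 * (Ex P (fun w => `|r_ n u w|) / eps)) @[n --> \oo] --> 0.
  rewrite -[X in _ --> X](mulr0 3); apply: cvgMl_tmp; rewrite -[X in _ --> X](mul0r eps^-1).
  by apply: cvgMr_tmp; exact: Ex_abs_r_cvg0.
rewrite -(cvg_lim _ c)//; apply: limr_ge; first by apply/cvg_ex; exists 0.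
apply: nearW => n; rewrite -lee_fin fineK; first exact: P0.
exact: fin_num_measure.
Qed.

Lemma exceeds_lt n u eps w : (forall N, ~ exceeds n u eps N w) ->
  forall j, (n <= j)%N -> `|r_ j u w| < eps.
Proof.
move=> h j nj; rewrite ltNge; apply/negP => hj; apply: (h (j - n).+1); right => /=.
by rewrite subnKC.
Qed.

Lemma r_diff_ae_cvg0 th th' : th \in Theta_bar -> th' \in Theta_bar ->
  {ae P, forall w, r_ n (diff (th, tm) (th', tm)) w @[n --> \oo] --> 0}.
Proof.
move=> hth hth'; set u := diff _ _.
(* Countably many thresholds, so that the exceptional set stays negligible. *)
pose eps j : R := j.+1%:R^-1.
have eps0 j : 0 < eps j by rewrite invr_gt0 ltr0n.
have ne j : {ae P, forall w, ~ (\bigcap_n \bigcup_N exceeds n u (eps j + eps j) N) w}.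
  have := negligible_exceeds hth hth' (eps0 j).
  by apply: negligibleS => w /= /contrapT.
apply: filterS (ae_foralln ne) => w hw.
apply/cvgr0Pnorm_lt => e e0.
have [j hj] : exists j, eps j + eps j < e.
  have e2 : 0 < e / 2 by rewrite divr_gt0.
  have [j _ hj] := near_infty_natSinv_lt (PosNum e2); exists j.
  by have /= := hj j (leqnn j); rewrite -/(eps j); lra.
have [n hn] : exists n, forall N, ~ exceeds n u (eps j + eps j) N w.
  apply/not_existsP => h; apply: (hw j) => n _; apply: contrapT => nU; apply: (h n).
  by move=> N hN; apply: nU; exists N.
exists n => // i /= ni; apply: lt_trans hj; exact: exceeds_lt hn _ ni.
Qed.

Lemma recommendation_cvg (theta_rec : nat -> Omega -> 'rV[R]_m) :
  (forall N, {ae P, forall w,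
     is_argmax [set` Theta_bar]
       (fun th => posterior_mean f eps_env eps_rep policy N (th, tm) w) (theta_rec N w)}) ->
  {ae P, forall w, (fun N => f (theta_rec N w, tm) w) @ \oo -->
     fset_max Theta_bar (fun th => f (th, tm) w)}.
Proof.
move=> rec_argmax.
have ae_r : {ae P, forall w, forall th, th \in enum_fset Theta_bar ->
    forall th', th' \in enum_fset Theta_bar ->
    r_ n (diff (th, tm) (th', tm)) w @[n --> \oo] --> 0}.
  by apply: ae_all_in => th hth; apply: ae_all_in => th' hth'; exact: r_diff_ae_cvg0.
have ae_mu : {ae P, forall w, forall N, forall th, th \in enum_fset Theta_bar ->
    posterior_mean f eps_env eps_rep policy N (th, tm) w = mu_ N (f (th, tm)) w}.
  by apply: ae_foralln => N; apply: ae_all_in => th hth; exact: posterior_mean_ae.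
have ae_rec := ae_foralln rec_argmax.
apply: filterS2 ae_r (filterI ae_mu ae_rec) => w hr [hmu hrec].
have [[th0 hth0 Emax] maxP] := fset_maxP (fun th => f (th, tm) w) Theta_bar_neq0.
rewrite Emax in maxP *.
(* [th0] is a true maximizer. The recommended point has a posterior mean at least that of [th0], so
   its deficit in [f] is at most the error of their difference. As the recommendation varies with
   [N], this error is bounded by a sum over all points. *)
apply: (@squeeze_cvgr _ _ _ _ (fun N => f (th0, tm) w -
    \sum_(th <- enum_fset Theta_bar) `|r_ N (diff (th0, tm) (th, tm)) w|) (fun=> f (th0, tm) w)).
- apply: nearW => N; have [hin best] := hrec N.
  have hin' : theta_rec N w \in Theta_bar by [].
  rewrite maxP// andbT lerBlDr -lerBlDl.
  have le_r : r_ N (diff (th0, tm) (theta_rec N w, tm)) w <=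
      \sum_(th <- enum_fset Theta_bar) `|r_ N (diff (th0, tm) (th, tm)) w|.
    rewrite (big_rem (theta_rec N w))//=; apply: (le_trans (ler_norm _)).
    by rewrite lerDl sumr_ge0.
  have := best th0 hth0; rewrite !hmu// /mu_ => bw.
  apply: le_trans le_r; rewrite /diff r_lin; [|exact: prior_point..].
  by move: bw; lra.
- rewrite -[X in _ --> X]subr0; apply: cvgB; first exact: cvg_cst.
  apply: cvg0_sum => th hth; rewrite -[X in _ --> X](@normr0 _ R).
  by apply: cvg_norm; exact: hr.
- exact: cvg_cst.
Qed.

End posterior.

Theorem theorem1 (R : realType) (m : nat)
  (Theta : set 'rV[R]_m) (Theta_bar : {fset 'rV[R]_m}) (T Q : {fset nat})
  (Theta_bar_sub : [set` Theta_bar] `<=` Theta)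
  (Theta_bar_neq0 : Theta_bar != fset0)
  (T_neq0 : T != fset0) (T_gt0 : forall t, t \in T -> (0 < t)%N)
  (Q_neq0 : Q != fset0) (Q_gt0 : forall q, q \in Q -> (0 < q)%N)
  (d : measure_display) (Omega : measurableType d) (P : probability Omega R)
  (* prior *)
  (f : 'rV[R]_m * nat -> {RV P >-> R})
  (k : 'rV[R]_m * nat -> 'rV[R]_m * nat -> R)
  (f_gp : gaussian_process [set x | Theta x.1 /\ x.2 \in T] f (fun=> 0) k)
  (k_smooth : smooth_kernel 4 Theta T k)
  (* noise *)
  (sigma_env sigma_rep : R)
  (lambda_gt0 : forall q, q \in Q -> 0 < sigma_env ^+ 2 + sigma_rep ^+ 2 / q%:R)
  (eps_env : nat -> {RV P >-> R}) (eps_rep : nat -> nat -> {RV P >-> R})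
  (eps_env_law : forall n, has_gaussian_law P (eps_env n) 0 (sigma_env ^+ 2))
  (eps_rep_law : forall n q, q \in Q ->
     has_gaussian_law P (eps_rep n q) 0 (sigma_rep ^+ 2 / q%:R))
  (indep : mutually_independent P (model_block f eps_env eps_rep Theta T Q))
  (* sampling decisions *)
  (policy : seq (evaluation R m * R) -> evaluation R m)
  (policy_in : forall n w,
     evaluations Theta_bar T Q (decision f eps_env eps_rep policy n w))
  (policy_meas : forall n x,
     filtration f eps_env eps_rep policy n
       (decision f eps_env eps_rep policy n @^-1` [set x]))
  (policy_argmax : forall n, {ae P, forall w,
     is_argmax (evaluations Theta_bar T Q)
       (acquisition f eps_env eps_rep policy Theta_bar T n w)
       (decision f eps_env eps_rep policy n w)})
  (* recommendations *)
  (theta_rec : nat -> Omega -> 'rV[R]_m)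
  (rec_argmax : forall N, {ae P, forall w,
     is_argmax [set` Theta_bar]
       (fun th => posterior_mean f eps_env eps_rep policy N (th, tau_max T) w)
       (theta_rec N w)}) :
  {ae P, forall w,
     (fun N => f (theta_rec N w, tau_max T) w) @ \oo -->
       fset_max Theta_bar (fun th => f (th, tau_max T) w)}.
Proof.
exact: (recommendation_cvg Theta_bar_sub f_gp eps_env_law eps_rep_law indep policy_in
  policy_meas Theta_bar_neq0 T_neq0 T_gt0 Q_neq0 Q_gt0 policy_argmax lambda_gt0).
Qed.
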